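(* Let $\sigma\in C([0,\infty);\mathbb{R}^{d\times r})$ and let $A$ be a $d\times d$ real matrix all of whose eigenvalues have negative real parts. For $\xi\in\mathbb{R}^d$ let $X(\cdot,\xi)$ be the unique continuous adapted process obeying \[ dX(t)=AX(t)\,dt+\sigma(t)\,dB(t),\quad t\ge 0;\quad X(0)=\xi. \] Let $c>0$, and define \[ \varsigma_c(t)=\left(\int_t^{t+c}\|\sigma(s)\|_F^2\,ds\right)^{1/2},\quad t\ge 0, \] \[ I_c(\epsilon)=\int_0^\infty \varsigma_c(t)\exp\left(-\frac{\epsilon^2/2}{\varsigma_c(t)^2}\right)\chi_{(0,\infty)}(\varsigma_c(t))\,dt,\quad \epsilon>0. \] (A) If $I_c(\epsilon)<+\infty$ for all $\epsilon>0$, then $\lim_{t\to\infty}X(t,\xi)=0$ a.s. for each $\xi\in\mathbb{R}^d$. (B) If there exists $\epsilon'>0$ such that $I_c(\epsilon)<+\infty$ for all $\epsilon>\epsilon'$ and $I_c(\epsilon)=+\infty$ for all $0<\epsilon<\epsilon'$, then there exist deterministic $0<c_1\le c_2<+\infty$, independent of $\xi$, such that for each $\xi\in\mathbb{R}^d$ \[ c_1\le\limsup_{t\to\infty}\|X(t,\xi)\|\le c_2,\quad\text{a.s.} \] Moreover, for each $\xi\in\mathbb{R}^d$, \[ \liminf_{t\to\infty}\|X(t,\xi)\|=0,\quad \lim_{t\to\infty}\frac1t\int_0^t\|X(s,\xi)\|^2\,ds=0,\quad\text{a.s.} \] (C) If $I_c(\epsilon)=+\infty$ for all $\epsilon>0$,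 then $\limsup_{t\to\infty}\|X(t,\xi)\|=+\infty$ a.s. for each $\xi\in\mathbb{R}^d$.
   Context: $d,r$ are positive integers, $B$ is an $r$-dimensional standard Brownian motion, $\sigma$ is deterministic, $\|\cdot\|$ is the Euclidean norm on $\mathbb{R}^d$, $\|\cdot\|_F$ is the Frobenius norm on $\mathbb{R}^{d\times r}$, and $\chi_{(0,\infty)}$ is the indicator function of $(0,\infty)$, so the integrand of $I_c(\epsilon)$ is $0$ where $\varsigma_c(t)=0$. *)

(* Defs.v *)
(* MathComp / MathComp-Analysis. *)
From mathcomp Require Import all_boot all_order all_algebra.
From mathcomp Require Import all_classical all_reals all_analysis.
From mathcomp Require Export complex.

Set Implicit Arguments.
Unset Strict Implicit.
Unset Printing Implicit Defensive.

Import Order.TTheory GRing.Theory Num.Theory.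
Import numFieldNormedType.Exports.

Local Open Scope classical_set_scope.
Local Open Scope ring_scope.

(* Frobenius norm; on column vectors it is the Euclidean norm.  The library's
   norm on matrices is the sup norm, so it cannot be used here. *)
Definition fnorm (R : realType) (m n : nat) (M : 'M[R]_(m, n)) : R :=
  Num.sqrt (\sum_i \sum_j M i j ^+ 2).

Definition stable_matrix (R : realType) (d : nat) (A : 'M[R]_d) : Prop :=
  forall z : R[i], eigenvalue (map_mx (real_complex R) A) z ->
    complex.Re z < 0.

Section Processes.
Context (R : realType) (disp : measure_display) (T : measurableType disp).
Implicit Type P : probability T R.

(* Processes are indexed by R, but only times t >= 0 are ever constrained. *)

Definition filtration (Fi : R -> set (set T)) : Prop :=
  [/\ forall t, 0 <= t -> sigma_algebra [set: T] (Fi t),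
      forall t, 0 <= t -> Fi t `<=` measurable
    & forall s t, 0 <= s -> s <= t -> Fi s `<=` Fi t].

Definition adapted (n : nat) (Fi : R -> set (set T))
    (X : R -> T -> 'cV[R]_n) : Prop :=
  forall t, 0 <= t -> forall (i : 'I_n) (U : set R), measurable U ->
    Fi t [set w | U (X t w i 0)].

Definition ae_continuous_paths (n : nat) P (X : R -> T -> 'cV[R]_n) : Prop :=
  {ae P, forall w, {within `[0, +oo[, continuous (fun t => X t w)}}.

(* Independent increments and their law are stated together: for s < t the
   increment B t - B s is independent of Fi s, and its coordinates are
   independent with law N(0, t - s).  The second parameter of [normal_prob] is
   the standard deviation. *)
Definition brownian_motion (r : nat) P (Fi : R -> set (set T))
    (B : R -> T -> 'cV[R]_r) : Prop :=
  [/\ adapted Fi B,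
      {ae P, forall w, B 0 w = 0},
      ae_continuous_paths P B
    & forall s t, 0 <= s -> s < t ->
      forall (E : set T) (U : 'I_r -> set R),
        Fi s E -> (forall i, measurable (U i)) ->
        P (E `&` [set w | forall i, U i ((B t w - B s w) i 0)]) =
        (P E * \prod_(i < r) normal_prob 0 (Num.sqrt (t - s)) (U i))%E].

(* Deterministic matrix-valued step functions
   \sum_i 1_(knot i, knot i.+1] * coef i on (0, t]. *)
Record step_fun (d r : nat) (t : R) := StepFun {
  pieces : nat;
  knot : nat -> R;
  coef : nat -> 'M[R]_(d, r);
  knot_first : knot 0%N = 0;
  knot_last : knot pieces = t;
  knot_le : forall i, (i < pieces)%N -> knot i <= knot i.+1 }.

Definition step_eval (d r : nat) (t : R) (h : step_fun d r t) (s : R) :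
    'M[R]_(d, r) :=
  \sum_(i < pieces h) (\1_(`]knot h i, knot h i.+1]%classic) s : R) *: coef h i.

Definition step_integral (d r : nat) (B : R -> T -> 'cV[R]_r) (t : R)
    (h : step_fun d r t) (w : T) : 'cV[R]_d :=
  \sum_(i < pieces h) coef h i *m (B (knot h i.+1) w - B (knot h i) w).

(* Y is a version of the Ito integral of the deterministic integrand f over
   [0, t]: the limit in L^2(P) of the elementary integrals of some sequence of
   step functions converging to f in L^2([0, t]). *)
Definition is_stoch_integral (d r : nat) P (B : R -> T -> 'cV[R]_r)
    (f : R -> 'M[R]_(d, r)) (t : R) (Y : T -> 'cV[R]_d) : Prop :=
  (forall i : 'I_d, measurable_fun [set: T] (fun w => Y w i 0)) /\
  exists h : nat -> step_fun d r t,
    (\int[lebesgue_measure]_(s in `[0%R, t])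
        ((fnorm (step_eval (h k) s - f s)) ^+ 2)%:E @[k --> \oo] --> 0)%E /\
    (\int[P]_w ((fnorm (step_integral B (h k) w - Y w)) ^+ 2)%:E
        @[k --> \oo] --> 0)%E.

(* X is a continuous adapted process with
   X(t) = xi + \int_0^t A X(s) ds + \int_0^t sigma(s) dB(s), t >= 0. *)
Definition affine_sde_solution (d r : nat) P (Fi : R -> set (set T))
    (B : R -> T -> 'cV[R]_r) (A : 'M[R]_d) (sigma : R -> 'M[R]_(d, r))
    (xi : 'cV[R]_d) (X : R -> T -> 'cV[R]_d) : Prop :=
  [/\ adapted Fi X,
      ae_continuous_paths P X
    & forall t, 0 <= t -> exists2 Y : T -> 'cV[R]_d,
        is_stoch_integral P B sigma t Y &
        {ae P, forall w, X t w = xi +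
          \col_i \int[lebesgue_measure]_(s in `[0, t]) (A *m X s w) i 0
          + Y w}].

End Processes.

Definition varsigma (R : realType) (d r : nat) (sigma : R -> 'M[R]_(d, r))
    (c t : R) : R :=
  Num.sqrt (\int[lebesgue_measure]_(s in `[t, t + c]) (fnorm (sigma s) ^+ 2)).

Definition Ic (R : realType) (d r : nat) (sigma : R -> 'M[R]_(d, r))
    (c eps : R) : \bar R :=
  (\int[lebesgue_measure]_(t in `[0%R, +oo[)
    (varsigma sigma c t * expR (- ((eps ^+ 2 / 2) / varsigma sigma c t ^+ 2))
     * \1_(`]0%R, +oo[%classic) (varsigma sigma c t))%:E)%E.

(* Main.v *)
Require Import Defs.
From mathcomp Require Import all_boot all_order all_algebra.
From mathcomp Require Import all_classical all_reals all_analysis.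
From mathcomp Require Import measurable_realfun.
From mathcomp Require Import mxred spectral.
From mathcomp Require Import ring lra.

Import Order.TTheory GRing.Theory Num.Theory.
Import numFieldNormedType.Exports.

Set Implicit Arguments.
Unset Strict Implicit.
Unset Printing Implicit Defensive.

Local Open Scope classical_set_scope.
Local Open Scope ring_scope.

(** Write [M t = X t - xi - \int_0^t A X] for the forcing term, which is a continuous
    version of the integral of [sigma] against the Brownian motion. Time is cut into
    blocks [[n h, (n + 1) h]]; [v_n] denotes the integral of the squared norm of
    [sigma] over block [n], and [u_n] the supremum over the block of the coordinates
    of [M - M (n h)]. Everything is read off the sequence [u_n].

    Path by path. By Lyapunov's theorem ([lyapunov]) some quadratic form decreases
    exponentially along [x' = A x]. It yields numbers [W_n >= 0] with
    [W_(n+1) <= rho W_n + C u_n^2], [rho < 1], and [|X|^2 <= C (W_n + u_n^2)] on block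
    [n] ([path_bound]). So an eventual bound on [u_n] bounds the limsup of [|X|], and
    if the averages of [u_n^2] tend to zero, so do those of [|X|^2]. Conversely,
    [M ((n + 1) h) - M (n h)] is an increment of [X] minus an integral of [A X] over
    the block, so that large increments of [M] infinitely often force large values
    of [X] infinitely often.

    Probability. For one block and one coordinate, the probability that [M - M (n h)]
    leaves [[- y, y]] is at most [2 exp (- y^2 / (16 v_n))] ([large_incr_prob]).
    On the other hand, the probability that no increment over the blocks considered
    exceeds [y] is at most the product of the [1 - k exp (- 256 d y^2 / v_n)], for
    some absolute constant [k > 0] ([stoch_integral_all_small]). Both bounds come from
    the exponential moments of sums of Brownian increments over a grid of times
    ([grid_mgf]), by stopping at the first passage above a level for the first and by
    a Paley-Zygmund argument for the second; they pass to the stochastic integral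
    by approximation ([approx_grid]). The constants are far from optimal, which
    is harmless: (A) and (C) quantify over all [eps], and (B) claims only that some
    [c1] and [c2] exist.

    The criterion. If [Ic eps] is finite, the series of [exp (- eps^2 / v_n)] converges
    for [h = c / 2] ([Ic_finite_sum]); if it is infinite, the series of
    [exp (- eps^2 / (4 v_n))] diverges for [h = c] ([sum_Ic_finite]). With the two
    Borel-Cantelli lemmas this gives the bounds on the limsup in (A), (B) and (C).

    The mean square in (B). Here only some series of [exp (- K / v_n)] with a large [K]
    converges, whereas [u_n > y] must be rare for every [y > 0]. The [m]-th power of the
    weight [exp (- y^2 / (16 v_n))] is summable for large [m], and then these weights
    are summable after division by [n + 1] ([weighted_sum]). By Kronecker's lemma the
    blocks where [u_n > y] have density zero; since [u_n] is also eventually bounded,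
    the averages of [u_n^2] tend to zero. A vanishing mean square brings the path
    back near the origin at arbitrarily late times, hence the zero liminf. *)

(** * Integrals of products of independent factors *)

Section Density.
Context (R : realType) (d1 d2 : measure_display)
  (T1 : measurableType d1) (T2 : measurableType d2).
Context (mu : {measure set T1 -> \bar R}) (nu : {measure set T2 -> \bar R}).
Context (W : T1 -> R) (phi : T1 -> T2).
Hypothesis mphi : measurable_fun [set: T1] phi.
Hypothesis mW : measurable_fun [set: T1] W.
Hypothesis W0 : forall x, 0 <= W x.
Hypothesis Wnu : forall U, measurable U ->
  (\int[mu]_(x in phi @^-1` U) (W x)%:E = nu U)%E.
Import HBNNSimple.

Lemma integral_density_nnsfun (g : {nnsfun T2 >-> R}) :
  (\int[mu]_x ((W x)%:E * (g (phi x))%:E) = \int[nu]_y (g y)%:E)%E.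
Proof.
have mpre U : measurable U -> measurable (phi @^-1` U).
  by move=> mU; rewrite -[X in measurable X]setTI; exact: mphi.
transitivity (\int[mu]_x (\sum_(k \in range g)
    (k%:E * ((W x)%:E * (\1_(phi @^-1` (g @^-1` [set k])) x)%:E))))%E.
  apply: eq_integral => x _; rewrite fimfunE -fsumEFin// ge0_mule_fsumr; last first.
    by move=> k; rewrite EFinM nnfun_muleindic_ge0.
  by apply: eq_fsbigr => k _; rewrite EFinM muleCA.
have k0 k x : (0 <= k%:E * ((W x)%:E * (\1_(phi @^-1` (g @^-1` [set k])) x)%:E))%E.
  have [k0|k0] := leP 0 k.
    by rewrite !mule_ge0 ?lee_fin.
  by rewrite preimage_nnfun0// preimage_set0 indic0 mule0 mule0.
rewrite ge0_integral_fsum//; last first.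
  move=> k; apply: measurable_funeM; apply: emeasurable_funM; first exact/measurable_EFinP.
  by apply/measurable_EFinP; apply: measurable_indic; apply: mpre.
rewrite integralT_nnsfun sintegralE; apply: eq_fsbigr => k /[!inE] -[y _ yk].
have kge0 : 0 <= k by rewrite -yk.
rewrite ge0_integralZl//; last 2 first.
  - apply: emeasurable_funM; first exact/measurable_EFinP.
    by apply/measurable_EFinP; apply: measurable_indic; apply: mpre.
  - by move=> x _; rewrite mule_ge0 ?lee_fin.
congr (_ * _)%E; rewrite -Wnu//.
rewrite [RHS]integral_mkcond; apply: eq_integral => x _.
by rewrite epatch_indic.
Qed.

(** The measure of density [W] is carried by [phi] to [nu] on sets, hence on simple
    functions, hence on nonnegative functions by monotone convergence. *)
Lemma integral_density (f : T2 -> \bar R) : measurable_fun [set: T2] f ->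
  (forall y, 0 <= f y)%E ->
  (\int[mu]_x ((W x)%:E * f (phi x)) = \int[nu]_y f y)%E.
Proof.
move=> mf f0; pose g := nnsfun_approx measurableT mf.
have gf y : EFin \o g ^~ y @ \oo --> f y.
  by apply: cvg_nnsfun_approx.
have ndg y : nondecreasing_seq (fun n => (g n y)%:E).
  by move=> a b ab; rewrite lee_fin; exact/lefP/nd_nnsfun_approx.
transitivity (limn (fun n => \int[nu]_y (g n y)%:E))%E; last first.
  rewrite -monotone_convergence//=.
  - by apply: eq_integral => y _; apply/cvg_lim => //; exact: gf.
  - by move=> n; exact/measurable_EFinP.
  - by move=> n x _; rewrite lee_fin.
transitivity (limn (fun n => \int[mu]_x ((W x)%:E * (g n (phi x))%:E)))%E; last first.
  by congr (limn _); apply/funext => n; exact: integral_density_nnsfun.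
rewrite -monotone_convergence//=.
- apply: eq_integral => x _; apply/esym/cvg_lim => //.
  by apply: cvgeMl; [|exact: gf].
- move=> n; apply: emeasurable_funM; first exact/measurable_EFinP.
  apply/measurable_EFinP.
  exact: measurableT_comp.
- by move=> n x _; rewrite mule_ge0 ?lee_fin.
- move=> x _ a b ab; rewrite lee_wpmul2l ?lee_fin//; exact: ndg.
Qed.

End Density.

(** The indicators of events are replaced by the functions [f i] one coordinate at
    a time: [integral_density] does it for one coordinate, the density being the
    product of the factors of all the others. *)
Lemma integral_prod_of_events (R : realType) (d : measure_display)
    (T : measurableType d) (P : probability T R) (I : finType)
    (xi : I -> T -> R) (nu : I -> probability (measurableTypeR R) R) (E : set T)
    (f : I -> R -> R) (m : I -> R) :
  measurable E -> (forall i, measurable_fun [set: T] (xi i)) ->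
  (forall U : I -> set R, (forall i, measurable (U i)) ->
    P (E `&` [set w | forall i, U i (xi i w)]) =
    (P E * \prod_i nu i (U i))%E) ->
  (forall i, measurable_fun [set: R] (f i)) -> (forall i x, 0 <= f i x) ->
  (forall i, \int[nu i]_x (f i x)%:E = (m i)%:E)%E ->
  (\int[P]_w (\1_E w * \prod_i f i (xi i w))%:E =
   (fine (P E) * \prod_i m i)%:E)%E.
Proof.
move=> mE mxi PE mf f0 fm.
have fU i V : measurable V -> nu i V \is a fin_num.
  by move=> mV; exact: (fin_num_measure (nu i) V mV).
(* The first [k] coordinates carry their function, the others still an
   indicator; [G] is the corresponding mean. *)
pose F k (U : I -> set R) (i : I) x := if (enum_rank i < k)%N then f i x else \1_(U i) x.
pose G k (U : I -> set R) (i : I) := if (enum_rank i < k)%N then m i else fine (nu i (U i)).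
have m0 i : 0 <= m i by rewrite -lee_fin -fm; apply: integral_ge0 => x _; rewrite lee_fin.
have G0 k U i : 0 <= G k U i by rewrite /G; case: ifPn => // _; exact: fine_ge0.
have F0 k U i x : 0 <= F k U i x by rewrite /F; case: ifPn.
have mF k U i : measurable (U i) -> measurable_fun [set: R] (F k U i).
  by move=> mU; rewrite /F; case: (ltnP (enum_rank i) k) => _ //; exact: measurable_indic.
suff claim k : (k <= #|I|)%N -> forall U : I -> set R, (forall i, measurable (U i)) ->
    (\int[P]_w (\1_E w * \prod_i F k U i (xi i w))%:E =
     (fine (P E) * \prod_i G k U i)%:E)%E.
  have := claim #|I| (leqnn #|I|) (fun=> set0) (fun=> measurable0).
  have -> : \prod_i G #|I| (fun=> set0) i = \prod_i m i.
    by apply: eq_bigr => i _; rewrite /G ltn_ord.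
  move=> <-; apply: eq_integral => w _; congr ((_ * _)%:E).
  by apply: eq_bigr => i _; rewrite /F ltn_ord.
elim: k => [_|k IH kr] U mU.
  transitivity (P (E `&` [set w | forall i, U i (xi i w)])).
    have mS : measurable (E `&` [set w | forall i, U i (xi i w)]).
      apply: measurableI => //.
      rewrite (_ : mkset _ = \bigcap_(i in [set: I]) (xi i @^-1` U i)).
        apply: fin_bigcap_measurable => // i _.
        by rewrite -[X in measurable X]setTI; exact: mxi.
      by apply/seteqP; split=> w /= h i => [_|]; exact: h.
    rewrite -[X in _ = P X]setIT -integral_indic//; apply: eq_integral => w _.
    congr (_%:E); rewrite indicI/=; congr (_ * _).
    rewrite indicE; case: (pselect (forall i, U i (xi i w))) => h.
      by rewrite mem_set//= big1// => i _; rewrite /F/= indicE mem_set.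
    rewrite memNset//=; move/existsNP: h => [i Ui].
    by rewrite (bigD1 i)//= /F/= indicE memNset// mul0r.
  rewrite PE// EFinM fineK ?fin_num_measure//; congr (_ * _)%E.
  rewrite -prodEFin; apply: eq_bigr => i _.
  by rewrite /G/= fineK; [|exact: (fU i _ (mU i))].
pose k0 : I := enum_val (Ordinal kr).
have rk0 : enum_rank k0 = k :> nat by rewrite /k0 enum_valK.
have rkS i : i != k0 -> (enum_rank i < k.+1)%N = (enum_rank i < k)%N.
  move=> ik; rewrite ltnS leq_eqVlt; case: eqP => //= rik; case/eqP: ik.
  by apply: enum_rank_inj; apply: val_inj; rewrite /= rik rk0.
pose U' (V : set R) i := if i == k0 then V else U i.
have mU' V : measurable V -> forall i, measurable (U' V i).
  by move=> mV i; rewrite /U'; case: ifPn.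
(* [k0] is the coordinate that changes at this step. *)
pose W w := \1_E w * \prod_(i | i != k0) F k U i (xi i w).
pose C := fine (P E) * \prod_(i | i != k0) G k U i.
have C0 : 0 <= C by rewrite mulr_ge0 ?fine_ge0// prodr_ge0.
have W0 w : 0 <= W w by rewrite mulr_ge0// prodr_ge0.
have mW : measurable_fun [set: T] W.
  apply: measurable_funM; first exact: measurable_indic.
  under eq_fun do rewrite big_mkcond/=.
  apply: measurable_prod => i _; case: (i != k0) => //.
  by apply: measurableT_comp => //; exact: mF.
have FS V i x : i != k0 -> F k.+1 V i x = F k V i x.
  by move=> ik; rewrite /F rkS.
have GS V i : i != k0 -> G k.+1 V i = G k V i.
  by move=> ik; rewrite /G rkS.
have key V : measurable V ->
    (\int[P]_(w in xi k0 @^-1` V) (W w)%:E = mscale (NngNum C0) (nu k0) V)%E.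
  move=> mV; rewrite integral_mkcond.
  have := IH (ltnW kr) (U' V) (mU' V mV).
  rewrite /mscale/= (bigD1 k0)//= [G _ _ k0]/G rk0 ltnn /U' eqxx mulrCA mulrC EFinM.
  rewrite fineK; last exact: fU.
  have -> : \prod_(i | i != k0) G k (U' V) i = \prod_(i | i != k0) G k U i.
    by apply: eq_bigr => i ik; rewrite /G /U' (negbTE ik).
  move=> <-; apply: eq_integral => w _; rewrite epatch_indic -EFinM.
  congr (_%:E); rewrite (bigD1 k0)//= [F _ _ k0 _]/F rk0 ltnn /U' eqxx mulrCA [RHS]mulrC.
  rewrite /W; congr (_ * _ * _).
  by apply: eq_bigr => i ik; rewrite /F /U' (negbTE ik).
have := integral_density (T2 := measurableTypeR R) (nu := mscale (NngNum C0) (nu k0)) (mxi k0) mW W0 key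
  (f := fun x => (f k0 x)%:E).
rewrite ge0_integral_mscale//; last 2 first.
  - by apply/measurable_EFinP; exact: mf.
  - by move=> x _; rewrite lee_fin.
rewrite fm => eqI; transitivity (C%:E * (m k0)%:E)%E; last first.
  rewrite -EFinM (bigD1 k0)//= [G _ _ k0]/G rk0 ltnSn mulrCA mulrC /C.
  congr (_%:E); congr (_ * (_ * _)); apply: eq_bigr => i ik; rewrite GS//.
apply: etrans (eqI _ _); last 2 first.
  - by apply/measurable_EFinP; exact: mf.
  - by move=> x; rewrite lee_fin.
apply: eq_integral => w _; rewrite -EFinM; congr (_%:E).
rewrite (bigD1 k0)//= [F _ _ k0 _]/F rk0 ltnSn mulrCA mulrC /W.
by congr (_ * _ * _); apply: eq_bigr => i ik; rewrite FS//.
Qed.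

(** * Brownian increments over a grid of times *)

(** Completing the square turns the integrand into a constant times the density
    of another normal law. *)
Lemma normal_mgf (R : realType) (s a : R) : s != 0 ->
  (\int[normal_prob 0 s]_x (expR (a * x))%:E = (expR (a ^+ 2 * s ^+ 2 / 2))%:E)%E.
Proof.
move=> s0; pose mu := @lebesgue_measure R.
have mexp : measurable_fun [set: measurableTypeR R] (fun x : R => (expR (a * x))%:E).
  by apply/measurable_EFinP; apply: measurableT_comp => //; exact: measurable_funM.
have mpdf : measurable_fun [set: measurableTypeR R] (normal_pdf 0 s).
  exact: measurable_normal_pdf.
have exp0 (x : R) : (0 <= (expR (a * x))%:E)%E by rewrite lee_fin expR_ge0.
rewrite -(@integral_density R _ _ (measurableTypeR R) (measurableTypeR R) mu
  (normal_prob 0 s) (normal_pdf 0 s) id (@measurable_id _ _ _) mpdf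
  (normal_pdf_ge0 0 s) (fun _ _ => erefl) _ mexp exp0).
transitivity (\int[mu]_x ((expR (a ^+ 2 * s ^+ 2 / 2))%:E *
    (normal_pdf (a * s ^+ 2) s x)%:E))%E.
  apply: eq_integral => x _; rewrite -!EFinM; congr (_%:E).
  rewrite /normal_pdf (negbTE s0) -[LHS]mulrA [RHS]mulrCA; congr (_ * _).
  rewrite /normal_fun -!expRD; congr expR.
  by field; rewrite s0.
rewrite ge0_integralZl//.
- by rewrite integral_normal_pdf mule1.
- by apply/measurable_EFinP; exact: measurable_normal_pdf.
- by move=> x _; rewrite lee_fin normal_pdf_ge0.
Qed.

Section Brownian.
Context (R : realType) (disp : measure_display) (T : measurableType disp)
  (P : probability T R) (r : nat) (Fi : R -> set (set T))
  (B : R -> T -> 'cV[R]_r).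
Hypothesis hFi : filtration Fi.
Hypothesis hB : brownian_motion P Fi B.

(** Measurability at time [t] is measurability on the type that carries [Fi t] as
    sigma-algebra, so that the closure properties of measurable functions apply. *)
Definition Fi_measurable (t : R) (f : T -> R) :=
  measurable_fun [set: g_sigma_algebraType (Fi t)] (f : g_sigma_algebraType (Fi t) -> R).

Lemma FiE t (A : set T) : 0 <= t ->
  measurable (A : set (g_sigma_algebraType (Fi t))) = Fi t A.
Proof.
move=> t0; have [sFi _ _] := hFi.
by rewrite measurable_g_measurableTypeE//; exact: sFi.
Qed.

Lemma Fi_measurableP t f (V : set R) : 0 <= t -> Fi_measurable t f ->
  measurable V -> Fi t (f @^-1` V).
Proof. by move=> t0 mf mV; rewrite -FiE// -[X in measurable X]setTI; exact: mf. Qed.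

Lemma sub_Fi_measurable t A : 0 <= t -> Fi t A -> measurable A.
Proof. by move=> t0; have [_ h _] := hFi; exact: h. Qed.

Lemma Fi_measurable_funT t f : 0 <= t -> Fi_measurable t f ->
  measurable_fun [set: T] f.
Proof.
move=> t0 mf _ V mV; rewrite setTI; apply: (sub_Fi_measurable t0).
exact: Fi_measurableP.
Qed.

Lemma le_Fi s t A : 0 <= s -> s <= t -> Fi s A -> Fi t A.
Proof. by move=> s0 st; have [_ _ h] := hFi; exact: h. Qed.

Lemma brownian_Fi_measurable s t l : 0 <= s -> s <= t ->
  Fi_measurable t (fun w => B s w l 0).
Proof.
move=> s0 st _ V mV; have t0 := le_trans s0 st.
rewrite setTI FiE//; apply: (le_Fi s0 st).
by have [aB _ _ _] := hB; exact: aB.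
Qed.

Definition brownian_incr (s t : R) (l : 'I_r) (w : T) : R := (B t w - B s w) l 0.

Lemma brownian_incr_Fi_measurable s u t l : 0 <= s -> 0 <= u -> s <= t -> u <= t ->
  Fi_measurable t (brownian_incr s u l).
Proof.
move=> s0 u0 st ut; rewrite /brownian_incr /Fi_measurable.
rewrite (_ : (fun w => _) = (fun w => B u w l 0) \- (fun w => B s w l 0)); last first.
  by apply/funext => w; rewrite !mxE.
by apply: measurable_funB; exact: brownian_Fi_measurable.
Qed.

Section Grid.
Variables (N : nat) (tau : nat -> R).
Hypothesis tau0 : 0 <= tau 0%N.
Hypothesis tau_lt : forall i, (i < N)%N -> tau i < tau i.+1.

Lemma tau_le i j : (i <= j)%N -> (j <= N)%N -> tau i <= tau j.
Proof.
elim: j => [|j IH]; first by rewrite leqn0 => /eqP ->.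
rewrite leq_eqVlt => /predU1P[-> //|ij jN].
by rewrite (le_trans (IH ij (ltnW jN)))// ltW// tau_lt.
Qed.

Lemma tau_ge0 i : (i <= N)%N -> 0 <= tau i.
Proof. by move=> iN; rewrite (le_trans tau0)// tau_le. Qed.

Let nu i : probability (measurableTypeR R) R :=
  normal_prob 0 (Num.sqrt (tau i.+1 - tau i)).

(** Each cell is independent of the events of the earlier cells, which belong to
    its past. *)
Lemma grid_events k m E (U : nat -> 'I_r -> set R) : (k + m <= N)%N ->
  Fi (tau k) E -> (forall i l, measurable (U i l)) ->
  P (E `&` [set w | forall i, (i < m)%N ->
      forall l, U i l (brownian_incr (tau (k + i)) (tau (k + i).+1) l w)]) =
  (P E * \prod_(i < m) \prod_(l < r) nu (k + i)%N (U i l))%E.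
Proof.
move=> + FE mU; elim: m => [_|m IH kmN].
  rewrite big_ord0 mule1 (_ : mkset _ = setT) ?setIT//.
  by apply/seteqP; split.
have kN : (k + m < N)%N by rewrite addnS in kmN.
have km0 : 0 <= tau (k + m) by apply: tau_ge0; exact: ltnW.
rewrite big_ord_recr/= muleA -(IH (ltnW kN)).
have [_ _ _ /(_ _ _ km0 (tau_lt kN))<-] := hB; last exact: mU.
  rewrite -setIA; congr (P (_ `&` _)); apply/seteqP; split => w /=.
    move=> h; split; first by move=> i im; apply: h; exact: ltnW.
    by move=> l; apply: h.
  move=> [h1 h2] i; rewrite ltnS leq_eqVlt => /predU1P[->//|]; exact: h1.
rewrite -FiE// ; apply: measurableI.
  by rewrite FiE//; apply: le_Fi FE; [apply: tau_ge0; apply: leq_trans (ltnW kN); exact: leq_addr|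
    apply: tau_le; [exact: leq_addr|exact: ltnW]].
rewrite (_ : mkset _ = \bigcap_(i in `I_m) \bigcap_(l in [set: 'I_r])
   (brownian_incr (tau (k + i)) (tau (k + i).+1) l @^-1` U i l)); last first.
  by apply/seteqP; split => w /= h i im => [l _|l]; apply: h.
apply: fin_bigcap_measurable => [|i /= im]; first exact: finite_II.
apply: fin_bigcap_measurable => // l _.
rewrite FiE//; apply: Fi_measurableP => //.
have kim : (k + i < k + m)%N by rewrite ltn_add2l.
apply: brownian_incr_Fi_measurable.
- by apply: tau_ge0; rewrite (leq_trans (ltnW kim))// ltnW.
- by apply: tau_ge0; rewrite (leq_trans kim)// ltnW.
- by apply: tau_le; rewrite ltnW.
- by apply: tau_le => //; rewrite ltnW.
Qed.

(** The increments over the cells after [tau k] are independent of [E] and of each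
    other, so that the mean of the exponential splits into normal factors. *)
Lemma grid_mgf k m E (a : nat -> 'I_r -> R) : (k <= m)%N -> (m <= N)%N ->
  Fi (tau k) E ->
  (\int[P]_w (\1_E w * expR (\sum_(k <= i < m) \sum_(l < r)
      a i l * brownian_incr (tau i) (tau i.+1) l w))%:E =
   (fine (P E) * expR (\sum_(k <= i < m)
     (\sum_(l < r) a i l ^+ 2) * (tau i.+1 - tau i) / 2))%:E)%E.
Proof.
move=> km mN FE.
have k0 : 0 <= tau k by apply: tau_ge0; exact: leq_trans mN.
pose M := (m - k)%N.
have MN : (k + M <= N)%N by rewrite subnKC.
have sumE (F : nat -> R) : \sum_(k <= i < m) F i = \sum_(i < M) F (k + i)%N.
  rewrite -[X in \sum_(X <= _ < _) _]add0n big_addn big_mkord.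
  by apply: eq_bigr => i _; rewrite addnC.
pose xi (p : 'I_M * 'I_r) := brownian_incr (tau (k + p.1)) (tau (k + p.1).+1) p.2.
have ltN (i : 'I_M) : (k + i < N)%N.
  by apply: leq_trans MN; rewrite ltn_add2l.
have := @integral_prod_of_events R _ T P _ xi (fun p => nu (k + p.1)) E
  (fun p x => expR (a (k + p.1)%N p.2 * x))
  (fun p => expR (a (k + p.1)%N p.2 ^+ 2 * (tau (k + p.1).+1 - tau (k + p.1)) / 2)).
have -> : \prod_(p : 'I_M * 'I_r)
    expR (a (k + p.1)%N p.2 ^+ 2 * (tau (k + p.1).+1 - tau (k + p.1)) / 2) =
    expR (\sum_(k <= i < m) (\sum_(l < r) a i l ^+ 2) * (tau i.+1 - tau i) / 2).
  rewrite -expR_sum; congr expR.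
  rewrite sumE [RHS](eq_bigr (fun i : 'I_M => \sum_(l < r)
    a (k + i)%N l ^+ 2 * (tau (k + i).+1 - tau (k + i)) / 2)); last first.
    by move=> i _; rewrite !mulr_suml.
  by rewrite pair_big/=.
move=> <-.
- apply: eq_integral => w _; congr ((_ * _)%:E).
  rewrite -expR_sum; congr expR.
  rewrite sumE pair_big/=.
  by [].
- exact: sub_Fi_measurable FE.
- move=> [i l]; rewrite /xi/=; apply: (@Fi_measurable_funT (tau (k + i).+1)).
    by apply: tau_ge0; exact: ltN.
  apply: brownian_incr_Fi_measurable => //.
  + by apply: tau_ge0; exact: ltnW (ltN i).
  + by apply: tau_ge0; exact: ltN.
  + by apply: ltW; apply: tau_lt.
- move=> U mU; pose U' (i : nat) (l : 'I_r) := if insub i is Some j then U (j, l) else set0.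
  have := grid_events (U := U') MN FE.
  have -> : (\prod_(i < M) \prod_(l < r) nu (k + i)%N (U' i l) =
     \prod_(p : 'I_M * 'I_r) nu (k + p.1)%N (U p))%E.
    rewrite pair_big/=; apply: eq_bigr => -[i l] _; congr (nu _ _).
    by rewrite /U' valK.
  move=> <-.
    congr (P (_ `&` _)); apply/seteqP; split => w /=.
      by move=> h i iM l; rewrite /U' insubT; exact: (h (Ordinal iM, l)).
    by move=> h [i l]; have := h i (ltn_ord i) l; rewrite /U' valK.
  by move=> i l; rewrite /U'; case: insubP.
- by move=> p; apply: measurableT_comp => //; exact: measurable_funM.
- by move=> p x; exact: expR_ge0.
- move=> [i l]/=; have d0 : 0 < tau (k + i).+1 - tau (k + i) by rewrite subr_gt0 tau_lt.
  rewrite normal_mgf ?sqr_sqrtr// ?ltW//.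
  by rewrite gt_eqF// sqrtr_gt0.
Qed.

End Grid.
End Brownian.

(** * Maximal inequality and lower tail bound for sums over a grid *)

Lemma measurable_gt (R : realType) (d : measure_display) (T : measurableType d)
    (f : T -> R) (c : R) : measurable_fun [set: T] f -> measurable [set w | c < f w].
Proof.
move=> mf; rewrite (_ : mkset _ = f @^-1` `]c, +oo[).
  by rewrite -[X in measurable X]setTI; exact: mf.
by apply/seteqP; split=> w /=; rewrite in_itv/= andbT.
Qed.

Lemma measure_bigsetU_le (R : realType) (d : measure_display)
    (T : measurableType d) (mu : {measure set T -> \bar R}) (I : Type)
    (s : seq I) (D : I -> set T) : (forall i, measurable (D i)) ->
  (mu (\big[setU/set0]_(i <- s) D i) <= \sum_(i <- s) mu (D i))%E.
Proof.
move=> mD; elim: s => [|i s IH]; first by rewrite !big_nil measure0.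
rewrite !big_cons (le_trans (measureU2 _ _ _))//; last by rewrite leeD2l.
exact: bigsetU_measurable.
Qed.

Lemma le_integral_real (R : realType) (d : measure_display) (T : measurableType d)
    (mu : {measure set T -> \bar R}) (D : set T) (f g : T -> R) : measurable D ->
  measurable_fun D f -> measurable_fun D g ->
  (forall x, D x -> 0 <= f x) -> (forall x, D x -> f x <= g x) ->
  (\int[mu]_(x in D) (f x)%:E <= \int[mu]_(x in D) (g x)%:E)%E.
Proof.
move=> mD mf mg f0 fg; apply: ge0_le_integral => //.
- exact/measurable_EFinP.
- exact/measurable_EFinP.
Qed.

Lemma integral_realZl (R : realType) (d : measure_display) (T : measurableType d)
    (mu : {measure set T -> \bar R}) (D : set T) (k : R) (f : T -> R) : measurable D ->
  measurable_fun D f -> 0 <= k -> (forall x, D x -> 0 <= f x) ->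
  (\int[mu]_(x in D) (k * f x)%:E = k%:E * \int[mu]_(x in D) (f x)%:E)%E.
Proof.
move=> mD mf k0 f0; rewrite -ge0_integralZl//; exact/measurable_EFinP.
Qed.

Lemma integral_realD (R : realType) (d : measure_display) (T : measurableType d)
    (mu : {measure set T -> \bar R}) (D : set T) (f g : T -> R) : measurable D ->
  measurable_fun D f -> measurable_fun D g ->
  (forall x, D x -> 0 <= f x) -> (forall x, D x -> 0 <= g x) ->
  (\int[mu]_(x in D) (f x + g x)%:E =
   \int[mu]_(x in D) (f x)%:E + \int[mu]_(x in D) (g x)%:E)%E.
Proof.
move=> mD mf mg f0 g0; rewrite -ge0_integralD//; exact/measurable_EFinP.
Qed.

(** Lower bound for the conditional probability that a sum of variance [V] exceeds
    [x], see [grid_tail_lower]; it vanishes with the variance. *)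
Definition tail_lower (R : realType) (x V : R) : R :=
  if 0 < V then expR (- 16 * (1 + x ^+ 2 / V)) / 4 else 0.

Lemma tail_lower_itv (R : realType) (x V : R) : 0 <= tail_lower x V <= 1.
Proof.
rewrite /tail_lower; case: ifP => [V0|]; last by rewrite lexx ler01.
rewrite divr_ge0 ?expR_ge0//= ler_pdivrMr// mul1r (@le_trans _ _ 1) ?ler1n//.
rewrite -[leRHS]expR0 ler_expR mulNr oppr_le0 mulr_ge0// addr_ge0//.
by rewrite divr_ge0 ?sqr_ge0// ltW.
Qed.

Lemma le_tail_lower (R : realType) (x V V' : R) : V <= V' -> tail_lower x V <= tail_lower x V'.
Proof.
move=> VV'; have [V0|V0] := ltP 0 V; last first.
  by rewrite {1}/tail_lower ltNge V0/=; have /andP[] := tail_lower_itv x V'.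
rewrite /tail_lower V0 (lt_le_trans V0 VV') ler_pM2r ?invr_gt0// ler_expR.
rewrite !mulNr lerN2 ler_pM2l// lerD2l ler_wpM2l ?sqr_ge0//.
by rewrite lef_pV2 ?posrE// (lt_le_trans V0).
Qed.

Section GridBounds.
Context (R : realType) (disp : measure_display) (T : measurableType disp)
  (P : probability T R) (r : nat) (Fi : R -> set (set T))
  (B : R -> T -> 'cV[R]_r).
Hypothesis hFi : filtration Fi.
Hypothesis hB : brownian_motion P Fi B.
Variables (N : nat) (tau : nat -> R).
Hypothesis tau0 : 0 <= tau 0%N.
Hypothesis tau_lt : forall i, (i < N)%N -> tau i < tau i.+1.

Definition gridS (k m : nat) (a : nat -> 'I_r -> R) (w : T) : R :=
  \sum_(k <= i < m) \sum_(l < r) a i l * brownian_incr B (tau i) (tau i.+1) l w.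

Definition gridV (k m : nat) (a : nat -> 'I_r -> R) : R :=
  \sum_(k <= i < m) (\sum_(l < r) a i l ^+ 2) * (tau i.+1 - tau i).

Lemma gridV_ge0 k m a : (m <= N)%N -> 0 <= gridV k m a.
Proof.
move=> mN; rewrite /gridV big_nat; apply: sumr_ge0 => i /andP[ki im].
apply: mulr_ge0; first by apply: sumr_ge0 => l _; exact: sqr_ge0.
by rewrite subr_ge0 ltW// tau_lt// (leq_trans im).
Qed.

Lemma gridS_cat k m n a w : (k <= m)%N -> (m <= n)%N ->
  gridS k n a w = gridS k m a w + gridS m n a w.
Proof. by move=> km mn; rewrite /gridS (big_cat_nat km mn). Qed.

Lemma gridSZ c k m a w : gridS k m (fun i l => c * a i l) w = c * gridS k m a w.
Proof.
rewrite /gridS mulr_sumr; apply: eq_bigr => i _; rewrite mulr_sumr.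
by apply: eq_bigr => l _; rewrite mulrA.
Qed.

Lemma gridVZ c k m a : gridV k m (fun i l => c * a i l) = c ^+ 2 * gridV k m a.
Proof.
rewrite /gridV mulr_sumr; apply: eq_bigr => i _; rewrite mulrA mulr_sumr.
by congr (_ * _); apply: eq_bigr => l _; rewrite exprMn.
Qed.

Lemma gridS_Fi k m a : (m <= N)%N -> Fi_measurable Fi (tau m) (gridS k m a).
Proof.
move=> mN; rewrite /Fi_measurable /gridS.
under eq_fun do rewrite big_nat_cond big_mkcond/=.
apply: measurable_sum => i; rewrite andbT.
case: (boolP (k <= i < m)%N) => [/andP[_ im]|_]; last exact: measurable_cst.
apply: measurable_sum => l; apply: measurable_funM => //.
apply: (brownian_incr_Fi_measurable hFi hB).
- by apply: (tau_ge0 tau0 tau_lt); rewrite (leq_trans (ltnW im)).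
- by apply: (tau_ge0 tau0 tau_lt); rewrite (leq_trans im).
- by apply: (tau_le tau_lt) => //; exact: ltnW.
- exact: (tau_le tau_lt).
Qed.

Lemma gridS_measurable k m a : (m <= N)%N -> measurable_fun [set: T] (gridS k m a).
Proof.
move=> mN; apply: (Fi_measurable_funT hFi (t := tau m)); last exact: gridS_Fi.
exact: tau_ge0 mN.
Qed.

Lemma gridS_mgf c k m E a : (k <= m)%N -> (m <= N)%N -> Fi (tau k) E ->
  (\int[P]_w (\1_E w * expR (c * gridS k m a w))%:E =
   (fine (P E) * expR (c ^+ 2 * gridV k m a / 2))%:E)%E.
Proof.
move=> km mN FE.
have := grid_mgf hFi hB tau0 tau_lt (fun i l => c * a i l) km mN FE.
rewrite -gridVZ /gridV -mulr_suml => <-.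
by apply: eq_integral => w _; rewrite -gridSZ.
Qed.

(** Exponential maximal inequality: at the first passage above [x] the rest of
    the sum is independent of the past and has exponential moment at least 1. *)
Lemma grid_max_pos (p q : nat) a (th x : R) : (p <= q)%N -> (q <= N)%N -> 0 < th ->
  (P [set w | exists2 l, (p <= l <= q)%N & (x < gridS p l a w)%R] <=
   (expR (- (th * x) + th ^+ 2 * gridV p q a / 2))%:E)%E.
Proof.
move=> pq qN th0.
(* [D l]: the first passage above [x] happens at index [l]. *)
pose D0 l := [set w | x < gridS p l a w] `&`
  \bigcap_(j in [set j | (p <= j < l)%N]) [set w | gridS p j a w <= x].
pose D l := if (p <= l <= q)%N then D0 l else set0.
have DE0 l : (p <= l <= q)%N -> D l = D0 l by rewrite /D => ->.
have tq l : (p <= l <= q)%N -> 0 <= tau l.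
  by move=> /andP[_ lq]; apply: (tau_ge0 tau0 tau_lt); exact: leq_trans qN.
have FD l : (p <= l <= q)%N -> Fi (tau l) (D l).
  move=> plq; rewrite DE0// -(FiE hFi _ (tq l plq)); have /andP[pl lq] := plq.
  apply: measurableI.
    rewrite (_ : [set w | _] = gridS p l a @^-1` `]x, +oo[); last first.
      by apply/seteqP; split=> w /=; rewrite in_itv/= andbT.
    rewrite -[X in measurable X]setTI; apply: gridS_Fi => //.
    exact: leq_trans qN.
  apply: fin_bigcap_measurable => [|j /= /andP[pj jl]].
    by apply: sub_finite_set (finite_II l) => j /= /andP[].
  have jN : (j <= N)%N by rewrite (leq_trans (ltnW jl))// (leq_trans lq).
  rewrite (_ : [set w | _] = gridS p j a @^-1` `]-oo, x]); last first.
    by apply/seteqP; split=> w /=; rewrite in_itv/=.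
  rewrite FiE ?tq//.
  apply: (@le_Fi _ _ _ _ hFi (tau j)).
  - exact: (tau_ge0 tau0 tau_lt).
  - by apply: (tau_le tau_lt); [exact: ltnW|exact: leq_trans qN].
  apply: (Fi_measurableP hFi) => //; last exact: gridS_Fi.
  exact: (tau_ge0 tau0 tau_lt).
have mD l : measurable (D l).
  have [plq|nplq] := boolP (p <= l <= q)%N; last by rewrite /D (negbTE nplq).
  by apply: (sub_Fi_measurable hFi (tq l plq)); exact: FD.
have DE : [set w | exists2 l, (p <= l <= q)%N & (x < gridS p l a w)%R] =
    \big[setU/set0]_(p <= l < q.+1) D l.
  rewrite -bigcup_seq; apply/seteqP; split=> w; last first.
    move=> [l /=]; rewrite mem_index_iota ltnS => plq.
    by rewrite DE0// => -[Sl _]; exists l.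
  move=> [l plq Sl].
  have exl : exists l, (p <= l <= q)%N && (x < gridS p l a w) by exists l; rewrite plq.
  case: (ex_minnP exl) => l0 /andP[plq0 Sl0] minl0.
  exists l0 => /=; first by rewrite mem_index_iota ltnS.
  rewrite DE0//; split=> // j /= /andP[pj jl]; rewrite leNgt; apply/negP => Sj.
  have : (l0 <= j)%N.
    apply: minl0; rewrite pj Sj/= andbT; case/andP: plq0 => _ l0q.
    by rewrite ltnW// (leq_trans jl).
  by rewrite leqNgt jl.
have Ddisj w : \sum_(p <= l < q.+1) \1_(D l) w <= 1 :> R.
  have [[l0 pl0 Dl0]|nD] := pselect (exists2 l, l \in index_iota p q.+1 & D l w).
    rewrite (bigD1_seq l0) ?iota_uniq//= indicE mem_set// big1_seq ?addr0//.
    move=> l /andP[ll0 pl]; rewrite indicE memNset// => Dl.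
    rewrite !mem_index_iota !ltnS in pl0 pl; rewrite !DE0// in Dl Dl0.
    case/andP: pl0 => pl0 _; case/andP: pl => pl _.
    move: ll0; rewrite neq_ltn => /orP[ll|ll].
      by case: Dl0 => _ /(_ l); rewrite /= pl ll => /(_ isT); rewrite leNgt; case: Dl => ->.
    by case: Dl => _ /(_ l0); rewrite /= pl0 ll => /(_ isT); rewrite leNgt; case: Dl0 => ->.
  rewrite big1_seq// => l /andP[_ pl]; rewrite indicE memNset// => Dl.
  by apply: nD; exists l.
have mA : measurable (\big[setU/set0]_(p <= l < q.+1) D l).
  exact: bigsetU_measurable.
(* On [D l] the exponential of the whole sum is at least [expR (th * x)] times
   the exponential of the rest of the sum, whose mean given [D l] is at least 1. *)
have main : (\sum_(p <= l < q.+1) (expR (th * x))%:E * P (D l) <=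
    (expR (th ^+ 2 * gridV p q a / 2))%:E)%E.
  have mexp c k m : (m <= N)%N -> measurable_fun [set: T] (fun w => expR (c * gridS k m a w)).
    move=> mN; apply: measurableT_comp => //; apply: measurable_funM => //.
    exact: gridS_measurable.
  have F0 : Fi (tau p) setT.
    have p0 := tau_ge0 tau0 tau_lt (leq_trans pq qN).
    by rewrite -(FiE hFi _ p0).
  have := gridS_mgf th a pq qN F0; rewrite probability_setT/= mul1r => <-.
  apply: (@le_trans _ _ (\sum_(p <= l < q.+1)
      \int[P]_w (\1_(D l) w * expR (th * gridS p q a w))%:E)%E).
    rewrite big_seq [leRHS]big_seq; apply: lee_sum => l; rewrite mem_index_iota ltnS => plq.
    have [pl lq] := andP plq.
    apply: (@le_trans _ _ ((expR (th * x))%:E *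
        \int[P]_w (\1_(D l) w * expR (th * gridS l q a w))%:E)%E).
      rewrite gridS_mgf; [|by []|by []|exact: FD]. apply: lee_wpmul2l; first by rewrite lee_fin expR_ge0.
      rewrite EFinM fineK ?fin_num_measure ?mD// lee_pemulr ?measure_ge0//.
      rewrite lee_fin -[leLHS]expR0 ler_expR divr_ge0// mulr_ge0 ?sqr_ge0//.
      exact: gridV_ge0.
    have mDexp k : (k <= q)%N -> measurable_fun [set: T]
        (fun w => \1_(D l) w * expR (th * gridS k q a w)).
      move=> _; apply: measurable_funM; last exact: mexp.
      by apply: measurable_indic; exact: mD.
    have Dexp0 k w : 0 <= \1_(D l) w * expR (th * gridS k q a w).
      by rewrite mulr_ge0 ?expR_ge0.
    rewrite -integral_realZl// ?expR_ge0//; last exact: mDexp.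
    apply: le_integral_real => //.
    - by apply: measurable_funM => //; exact: mDexp.
    - exact: mDexp.
    - move=> w _; rewrite indicE.
      case: (boolP (w \in D l)) => [/set_mem|]; last by rewrite !mul0r mulr0.
      rewrite DE0// => -[/= Sx _].
      rewrite !mul1r -expRD ler_expR (gridS_cat _ _ pl lq) mulrDr lerD2r.
      by rewrite ler_pM2l// ltW.
  rewrite -ge0_integral_sum//; last first.
  - move=> l; apply/measurable_EFinP; apply: measurable_funM; last exact: mexp.
    by apply: measurable_indic; exact: mD.
  under eq_integral do rewrite sumEFin -mulr_suml.
  have mI : measurable_fun [set: T] (fun w => \sum_(p <= l < q.+1) \1_(D l) w : R).
    by apply: measurable_sum => l; apply: measurable_indic; exact: mD.
  apply: le_integral_real => //.
  - by apply: measurable_funM => //; exact: mexp.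
  - by apply: measurable_funM; [exact: measurable_indic|exact: mexp].
  - by move=> w _; rewrite mulr_ge0 ?expR_ge0// sumr_ge0.
  - by move=> w _; rewrite indicT mul1r ler_piMl ?expR_ge0.
have sub : (P [set w | exists2 l, (p <= l <= q)%N & (x < gridS p l a w)%R] <=
    \sum_(p <= l < q.+1) P (D l))%E.
  by rewrite DE; exact: measure_bigsetU_le.
apply: (le_trans sub).
rewrite expRD expRN EFinM lee_pdivlMl ?expR_gt0// ge0_sume_distrr//.
Qed.

Lemma grid_max (p q : nat) a (th x : R) : (p <= q)%N -> (q <= N)%N -> 0 < th ->
  (P [set w | exists2 l, (p <= l <= q)%N & (x < `|gridS p l a w|)%R] <=
   (2 * expR (- (th * x) + th ^+ 2 * gridV p q a / 2))%:E)%E.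
Proof.
move=> pq qN th0.
have meas b : measurable [set w | exists2 l, (p <= l <= q)%N & (x < gridS p l b w)%R].
  rewrite (_ : mkset _ = \bigcup_(l in [set l | (p <= l <= q)%N])
    (gridS p l b @^-1` `]x, +oo[)); last first.
    by apply/seteqP; split=> w [l plq] /= Sl; exists l => //; move: Sl; rewrite /= in_itv/= andbT.
  apply: bigcup_measurable => l /= /andP[_ lq].
  rewrite -[X in measurable X]setTI; apply: gridS_measurable => //.
  exact: leq_trans qN.
rewrite (_ : mkset _ =
    [set w | exists2 l, (p <= l <= q)%N & (x < gridS p l a w)%R] `|`
    [set w | exists2 l, (p <= l <= q)%N & (x < gridS p l (fun i l => -1 * a i l) w)%R]); last first.
  apply/seteqP; split=> w /=.
    move=> [l plq]; rewrite lter_normr => /orP[h|h]; [left|right]; exists l => //.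
    by rewrite gridSZ mulN1r.
  move=> [|] [l plq h]; exists l => //; rewrite lter_normr ?h//.
  by move: h; rewrite gridSZ mulN1r => ->; rewrite orbT.
apply: (le_trans (measureU2 _ (meas _) (meas _))).
rewrite mulr2n mulrDl mul1r EFinD; apply: leeD; first exact: grid_max_pos.
have := grid_max_pos (fun i l => -1 * a i l) x pq qN th0.
by rewrite gridVZ sqrrN expr1n mul1r.
Qed.

(** Paley-Zygmund argument for an exponential tilt: if the tilt is strong enough,
    at most half of the exponential moment comes from the part below [x], and
    Cauchy-Schwarz bounds the part above by the probability to be estimated. *)
Lemma grid_tail_lower (p q : nat) a (x : R) E : (p <= q)%N -> (q <= N)%N ->
  Fi (tau p) E -> 0 < gridV p q a ->
  (P E * (expR (- 16 * (1 + x ^+ 2 / gridV p q a)) / 4)%:E <=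
   P (E `&` [set w | (x < gridS p q a w)%R]))%E.
Proof.
move=> pq qN FE V0; set V := gridV p q a in V0 *.
have p0 := tau_ge0 tau0 tau_lt (leq_trans pq qN).
have mE : measurable E := sub_Fi_measurable hFi p0 FE.
have mS : measurable_fun [set: T] (gridS p q a) by exact: gridS_measurable.
have mG : measurable (E `&` [set w | x < gridS p q a w]).
  apply: measurableI => //; rewrite (_ : mkset _ = gridS p q a @^-1` `]x, +oo[).
    by rewrite -[X in measurable X]setTI; exact: mS.
  by apply/seteqP; split=> w /=; rewrite in_itv/= andbT.
set G := _ `&` _ in mG *.
(* The tilt [4 * z / V] works for every [x], because [z] dominates both [x] and
   the standard deviation. *)
pose z := Num.sqrt (V + x ^+ 2).
have Vx0 : 0 <= V + x ^+ 2 by rewrite addr_ge0 ?sqr_ge0 ?ltW.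
have z2 : z ^+ 2 = V + x ^+ 2 by rewrite sqr_sqrtr.
have z0 : 0 < z by rewrite sqrtr_gt0 ltr_pwDl ?sqr_ge0.
have xz : x <= z.
  by rewrite (le_trans (ler_norm _))// -sqrtr_sqr ler_sqrt// lerDr ltW.
pose th := 4 * z / V; pose u := 16 * (1 + x ^+ 2 / V).
have th0 : 0 < th by rewrite divr_gt0// mulr_gt0.
have uE : th ^+ 2 * V = u.
  rewrite /th /u !exprMn z2 exprVn; field; exact: lt0r_neq0.
(* [expR (u / 2)] is the exponential moment at [th]. *)
have ux : 2 * expR (th * x) <= expR (u / 2).
  have -> : u / 2 = th * x + (u / 2 - th * x) by ring.
  rewrite expRD mulrC ler_pM2l ?expR_gt0// (le_trans _ (expR_ge1Dx _))//.
  have -> : u = 16 * (z ^+ 2 / V) by rewrite z2 /u; field; exact: lt0r_neq0.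
  have h1 : th * x <= 4 * z ^+ 2 / V.
    rewrite (_ : 4 * z ^+ 2 / V = th * z) ?ler_pM2l//.
    by rewrite /th; field; exact: lt0r_neq0.
  have h2 : 1 <= z ^+ 2 / V.
    by rewrite ler_pdivlMr// mul1r z2 lerDl sqr_ge0.
  rewrite -mulrA in h1; move: (z ^+ 2 / V) (th * x) h1 h2 => y1 y2 h1 h2.
  lra.
have := gridS_mgf th a pq qN FE; rewrite -/V uE => mgf1.
have := gridS_mgf (2 * th) a pq qN FE.
have -> : (2 * th) ^+ 2 * V / 2 = 2 * u by rewrite -uE; field.
rewrite -/V => mgf2.
pose k := expR (3 * u / 2); pose h := expR (u / 2).
have k0 : 0 < k by exact: expR_gt0.
have h0 : 0 < h by exact: expR_gt0.
pose Ex c w : R := \1_E w * expR (c * gridS p q a w).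
have mEx c : measurable_fun [set: T] (Ex c).
  apply: measurable_funM; first exact: measurable_indic.
  by apply: measurableT_comp => //; exact: measurable_funM.
have Ex0 c w : 0 <= Ex c w by rewrite mulr_ge0 ?expR_ge0.
(* Above [x], the inequality [y <= k + y ^+ 2 / (4 * k)] replaces Cauchy-Schwarz;
   [k] balances the moments at [th] and [2 * th]. *)
have pointwise w : Ex th w <= h / 2 * \1_E w + (k * \1_G w + (4 * k)^-1 * Ex (2 * th) w).
  rewrite /Ex [\1_E w]indicE; case: (boolP (w \in E)) => [/set_mem Ew|nEw]; last first.
    by rewrite !mul0r !mulr0 add0r addr0 mulr_ge0// ltW.
  rewrite !mul1r mulr1 (_ : 2 * th * _ = th * gridS p q a w + th * gridS p q a w); last by ring.
  rewrite expRD.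
  set y := expR (th * _); have y0 : 0 < y by exact: expR_gt0.
  have [Sx|Sx] := leP (gridS p q a w) x.
    apply: (@le_trans _ _ (h / 2)); last first.
      by rewrite lerDl addr_ge0 ?mulr_ge0 ?invr_ge0 ?mulr_ge0// ltW.
    rewrite ler_pdivlMr// mulrC (le_trans _ ux)// ler_pM2l// ler_expR ler_pM2l//.
  rewrite indicE mem_set// mulr1 (@le_trans _ _ (k + (4 * k)^-1 * (y * y)))//; last first.
    by rewrite lerDr divr_ge0// ltW.
  rewrite -subr_ge0 (_ : _ - _ = (2 * k - y) ^+ 2 / (4 * k)); last first.
    by field; exact: lt0r_neq0.
  by rewrite divr_ge0 ?sqr_ge0 ?mulr_ge0// ltW.
have intE : (\int[P]_w (\1_E w)%:E = P E)%E by rewrite integral_indic// setIT.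
have intG : (\int[P]_w (\1_G w)%:E = P G)%E by rewrite integral_indic// setIT.
have mI A : measurable A -> measurable_fun [set: T] (\1_A : T -> R) by exact: measurable_indic.
have : (\int[P]_w (Ex th w)%:E <=
    \int[P]_w (h / 2 * \1_E w + (k * \1_G w + (4 * k)^-1 * Ex (2 * th) w))%:E)%E.
  apply: le_integral_real => //.
  by apply: measurable_funD; [|apply: measurable_funD]; apply: measurable_funM => //; exact: mI.
have h20 : 0 <= h / 2 by rewrite divr_ge0// ltW.
have k40 : 0 <= (4 * k)^-1 by rewrite invr_ge0 mulr_ge0// ltW.
rewrite integral_realD//; last 4 first.
- by apply: measurable_funM => //; exact: mI.
- by apply: measurable_funD; apply: measurable_funM => //; exact: mI.
- by move=> w _; rewrite mulr_ge0.
- by move=> w _; rewrite addr_ge0 ?mulr_ge0// ltW.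
rewrite integral_realD//; last 4 first.
- by apply: measurable_funM => //; exact: mI.
- by apply: measurable_funM.
- by move=> w _; rewrite mulr_ge0// ltW.
- by move=> w _; rewrite mulr_ge0.
rewrite !integral_realZl ?(ltW k0)//; try exact: mI.
rewrite intE intG mgf1 mgf2.
have fE : P E \is a fin_num by rewrite fin_num_measure.
have fG : P G \is a fin_num by rewrite fin_num_measure.
rewrite -[in leLHS](fineK fE) -(fineK fE) -(fineK fG) -!EFinM -!EFinD !lee_fin.
move: (fine (P E)) (fine (P G)) => pe pg.
have -> : expR (2 * u) = k * h by rewrite /k /h -expRD; congr expR; field.
have -> : expR (-16 * (1 + x ^+ 2 / V)) = h / k.
  by rewrite /k /h -expRN -expRD /u; congr expR; field; exact: lt0r_neq0.
rewrite -/h => ineq; rewrite -(ler_pM2l k0).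
have -> : k * (pe * (h / k / 4)) = pe * h / 4 by field; exact: lt0r_neq0.
move: ineq; have -> : (4 * k)^-1 * (pe * (k * h)) = pe * h / 4 by field; exact: lt0r_neq0.
have -> : h / 2 * pe = pe * h / 2 by field.
move: (pe * h) (k * pg) => y1 y2; lra.
Qed.
(** Given the past, the next sum stays in [[- x, x]] with probability at most one
    minus the lower tail bound. *)
Lemma grid_all_small (kap : nat -> nat) (M : nat) (a : nat -> nat -> 'I_r -> R) (x : R) :
  (forall n, (n <= M)%N -> (kap n <= N)%N) ->
  (forall n, (n < M)%N -> (kap n <= kap n.+1)%N) ->
  (P [set w | forall n, (n < M)%N -> (`|gridS (kap n) (kap n.+1) (a n) w| <= x)%R] <=
   (\prod_(n < M) (1 - tail_lower x (gridV (kap n) (kap n.+1) (a n))))%:E)%E.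
Proof.
move=> kapN kapS.
pose E m := [set w | forall n, (n < m)%N -> (`|gridS (kap n) (kap n.+1) (a n) w| <= x)%R].
have ES m : E m.+1 = E m `&` [set w | (`|gridS (kap m) (kap m.+1) (a m) w| <= x)%R].
  apply/seteqP; split=> w /=.
    by move=> h; split=> [n nm|]; apply: h; rewrite ?ltnS// ltnW.
  by move=> [h1 h2] n; rewrite ltnS leq_eqVlt => /predU1P[->//|]; exact: h1.
have E0 : E 0%N = setT by apply/seteqP; split.
suff main : forall m, (m <= M)%N -> Fi (tau (kap m)) (E m) /\
    (P (E m) <= (\prod_(n < m) (1 - tail_lower x (gridV (kap n) (kap n.+1) (a n))))%:E)%E.
  by have [] := main M (leqnn M).
have tk m : (m <= M)%N -> 0 <= tau (kap m) by move=> mM; apply: (tau_ge0 tau0 tau_lt); exact: kapN.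
elim=> [m0|m IH mM].
  by rewrite E0 big_ord0 probability_setT; split=> //; rewrite -(FiE hFi _ (tk 0%N m0)).
have [FE PE] := IH (ltnW mM).
have FE' : Fi (tau (kap m.+1)) (E m).
  apply: (le_Fi hFi _ _ FE); first exact: tk (ltnW mM).
  by apply: (tau_le tau_lt); [exact: kapS|exact: kapN].
have mS := @gridS_Fi (kap m) (kap m.+1) (a m) (kapN _ mM).
have FES : Fi (tau (kap m.+1)) (E m.+1).
  rewrite ES -(FiE hFi _ (tk _ mM)); apply: measurableI; first by rewrite FiE ?tk.
  rewrite (_ : mkset _ = gridS (kap m) (kap m.+1) (a m) @^-1` `[- x, x]).
    by rewrite -[X in measurable X]setTI; exact: mS.
  by apply/seteqP; split=> w /=; rewrite in_itv/= ler_norml.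
split=> //.
have mE := sub_Fi_measurable hFi (tk _ mM) FE'.
have mES := sub_Fi_measurable hFi (tk _ mM) FES.
have fE : P (E m) \is a fin_num by rewrite fin_num_measure.
rewrite big_ord_recr/= EFinM.
have /andP[g0 g1] := tail_lower_itv x (gridV (kap m) (kap m.+1) (a m)).
apply: (@le_trans _ _ (P (E m) * (1 - tail_lower x (gridV (kap m) (kap m.+1) (a m)))%:E)%E); last first.
  by rewrite lee_wpmul2r// lee_fin subr_ge0.
rewrite /tail_lower; case: ifP => V0; last first.
  rewrite subr0 mule1; apply: le_measure; rewrite ?inE// ES; exact: subIsetl.
have low := grid_tail_lower x (kapS _ mM) (kapN _ mM) FE V0.
set G := _ `&` _ in low.
have mG : measurable G.
  apply: measurableI => //; rewrite (_ : mkset _ = gridS (kap m) (kap m.+1) (a m) @^-1` `]x, +oo[).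
    apply: (sub_Fi_measurable hFi (tk _ mM)); apply: (Fi_measurableP hFi) => //; exact: tk.
  by apply/seteqP; split=> w /=; rewrite in_itv/= andbT.
have fG : P G \is a fin_num by rewrite fin_num_measure.
rewrite EFinB muleBr ?fin_num_adde_defr// mule1.
apply: (@le_trans _ _ (P (E m) - P G)%E); last by rewrite leeB.
have GE : G `<=` E m by exact: subIsetl.
rewrite -[X in (_ <= _ - P X)%E](setIidr GE) -measureD//; last first.
  by rewrite ltey_eq fE.
apply: le_measure; rewrite ?inE//; first exact: measurableD.
rewrite ES => w [Ew /= Sx]; split=> // -[_ /=].
by rewrite ltNge (le_trans (ler_norm _) Sx).
Qed.

End GridBounds.

(** * Step functions on a grid *)

Lemma knot_mono (R : realType) (d r : nat) (t : R) (h : step_fun d r t) i j :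
  (i <= j)%N -> (j <= pieces h)%N -> knot h i <= knot h j.
Proof.
elim: j => [|j IH]; first by rewrite leqn0 => /eqP ->.
rewrite leq_eqVlt => /predU1P[-> //|ij jp].
by rewrite (le_trans (IH ij (ltnW jp)))// knot_le.
Qed.

Section StepGrid.
Context (R : realType) (disp : measure_display) (T : measurableType disp)
  (r d : nat) (B : R -> T -> 'cV[R]_r).
Variables (N : nat) (tau : nat -> R).
Hypothesis tau_lt : forall i, (i < N)%N -> tau i < tau i.+1.

Lemma tau_mono i j : (i <= N)%N -> (j <= N)%N -> (tau i <= tau j) = (i <= j)%N.
Proof.
move=> iN jN; apply/idP/idP => [|ij]; last exact: (tau_le tau_lt).
apply: contraTT; rewrite -ltnNge -ltNge => ji.
by rewrite (lt_le_trans (tau_lt (leq_trans ji iN)))// (tau_le tau_lt).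
Qed.

Lemma tau_mono_lt i j : (i <= N)%N -> (j <= N)%N -> (tau i < tau j) = (i < j)%N.
Proof. by move=> iN jN; rewrite ltNge tau_mono// -ltnNge. Qed.

Lemma cell_indic p q i s : (p <= N)%N -> (q <= N)%N -> (i < N)%N ->
  tau i < s -> s <= tau i.+1 ->
  \1_(`]tau p, tau q]%classic) s = (p <= i < q)%N%:R :> R.
Proof.
move=> pN qN iN ts st; rewrite indicE; congr (nat_of_bool _)%:R.
apply/idP/idP.
  rewrite inE/= in_itv/= => /andP[ps sq].
  rewrite -ltnS -tau_mono_lt// (lt_le_trans ps)//=.
  by rewrite -tau_mono_lt ?(ltnW iN)// (lt_le_trans ts).
move=> /andP[pi iq]; rewrite inE/= in_itv/=; apply/andP; split.
  by rewrite (le_lt_trans _ ts)// tau_mono// ltnW.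
by rewrite (le_trans st)// tau_mono.
Qed.

Definition on_grid (t : R) (h : step_fun d r t) :=
  forall i, (i <= pieces h)%N -> exists2 p, (p <= N)%N & tau p = knot h i.

(** All the knots lie on the grid, so that the step function is constant on each
    cell; the cells are open on the left. *)
Lemma step_eval_cell (t : R) (h : step_fun d r t) i s : on_grid h -> (i < N)%N ->
  tau i < s -> s <= tau i.+1 -> step_eval h s = step_eval h (tau i.+1).
Proof.
move=> hg iN ts st; apply: eq_bigr => j _; congr (_ *: _).
have [p pN <-] := hg j (ltnW (ltn_ord j)).
have [q qN <-] := hg j.+1 (ltn_ord j).
by rewrite !(cell_indic pN qN iN)//; exact: tau_lt.
Qed.

(** Refining the knots of a step function to a grid does not change its elementary
    integral: the increments over the cells of a piece telescope. *)
Lemma step_integral_grid (t : R) (h : step_fun d r t) j w : on_grid h ->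
  step_integral B h w j 0 =
  gridS B tau 0 N (fun i l => step_eval h (tau i.+1) j l) w.
Proof.
move=> hg; rewrite /step_integral summxE /gridS.
under [RHS]eq_bigr => i _.
  under eq_bigr do rewrite summxE mulr_suml.
  rewrite exchange_big/=; over.
rewrite exchange_big/=; apply: eq_bigr => k _.
rewrite mxE exchange_big/=; apply: eq_bigr => l _.
have [p pN Ep] := hg k (ltnW (ltn_ord k)).
have [q qN Eq] := hg k.+1 (ltn_ord k).
have pq : (p <= q)%N by rewrite -tau_mono// Ep Eq; exact: knot_le.
rewrite -Ep -Eq.
transitivity (\sum_(0 <= i < N) coef h k j l * ((p <= i < q)%N%:R * brownian_incr B (tau i) (tau i.+1) l w)).
  rewrite -mulr_sumr; congr (_ * _).
  rewrite (big_cat_nat (leq0n p) pN)/= big_nat big1 ?add0r; last first.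
    by move=> i /andP[_ ip]; rewrite leqNgt ip/= mul0r.
  rewrite (big_cat_nat pq qN)/= [\sum_(q <= _ < N) _]big_nat [\sum_(q <= _ < N | _) _]big1 ?addr0; last first.
    by move=> i /andP[qi _]; rewrite [(i < q)%N]ltnNge qi andbF mul0r.
  rewrite (eq_big_nat _ _ (F2 := fun i => B (tau i.+1) w l 0 - B (tau i) w l 0)).
    by rewrite telescope_sumr// !mxE.
  by move=> i pi; rewrite pi mul1r /brownian_incr !mxE.
rewrite [LHS]big_nat [RHS]big_nat; apply: eq_bigr => i /andP[_ iN].
rewrite mxE (cell_indic pN qN iN)//; last exact: tau_lt.
by rewrite mulrA [coef _ _ _ _ * _]mulrC.
Qed.

Lemma step_eval_gt (t : R) (h : step_fun d r t) s : t < s -> step_eval h s = 0.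
Proof.
move=> ts; rewrite /step_eval big1// => i _; rewrite indicE memNset ?scale0r//=.
rewrite in_itv/= => /andP[_]; apply/negP; rewrite -ltNge (le_lt_trans _ ts)//.
by have := knot_mono (ltn_ord i) (leqnn (pieces h)); rewrite knot_last.
Qed.

Lemma measurable_step_eval (t : R) (h : step_fun d r t) j l D :
  measurable_fun D (fun s => step_eval h s j l).
Proof.
rewrite /step_eval; under eq_fun do rewrite summxE.
by apply: measurable_sum => i; under eq_fun do rewrite mxE; apply: measurable_funM => //;
  apply: measurable_funTS; exact: measurable_indic.
Qed.

Lemma cell_integral (f : R -> R) p q : (p <= q)%N -> (q <= N)%N ->
  measurable_fun [set: R] f -> (forall s, 0 <= f s) ->
  (forall i s, (i < N)%N -> tau i < s -> s <= tau i.+1 -> f s = f (tau i.+1)) ->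
  (\int[lebesgue_measure]_(s in `]tau p, tau q]) (f s)%:E =
   (\sum_(p <= i < q) f (tau i.+1) * (tau i.+1 - tau i))%:E)%E.
Proof.
move=> + + mf f0 fcell; elim: q => [|q IH].
  by rewrite leqn0 => /eqP -> _; rewrite big_geq// set_itvoc0 integral_set0.
rewrite leq_eqVlt => /predU1P[-> _|pq qN].
  by rewrite big_geq// set_itvoc0 integral_set0.
rewrite ltnS in pq.
have le1 : tau p <= tau q by rewrite tau_mono// ltnW// (leq_ltn_trans pq).
have lt2 : tau q < tau q.+1 by exact: tau_lt.
rewrite (_ : `]tau p, tau q.+1]%classic = `]tau p, tau q] `|` `]tau q, tau q.+1])%classic; last first.
  by rewrite -itv_bndbnd_setU// bnd_simp ?ltW.
rewrite ge0_integral_setU//=; last 3 first.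
- by apply/measurable_EFinP; exact: measurable_funTS.
- by move=> x _; rewrite lee_fin.
- apply/disj_setPS => x [/=]; rewrite !in_itv/= => /andP[_ h1] /andP[h2 _].
  by rewrite ltNge h1 in h2.
rewrite IH ?(ltnW qN)// big_nat_recr//= EFinD; congr (_ + _)%E.
rewrite (eq_integral (cst (f (tau q.+1))%:E)); last first.
  by move=> x; rewrite inE/= in_itv/= => /andP[h1 h2]; rewrite (fcell q).
by rewrite integral_cst//= lebesgue_measure_itv/= lte_fin lt2 -EFinB -EFinM.
Qed.

End StepGrid.

Lemma exists_grid (R : realType) (s : seq R) : (forall x, x \in s -> 0 <= x) -> s != [::] ->
  exists (N : nat) (tau : nat -> R), [/\ 0 <= tau 0%N,
    forall i, (i < N)%N -> tau i < tau i.+1 &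
    forall x, x \in s -> exists2 p, (p <= N)%N & tau p = x].
Proof.
move=> s0 sn0; pose u := sort <=%O (undup s).
have us : u =i s by move=> x; rewrite mem_sort mem_undup.
have un0 : (0 < size u)%N.
  rewrite lt0n size_eq0; apply: contra sn0 => /eqP u0.
  case: s s0 @u us u0 => // x s s0 u us u0.
  by have := us x; rewrite u0 mem_head in_nil.
exists (size u).-1, (nth 0 u); split.
- by apply: s0; rewrite -us; exact: mem_nth.
- have su : sorted <%O u by rewrite sort_lt_sorted undup_uniq.
  by move=> i iN; apply: (sortedP 0 su); rewrite -ltn_predRL.
- move=> x; rewrite -us => xu; exists (index x u); last exact: nth_index.
  by rewrite -ltnS prednK// index_mem.
Qed.

(** * Approximation of stochastic integrals by sums over a common grid *)

Lemma markov_real (R : realType) (d : measure_display) (T : measurableType d)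
    (mu : {measure set T -> \bar R}) (f : T -> R) (c e : R) :
  measurable_fun [set: T] f -> (forall x, 0 <= f x) -> 0 < c ->
  (\int[mu]_x (f x)%:E <= e%:E)%E ->
  (mu [set x | (c < f x)%R] <= (e / c)%:E)%E.
Proof.
move=> mf f0 c0 fe.
have mA : measurable [set x | (c < f x)%R].
  rewrite (_ : mkset _ = f @^-1` `]c, +oo[).
    by rewrite -[X in measurable X]setTI; exact: mf.
  by apply/seteqP; split=> w /=; rewrite in_itv/= andbT.
rewrite mulrC EFinM lee_pdivlMl//; apply: le_trans fe.
rewrite -[X in (_ * mu X)%E]setIT -integral_indic// -integral_realZl ?(ltW c0)//.
apply: le_integral_real => //.
- by apply: measurable_funM => //; exact: measurable_indic.
- by move=> x _; rewrite mulr_ge0// ltW.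
- move=> x _; rewrite indicE; case: (boolP (_ \in _)) => [/set_mem/= /ltW|_].
    by rewrite mulr1.
  by rewrite mulr0.
Qed.

(** Squared distance between rows of matrix-valued functions of time. *)
Definition row_dist2 (R : realType) (r : nat) (f g : R -> 'I_r -> R) (s : R) : R :=
  \sum_(l < r) (f s l - g s l) ^+ 2.

Section RowDistance.
Context (R : realType) (r : nat).
Implicit Types (f g k : R -> 'I_r -> R) (D : set R).
Local Notation lambda := (@lebesgue_measure R).

Lemma row_dist2C f g s : row_dist2 f g s = row_dist2 g f s.
Proof. by apply: eq_bigr => l _; rewrite -sqrrN opprB. Qed.

Lemma row_dist2_ge0 f g s : 0 <= row_dist2 f g s.
Proof. by apply: sumr_ge0 => l _; exact: sqr_ge0. Qed.

Lemma measurable_row_dist2 D f g : (forall l, measurable_fun D (f^~ l)) ->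
  (forall l, measurable_fun D (g^~ l)) -> measurable_fun D (row_dist2 f g).
Proof.
move=> mf mg; apply: measurable_sum => l; apply: measurable_funX.
by apply: measurable_funB; [exact: mf|exact: mg].
Qed.

Lemma row_dist2_le f g k s : row_dist2 f g s <= 2 * row_dist2 f k s + 2 * row_dist2 g k s.
Proof.
rewrite /row_dist2 !mulr_sumr -big_split/=; apply: ler_sum => l _.
rewrite -subr_ge0 (_ : _ - _ = (f s l + g s l - 2 * k s l) ^+ 2) ?sqr_ge0//.
by ring.
Qed.

Lemma integral_row_dist2_le D f g k : measurable D -> (forall l, measurable_fun D (f^~ l)) ->
  (forall l, measurable_fun D (g^~ l)) -> (forall l, measurable_fun D (k^~ l)) ->
  (\int[lambda]_(s in D) (row_dist2 f g s)%:E <=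
   2%:E * \int[lambda]_(s in D) (row_dist2 f k s)%:E + 2%:E * \int[lambda]_(s in D) (row_dist2 g k s)%:E)%E.
Proof.
move=> mD mf mg mk.
have m2 u : (forall l, measurable_fun D (u^~ l)) -> measurable_fun D (fun s => 2 * row_dist2 u k s).
  by move=> mu; apply: measurable_funM => //; exact: measurable_row_dist2.
rewrite -!integral_realZl//; try exact: measurable_row_dist2; try by move=> x _; exact: row_dist2_ge0.
rewrite -integral_realD//; try exact: m2; try by move=> x _; rewrite mulr_ge0// row_dist2_ge0.
apply: le_integral_real => //.
- exact: measurable_row_dist2.
- by apply: measurable_funD; exact: m2.
- by move=> x _; exact: row_dist2_ge0.
- by move=> x _; exact: row_dist2_le.
Qed.

End RowDistance.

Lemma fnorm2 (R : realType) (m n : nat) (M : 'M[R]_(m, n)) :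
  fnorm M ^+ 2 = \sum_i \sum_j M i j ^+ 2.
Proof.
rewrite sqr_sqrtr//; apply: sumr_ge0 => i _; apply: sumr_ge0 => j _.
exact: sqr_ge0.
Qed.

Lemma row_le_fnorm2 (R : realType) (m n : nat) (M : 'M[R]_(m, n)) i :
  \sum_j M i j ^+ 2 <= fnorm M ^+ 2.
Proof.
rewrite fnorm2 (bigD1 i)//= lerDl; apply: sumr_ge0 => k _.
by apply: sumr_ge0 => j _; exact: sqr_ge0.
Qed.

Lemma entry_le_fnorm2 (R : realType) (m n : nat) (M : 'M[R]_(m, n)) i j :
  M i j ^+ 2 <= fnorm M ^+ 2.
Proof.
apply: le_trans (row_le_fnorm2 M i).
by rewrite (bigD1 j)//= lerDl; apply: sumr_ge0 => k _; exact: sqr_ge0.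
Qed.

Section Approx.
Context (R : realType) (disp : measure_display) (T : measurableType disp)
  (P : probability T R) (d r : nat) (Fi : R -> set (set T))
  (B : R -> T -> 'cV[R]_r).
Hypothesis hFi : filtration Fi.
Hypothesis hB : brownian_motion P Fi B.
Variable sigma : R -> 'M[R]_(d, r).
Hypothesis msigma : forall j l, measurable_fun (`[0, +oo[ : set R) (fun u : R => sigma u j l).
Local Notation lambda := (@lebesgue_measure R).

Lemma is_stoch_integral_approx t Y (e : R) : is_stoch_integral P B sigma t Y -> 0 < e ->
  exists h : step_fun d r t,
    (\int[lambda]_(s in `[0%R, t]) (fnorm (step_eval h s - sigma s) ^+ 2)%:E <= e%:E)%E /\
    (\int[P]_w (fnorm (step_integral B h w - Y w) ^+ 2)%:E <= e%:E)%E.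
Proof.
move=> [_ [h [h1 h2]]] e0.
have ev (u : nat -> \bar R) : u @ \oo --> 0%E -> \forall k \near \oo, (u k < e%:E)%E.
  by move=> /(_ [set x | (x < e%:E)%E]); apply; exact: open_ereal_lt'.
near \oo => k; exists (h k); split; apply: ltW; near: k; exact: ev.
Unshelve. all: by end_near. Qed.

Let sig (j : 'I_d) (s : R) (l : 'I_r) : R := sigma s j l.
Let st (j : 'I_d) (t : R) (h : step_fun d r t) (s : R) (l : 'I_r) : R := step_eval h s j l.

Lemma integral_row_dist2_fnorm (t : R) (h : step_fun d r t) j (a b e : R) :
  0 <= a -> b <= t ->
  (\int[lambda]_(s in `[0%R, t]) (fnorm (step_eval h s - sigma s) ^+ 2)%:E <= e%:E)%E ->
  (\int[lambda]_(s in `]a, b]) (row_dist2 (st j h) (sig j) s)%:E <= e%:E)%E.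
Proof.
move=> a0 bt he; apply: le_trans he.
have sub : (`]a, b] `<=` `[0, t])%classic.
  by apply: subset_itv; rewrite bnd_simp.
have sub2 : (`[0, t] `<=` `[0%R, +oo[)%classic by apply: subset_itvl.
have m1 D j' l : measurable_fun D (fun s => step_eval h s j' l) by exact: measurable_step_eval.
have m2 j' l : measurable_fun (`[0, t]%classic : set R) (fun s => sigma s j' l).
  exact: measurable_funS (msigma j' l).
have mrs j' : measurable_fun (`[0, t]%classic : set R) (row_dist2 (st j' h) (sig j')).
  by apply: measurable_row_dist2 => l; [exact: m1|exact: m2].
apply: (@le_trans _ _ (\int[lambda]_(s in `[0%R, t]) (row_dist2 (st j h) (sig j) s)%:E)%E).
  apply: ge0_subset_integral => //; first by apply/measurable_EFinP; exact: mrs.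
  by move=> x _; rewrite lee_fin row_dist2_ge0.
have rsE j' s : row_dist2 (st j' h) (sig j') s = \sum_l (step_eval h s - sigma s) j' l ^+ 2.
  by apply: eq_bigr => l _; rewrite !mxE.
apply: le_integral_real => //.
- exact: mrs.
- rewrite (_ : (fun s => _) = (fun s => \sum_i \sum_j (step_eval h s - sigma s) i j ^+ 2)); last first.
    by apply/funext => s; rewrite fnorm2.
  apply: measurable_sum => i; apply: eq_measurable_fun (mrs i) => s _; exact: rsE.
- by move=> x _; exact: row_dist2_ge0.
- by move=> s _; rewrite rsE; exact: row_le_fnorm2.
Qed.

(** Choice of the exponent in the maximal inequality used for [approx_grid]. *)
Lemma expR_small (del e : R) : 0 < del -> 0 < e ->
  exists2 L, 0 < L & 2 * expR (- (L * del) + 1) <= e.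
Proof.
move=> del0 e0; pose C := 2 * expR 1 / e.
have C0 : 0 < C by rewrite divr_gt0// mulr_gt0// expR_gt0.
exists (C / del); first by rewrite divr_gt0.
rewrite divfK ?gt_eqF// expRD expRN.
have h : C <= expR C.
  by rewrite (le_trans _ (expR_ge1Dx _))// lerDr.
rewrite mulrCA mulrC -[leRHS](mulfVK (lt0r_neq0 C0)) (_ : e * C^-1 * C = C^-1 * (2 * expR 1)).
  rewrite [leLHS]mulrC ler_pM2r ?mulr_gt0 ?expR_gt0//.
  by rewrite lef_pV2 ?posrE// expR_gt0.
by rewrite /C; field; rewrite !gt_eqF ?expR_gt0.
Qed.

(** The integrals up to the times [t 0 <= ... <= t m] come with unrelated
    approximating step functions. The union of their knots is a grid on which all
    of them are elementary, and the step function of the last time can serve for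
    every [t n]: it is close to the one of [t n] in L^2 before [t n], so that by
    [grid_max] the two sums are close in probability. Energies are compared through
    [(a + b) ^+ 2 <= 2 * a ^+ 2 + 2 * b ^+ 2], whence the factors 2; this crude
    comparison takes the place of the Ito isometry. *)
Lemma approx_grid (m : nat) (t : nat -> R) (Y : nat -> T -> 'cV[R]_d) (del eta : R) :
  (forall n, 0 <= t n) -> (forall n, t n <= t n.+1) ->
  (forall n, is_stoch_integral P B sigma (t n) (Y n)) -> 0 < del -> 0 < eta ->
  exists (N : nat) (tau : nat -> R) (kap : nat -> nat) (a : 'I_d -> nat -> 'I_r -> R),
  [/\ 0 <= tau 0%N, (forall i, (i < N)%N -> tau i < tau i.+1),
      (forall n, (n <= m)%N -> (kap n <= N)%N),
      (forall n, (n < m)%N -> (kap n <= kap n.+1)%N) &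
      (forall n n' j, (n <= n')%N -> (n' <= m)%N ->
        ((gridV tau (kap n) (kap n') (a j))%:E <=
          2%:E * \int[lambda]_(s in `]t n, t n']) (\sum_l sigma s j l ^+ 2)%:E + eta%:E)%E /\
        (\int[lambda]_(s in `]t n, t n']) (\sum_l sigma s j l ^+ 2)%:E <=
          2%:E * (gridV tau (kap n) (kap n') (a j))%:E + eta%:E)%E) /\
      (forall n j, (n <= m)%N ->
        (P [set w | (del < `|Y n w j 0 - gridS B tau 0 (kap n) (a j) w|)%R] <= eta%:E)%E)].
Proof.
move=> t0 tS hY del0 eta0.
have del20 : 0 < del / 2 by rewrite divr_gt0.
have eta20 : 0 < eta / 2 by rewrite divr_gt0.
have [L L0 hL] := expR_small del20 eta20.
have tle n n' : (n <= n')%N -> t n <= t n'.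
  by move=> nn; apply: (homo_leq (@lexx _ _) (@le_trans _ _)) nn.
(* Precision of the step functions: for the energies, for the exponent [L] of the
   maximal inequality, and for Markov's inequality. *)
pose e := Num.min (eta / 2) (Num.min (2 * L ^+ 2)^-1 ((del / 2) ^+ 2 * (eta / 2))).
have e0 : 0 < e.
  rewrite !lt_min eta20 invr_gt0 mulr_gt0 ?exprn_gt0//=.
  by rewrite mulr_gt0// exprn_gt0.
have e1 : e <= eta / 2 by rewrite ge_min lexx.
have e2 : e <= (2 * L ^+ 2)^-1 by rewrite !ge_min lexx orbT.
have e3 : e <= (del / 2) ^+ 2 * (eta / 2) by rewrite !ge_min lexx !orbT.
pose h n := sval (cid (is_stoch_integral_approx (hY n) e0)).
have hh n : (\int[lambda]_(s in `[0%R, t n]) (fnorm (step_eval (h n) s - sigma s) ^+ 2)%:E <= e%:E)%E /\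
    (\int[P]_w (fnorm (step_integral B (h n) w - Y n w) ^+ 2)%:E <= e%:E)%E.
  exact: svalP (cid (is_stoch_integral_approx (hY n) e0)).
pose ks := flatten [seq [seq knot (h n) i | i <- iota 0 (pieces (h n)).+1] | n <- iota 0 m.+1].
have ksin n i : (n <= m)%N -> (i <= pieces (h n))%N -> knot (h n) i \in ks.
  move=> nm ip; apply/flattenP; exists [seq knot (h n) i | i <- iota 0 (pieces (h n)).+1].
    by apply/mapP; exists n => //; rewrite mem_iota/= add0n ltnS.
  by apply/mapP; exists i => //; rewrite mem_iota/= add0n ltnS.
have ks0 (x : R) : x \in ks -> 0 <= x.
  move=> /flattenP[s' /mapP[n _ s'E]]; rewrite s'E => xin.
  case: (mapP (f := knot (h n)) xin) => i.
  rewrite mem_iota/= add0n ltnS => ip ->.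
  by rewrite -(knot_first (h n)) knot_mono.
have ksn0 : ks != [::].
  by apply/eqP => ksE; have := @ksin 0%N 0%N isT isT; rewrite ksE in_nil.
have [N [tau [tau0 tau_lt htau]]] := exists_grid ks0 ksn0.
have hg n : (n <= m)%N -> on_grid N tau (h n).
  by move=> nm i ip; apply: htau; exact: ksin.
have /choice[kap hkap] n : exists p, (n <= m)%N -> (p <= N)%N /\ tau p = t n.
  have [nm|nm] := leqP n m; last by exists 0%N.
  have [p pN Ep] := hg n nm _ (leqnn _).
  by exists p => _; split=> //; rewrite Ep knot_last.
have kapN n : (n <= m)%N -> (kap n <= N)%N by move=> /hkap[].
have tkap n : (n <= m)%N -> tau (kap n) = t n by move=> /hkap[].
have kapS n n' : (n <= n')%N -> (n' <= m)%N -> (kap n <= kap n')%N.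
  move=> nn nm; have nm' := leq_trans nn nm.
  by rewrite -(tau_mono tau_lt) ?kapN// !tkap// tle.
exists N, tau, kap, (fun j i l => step_eval (h m) (tau i.+1) j l); split=> //.
  by move=> n nm; exact: kapS.
have zE f s : row_dist2 f (fun _ _ => 0) s = \sum_(l < r) f s l ^+ 2.
  by apply: eq_bigr => l _; rewrite subr0.
have zE' f s : row_dist2 (fun _ _ => 0) f s = \sum_(l < r) f s l ^+ 2.
  by apply: eq_bigr => l _; rewrite sub0r sqrrN.
have mst n j D l : measurable_fun D ((st j (h n))^~ l) by exact: measurable_step_eval.
have msig j a b : 0 <= a -> forall l, measurable_fun (`]a, b]%classic : set R) ((sig j)^~ l).
  move=> a0 l; apply: measurable_funS (msigma j l) => //.
  by apply: subset_itv; rewrite bnd_simp.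
have VE n1 n2 j p q : (n1 <= m)%N -> (n2 <= m)%N -> (p <= q)%N -> (q <= N)%N ->
  (gridV tau p q (fun i l => step_eval (h n1) (tau i.+1) j l - step_eval (h n2) (tau i.+1) j l))%:E =
  (\int[lambda]_(s in `]tau p, tau q]) (row_dist2 (st j (h n1)) (st j (h n2)) s)%:E)%E.
  move=> n1m n2m pq qN; rewrite (cell_integral tau_lt pq qN)//.
  - by apply: measurable_row_dist2 => l; exact: mst.
  - by move=> s; exact: row_dist2_ge0.
  - move=> i s iN ts st'; rewrite /row_dist2 /st.
    by rewrite (step_eval_cell tau_lt (hg _ n1m) iN ts st') (step_eval_cell tau_lt (hg _ n2m) iN ts st').
have VE0 n1 j p q : (n1 <= m)%N -> (p <= q)%N -> (q <= N)%N ->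
  (gridV tau p q (fun i l => step_eval (h n1) (tau i.+1) j l))%:E =
  (\int[lambda]_(s in `]tau p, tau q]) (row_dist2 (st j (h n1)) (fun _ _ => 0%R) s)%:E)%E.
  move=> n1m pq qN; rewrite (cell_integral tau_lt pq qN)//.
  - by congr (_%:E); apply: eq_bigr => i _; rewrite zE.
  - by apply: measurable_row_dist2 => l //; exact: mst.
  - by move=> s; exact: row_dist2_ge0.
  - move=> i s iN ts st'; rewrite !zE /st.
    by rewrite (step_eval_cell tau_lt (hg _ n1m) iN ts st').
split.
  move=> n n' j nn nm; rewrite VE0 ?kapS ?kapN// !tkap ?(leq_trans nn)//.
  have b1 : (\int[lambda]_(s in `]t n, t n']) (row_dist2 (st j (h m)) (sig j) s)%:E <= (eta / 2)%:E)%E.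
    have [h1 _] := hh m.
    by rewrite (le_trans (integral_row_dist2_fnorm j _ _ h1)) ?lee_fin// tle.
  have cmul : (2%:E * (eta / 2)%:E = eta%:E :> \bar R)%E by rewrite -EFinM mulrC divfK.
  split.
    apply: (le_trans (@integral_row_dist2_le _ _ _ _ _ (sig j) _ _ _ _)) => //; try exact: mst; try by (apply: msig; exact: t0).
    rewrite addeC; apply: leeD.
      by under eq_integral do rewrite zE'.
    by rewrite -cmul lee_wpmul2l.
  have := @integral_row_dist2_le _ _ `]t n, t n']%classic (sig j) (fun _ _ => 0) (st j (h m)).
  under eq_integral do rewrite zE.
  move=> /(_ _ _ _ _)/le_trans; apply => //; try exact: mst; try by (apply: msig; exact: t0).
  rewrite addeC; apply: leeD.
    by under eq_integral do rewrite row_dist2C.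
  rewrite -cmul lee_wpmul2l//; apply: le_trans b1.
  by under eq_integral do rewrite row_dist2C.
move=> n j nm.
(* [Y n] is close to the sum of its own step function [a0 + b], and the sum of
   [b] is small. *)
pose b i l := step_eval (h n) (tau i.+1) j l - step_eval (h m) (tau i.+1) j l.
pose a0 i l := step_eval (h m) (tau i.+1) j l.
have kn := kapN n nm.
have IE w : step_integral B (h n) w j 0 = gridS B tau 0 (kap n) a0 w + gridS B tau 0 (kap n) b w.
  rewrite (step_integral_grid B tau_lt _ _ (hg n nm)) (gridS_cat B tau _ w (leq0n _) kn).
  rewrite [X in _ + X](_ : _ = 0) ?addr0.
    rewrite /gridS -big_split/=; apply: eq_bigr => i _; rewrite -big_split/=.
    by apply: eq_bigr => l _; rewrite -mulrDl addrC subrK.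
  rewrite /gridS big_nat; apply: big1 => i /andP[ki iN]; apply: big1 => l _.
  rewrite step_eval_gt ?mxE ?mul0r//.
  by rewrite -(tkap n nm) (le_lt_trans _ (tau_lt _ iN))// (tau_mono tau_lt)// ltnW.
have mY : measurable_fun [set: T] (fun w => Y n w j 0) by have [mY _] := hY n; exact: mY.
have mS c k : (k <= N)%N -> measurable_fun [set: T] (gridS B tau 0 k c).
  by move=> kN; exact: (gridS_measurable hFi hB tau0 tau_lt).
have mI i : measurable_fun [set: T] (fun w => step_integral B (h n) w i 0).
  under eq_fun do rewrite (step_integral_grid B tau_lt _ _ (hg n nm)).
  exact: mS.
pose f w := (step_integral B (h n) w - Y n w) j 0 ^+ 2.
have mIY i : measurable_fun [set: T] (fun w => (step_integral B (h n) w - Y n w) i 0).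
  rewrite (_ : (fun w => _) = (fun w => step_integral B (h n) w i 0) \- (fun w => Y n w i 0)).
    by apply: measurable_funB => //; have [mYi _] := hY n; exact: mYi.
  by apply/funext => w; rewrite !mxE.
have mf : measurable_fun [set: T] f by exact: measurable_funX.
have Pf : (P [set w | ((del / 2) ^+ 2 < f w)%R] <= (eta / 2)%:E)%E.
  apply: (@le_trans _ _ (e / (del / 2) ^+ 2)%:E).
    apply: markov_real => //; first by move=> w; exact: sqr_ge0.
      by rewrite exprn_gt0.
    have [_ h2] := hh n; apply: le_trans h2; apply: le_integral_real => //.
    - rewrite (_ : (fun w => _) = (fun w => \sum_i \sum_j0
        (step_integral B (h n) w - Y n w) i j0 ^+ 2)); last first.
        by apply/funext => w; rewrite fnorm2.
      apply: measurable_sum => i; apply: measurable_sum => k.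
      by apply: measurable_funX; rewrite (ord1 k); exact: mIY.
    - by move=> w _; exact: sqr_ge0.
    - by move=> w _; exact: entry_le_fnorm2.
  by rewrite lee_fin ler_pdivrMr ?exprn_gt0// mulrC.
have D4 : gridV tau 0 (kap n) b <= 4 * e.
  rewrite -lee_fin VE// tkap//.
  apply: (le_trans (@integral_row_dist2_le _ _ _ _ _ (sig j) _ _ _ _)) => //; try exact: mst;
    try by (apply: msig; exact: tau0).
  have [h1 _] := hh n; have [h1m _] := hh m.
  have -> : (4 * e)%:E = (2%:E * e%:E + 2%:E * e%:E)%E :> \bar R.
    by rewrite -!EFinM -EFinD; congr (_%:E); ring.
  apply: leeD; rewrite lee_wpmul2l//.
    exact: (integral_row_dist2_fnorm j tau0 _ h1).
  exact: (integral_row_dist2_fnorm j tau0 (tle _ _ nm) h1m).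
have PS := grid_max hFi hB tau0 tau_lt b (del / 2) (leq0n (kap n)) kn L0.
have bound : 2 * expR (- (L * (del / 2)) + L ^+ 2 * gridV tau 0 (kap n) b / 2) <= eta / 2.
  apply: le_trans hL; rewrite ler_pM2l// ler_expR lerD2l ler_pdivrMr// mul1r.
  have L2 : 0 < L ^+ 2 by rewrite exprn_gt0.
  apply: (@le_trans _ _ (L ^+ 2 * (4 * e))); first by rewrite ler_pM2l.
  apply: (@le_trans _ _ (L ^+ 2 * (4 * (2 * L ^+ 2)^-1))).
    by rewrite ler_pM2l// ler_pM2l.
  by rewrite le_eqVlt; apply/orP; left; apply/eqP; field; rewrite gt_eqF.
have msup : measurable [set w | exists2 l, (0 <= l <= kap n)%N & (del / 2 < `|gridS B tau 0 l b w|)%R].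
  rewrite (_ : mkset _ = \bigcup_(l in [set l | (0 <= l <= kap n)%N])
    [set w | del / 2 < `|gridS B tau 0 l b w|]); last by [].
  apply: bigcup_measurable => l /= lk; apply: measurable_gt; apply: measurableT_comp => //.
  by apply: mS; exact: leq_trans kn.
apply: (@le_trans _ _ (P ([set w | ((del / 2) ^+ 2 < f w)%R] `|`
   [set w | exists2 l, (0 <= l <= kap n)%N & (del / 2 < `|gridS B tau 0 l b w|)%R]))).
  apply: le_measure; rewrite ?inE.
  - apply: measurable_gt; apply: measurableT_comp => //; apply: measurable_funB => //; exact: mS.
  - by apply: measurableU => //; exact: measurable_gt.
  move=> w /= hw.
  have [h2|h2] := ltP (del / 2) `|gridS B tau 0 (kap n) b w|.
    by right; exists (kap n) => //; rewrite leqnn.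
  left; rewrite /f -[ltRHS]real_normK ?num_real// ltr_pXn2r ?nnegrE ?(ltW del20)//.
  have -> : (step_integral B (h n) w - Y n w) j 0 =
    gridS B tau 0 (kap n) a0 w + gridS B tau 0 (kap n) b w - Y n w j 0 by rewrite !mxE IE.
  move: hw h2; rewrite -/a0.
  move: (Y n w j 0) (gridS B tau 0 (kap n) a0 w) (gridS B tau 0 (kap n) b w) => y1 y2 y3 hw h2.
  have := ler_normB y3 (y2 + y3 - y1).
  have -> : y3 - (y2 + y3 - y1) = y1 - y2 by ring.
  move: (`|y1 - y2|) (`|y2 + y3 - y1|) (`|y3|) hw h2 => z1 z2 z3 hw h2 h3; lra.
apply: (le_trans (measureU2 _ _ _)) => //; first exact: measurable_gt.
have -> : eta%:E = ((eta / 2)%:E + (eta / 2)%:E)%E :> \bar R.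
  by rewrite -EFinD -splitr.
apply: leeD => //; apply: le_trans PS _; exact: bound.
Qed.

End Approx.

(** * Deviation bounds for stochastic integrals *)

(** Order of magnitude of the probability that a centred normal variable of
    variance [v] exceeds a multiple of [Num.sqrt K]; it vanishes with the variance. *)
Definition gauss_weight (R : realType) (K v : R) : R := if 0 < v then expR (- (K / v)) else 0.

Section Bounds.
Context (R : realType) (disp : measure_display) (T : measurableType disp)
  (P : probability T R) (d r : nat) (Fi : R -> set (set T))
  (B : R -> T -> 'cV[R]_r).
Hypothesis hFi : filtration Fi.
Hypothesis hB : brownian_motion P Fi B.
Variable sigma : R -> 'M[R]_(d, r).
Hypothesis msigma : forall j l, measurable_fun (`[0, +oo[ : set R) (fun u : R => sigma u j l).
Local Notation lambda := (@lebesgue_measure R).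

Section Times.
Variables (t : nat -> R) (Y : nat -> T -> 'cV[R]_d).
Hypothesis t0 : forall n, 0 <= t n.
Hypothesis tS : forall n, t n <= t n.+1.
Hypothesis hY : forall n, is_stoch_integral P B sigma (t n) (Y n).

Let mY n j : measurable_fun [set: T] (fun w => Y n w j 0).
Proof. by have [mY _] := hY n; exact: mY. Qed.

(** The exceptional events of all the times and coordinates are gathered in one. *)
Lemma approx_grid_uniform (m : nat) (del eta : R) : 0 < del -> 0 < eta ->
  exists (N : nat) (tau : nat -> R) (kap : nat -> nat) (a : 'I_d -> nat -> 'I_r -> R)
    (Bad : set T),
  [/\ 0 <= tau 0%N /\ (forall i, (i < N)%N -> tau i < tau i.+1),
      (forall n, (n <= m)%N -> (kap n <= N)%N) /\
      (forall n, (n < m)%N -> (kap n <= kap n.+1)%N),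
      (forall n n' j, (n <= n')%N -> (n' <= m)%N ->
        ((gridV tau (kap n) (kap n') (a j))%:E <=
          2%:E * \int[lambda]_(s in `]t n, t n']) (\sum_l sigma s j l ^+ 2)%:E + eta%:E)%E /\
        (\int[lambda]_(s in `]t n, t n']) (\sum_l sigma s j l ^+ 2)%:E <=
          2%:E * (gridV tau (kap n) (kap n') (a j))%:E + eta%:E)%E),
      measurable Bad /\ (P Bad <= eta%:E)%E &
      forall w n j, ~ Bad w -> (n <= m)%N ->
        `|Y n w j 0 - gridS B tau 0 (kap n) (a j) w| <= del].
Proof.
move=> del0 eta0; pose D : R := (m.+1 * d)%:R + 1.
have D0 : 0 < D by rewrite ltr_wpDl.
have D1 : 1 <= D by rewrite lerDr.
have eD0 : 0 < eta / D by rewrite divr_gt0.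
have eDe : eta / D <= eta by rewrite ler_pdivrMr// ler_peMr// ltW.
have [N [tau [kap [a [tau0 tau_lt kapN kapS [h3 h4]]]]]] :=
  approx_grid hFi hB msigma m t0 tS hY del0 eD0.
pose F (p : 'I_m.+1 * 'I_d) := [set w | del < `|Y p.1 w p.2 0 - gridS B tau 0 (kap p.1) (a p.2) w|].
have mF p : measurable (F p).
  apply: measurable_gt; apply: measurableT_comp => //; apply: measurable_funB => //.
  by apply: (gridS_measurable hFi hB tau0 tau_lt); apply: kapN; rewrite -ltnS.
exists N, tau, kap, a, (\big[setU/set0]_(p <- enum {: 'I_m.+1 * 'I_d}) F p); split=> //.
- move=> n n' j nn nm; have [b1 b2] := h3 n n' j nn nm; split.
    by rewrite (le_trans b1)// leeD2l// lee_fin.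
  by rewrite (le_trans b2)// leeD2l// lee_fin.
- split; first exact: bigsetU_measurable.
  apply: (le_trans (measure_bigsetU_le _ _ mF)).
  apply: (@le_trans _ _ (\sum_(p <- enum {: 'I_m.+1 * 'I_d}) (eta / D)%:E)%E).
    by apply: lee_sum => p _; apply: h4; rewrite -ltnS.
  rewrite big_enum/= sumEFin lee_fin sumr_const card_prod !card_ord -mulr_natr.
  by rewrite mulrAC ler_pdivrMr// ler_pM2l// lerDl.
- move=> w n j nB nm; rewrite leNgt; apply/negP => hlt; apply: nB.
  have nm' : (n < m.+1)%N by [].
  rewrite -bigcup_seq; exists (Ordinal nm', j) => //=; exact: mem_enum.
Qed.

Lemma stoch_integral_max_slack (m : nat) j (th x v eta : R) : 0 < th -> 0 < x -> 0 < eta ->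
  (\int[lambda]_(s in `]t 0%N, t m]) (\sum_l sigma s j l ^+ 2)%:E <= v%:E)%E ->
  (P [set w | exists2 n, (n <= m)%N & (x < `|Y n w j 0 - Y 0%N w j 0|)%R] <=
   (2 * expR (- (th * x / 2) + th ^+ 2 * v + th ^+ 2 * eta / 2) + eta)%:E)%E.
Proof.
move=> th0 x0 eta0 hv; have x40 : 0 < x / 4 by rewrite divr_gt0.
have [N [tau [kap [a [Bad [[tau0 tau_lt] [kapN kapS] hV [mBad PBad] hBad]]]]]] :=
  approx_grid_uniform m x40 eta0.
have kap_le n n' : (n <= n')%N -> (n' <= m)%N -> (kap n <= kap n')%N.
  elim: n' => [|n' IH]; first by rewrite leqn0 => /eqP ->.
  rewrite leq_eqVlt => /predU1P[->//|nn nm].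
  by rewrite (leq_trans (IH nn (ltnW nm)))// kapS.
have [V2 _] := hV 0%N m j (leq0n m) (leqnn m).
have Vle : gridV tau (kap 0%N) (kap m) (a j) <= 2 * v + eta.
  rewrite -lee_fin; apply: (le_trans V2); rewrite [leRHS]EFinD; apply: leeD => //.
  by rewrite EFinM; apply: lee_wpmul2l.
pose G := [set w | exists2 l, (kap 0%N <= l <= kap m)%N &
   (x / 2 < `|gridS B tau (kap 0%N) l (a j) w|)%R].
have PG : (P G <= (2 * expR (- (th * x / 2) + th ^+ 2 * v + th ^+ 2 * eta / 2))%:E)%E.
  apply: (le_trans (grid_max hFi hB tau0 tau_lt (a j) (x / 2) (kap_le _ _ (leq0n m) (leqnn m)) (kapN _ (leqnn m)) th0)).
  rewrite lee_fin ler_pM2l// ler_expR -addrA [th * (x / 2)]mulrA lerD2l.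
  rewrite (_ : _ + _ = th ^+ 2 * (2 * v + eta) / 2); last by field.
  by rewrite ler_pM2r ?invr_gt0// ler_pM2l ?exprn_gt0.
have mG : measurable G.
  rewrite (_ : G = \bigcup_(l in [set l | (kap 0%N <= l <= kap m)%N])
    [set w | x / 2 < `|gridS B tau (kap 0%N) l (a j) w|]); last by [].
  apply: bigcup_measurable => l /= /andP[_ lk]; apply: measurable_gt.
  apply: measurableT_comp => //; apply: (gridS_measurable hFi hB tau0 tau_lt).
  by rewrite (leq_trans lk)// kapN.
apply: (@le_trans _ _ (P (G `|` Bad))); last first.
  by rewrite (le_trans (measureU2 _ _ _))// EFinD leeD.
apply: le_measure; rewrite ?inE; last 2 first.
- exact: measurableU.
- move=> w /= [n nm hw]; have [Bw|nBw] := pselect (Bad w); [by right|left].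
  exists (kap n); first by rewrite !kap_le.
  have b1 := hBad w n j nBw nm; have b2 := hBad w 0%N j nBw (leq0n m).
  rewrite (gridS_cat B tau _ w (leq0n (kap 0%N)) (kap_le _ _ (leq0n n) nm)) in b1.
  move: hw b1 b2.
  move: (Y n w j 0) (Y 0%N w j 0) (gridS _ _ 0 _ _ w) (gridS B tau (kap 0%N) _ _ w) => y1 y2 y3 y4.
  move=> hw b1 b2; rewrite ltNge; apply/negP => b3.
  have := ler_normD (y1 - (y3 + y4)) (y4 + (y3 - y2)).
  have -> : y1 - (y3 + y4) + (y4 + (y3 - y2)) = y1 - y2 by ring.
  have := ler_normD y4 (y3 - y2); rewrite (distrC y3).
  move: (`|y1 - y2|) (`|y4 + _|) (`|y1 - _|) (`|y4|) (`|y2 - y3|) hw b1 b2 b3 => z1 z2 z3 z4 z5 hw b1 b2 b3.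
  lra.
rewrite (_ : mkset _ = \bigcup_(n in [set n | (n <= m)%N]) [set w | x < `|Y n w j 0 - Y 0%N w j 0|]); last by [].
apply: bigcup_measurable => n _; apply: measurable_gt.
by apply: measurableT_comp => //; exact: measurable_funB.
Qed.

Lemma expR_le_lin (y : R) : 0 <= y -> y <= 1 / 2 -> expR y <= 1 + 2 * y.
Proof.
move=> y0 y1; rewrite -[y in expR y]opprK expRN invf_ple ?posrE ?expR_gt0//; last lra.
apply: le_trans (expR_ge1Dx _); rewrite -(@ler_pM2l _ (1 + 2 * y)); last lra.
rewrite divff; last by rewrite gt_eqF//; lra.
rewrite -subr_ge0 (_ : _ - _ = y * (1 - 2 * y)); last by ring.
by rewrite mulr_ge0//; lra.
Qed.

(** The precision of the approximation may depend on [th], so that it disappears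
    in the limit. *)
Lemma stoch_integral_max (m : nat) j (th x v : R) : 0 < th -> 0 < x ->
  (\int[lambda]_(s in `]t 0%N, t m]) (\sum_l sigma s j l ^+ 2)%:E <= v%:E)%E ->
  (P [set w | exists2 n, (n <= m)%N & (x < `|Y n w j 0 - Y 0%N w j 0|)%R] <=
   (2 * expR (- (th * x / 2) + th ^+ 2 * v))%:E)%E.
Proof.
move=> th0 x0 hv; apply/lee_addgt0Pr => e e0.
set c := - (th * x / 2) + th ^+ 2 * v.
pose K := 2 * expR c * th ^+ 2 + 1.
have K0 : 0 < K by rewrite ltr_wpDl// mulr_ge0 ?sqr_ge0// mulr_ge0 ?expR_ge0.
pose eta := Num.min (th ^- 2) (e / K).
have th20 : 0 < th ^+ 2 by rewrite exprn_gt0.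
have eta0 : 0 < eta by rewrite lt_min invr_gt0 th20 divr_gt0.
apply: (le_trans (stoch_integral_max_slack th0 x0 eta0 hv)).
rewrite -EFinD lee_fin -/c expRD.
have eta1 : eta <= th ^- 2 by rewrite ge_min lexx.
have eta2 : eta <= e / K by rewrite ge_min lexx orbT.
have y0 : 0 <= th ^+ 2 * eta / 2 by rewrite divr_ge0// mulr_ge0 ?ltW.
have y1 : th ^+ 2 * eta / 2 <= 1 / 2.
  by rewrite ler_pM2r ?invr_gt0// -(mulfV (lt0r_neq0 th20)) ler_pM2l.
have := expR_le_lin y0 y1.
rewrite -(ler_pM2l (_ : 0 < 2 * expR c)); last by rewrite mulr_gt0// expR_gt0.
move=> h.
have : 2 * expR c * (1 + 2 * (th ^+ 2 * eta / 2)) + eta <= 2 * expR c + e.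
  rewrite (_ : _ + eta = 2 * expR c + eta * K); last by rewrite /K; field.
  by rewrite lerD2l -ler_pdivlMr.
by apply: le_trans; rewrite lerD2r mulrA; exact: h.
Qed.

Lemma exists_min_pos (v : nat -> R) (m : nat) :
  exists2 e, 0 < e & forall n, (n < m)%N -> 0 < v n -> e <= v n.
Proof.
elim: m => [|m [e e0 he]]; first by exists 1.
have [vm|vm] := ltP 0 (v m).
  exists (Num.min e (v m)); first by rewrite lt_min e0.
  move=> n; rewrite ltnS leq_eqVlt => /predU1P[-> _|nm v0]; first by rewrite ge_min lexx orbT.
  by rewrite ge_min he.
exists e => // n; rewrite ltnS leq_eqVlt => /predU1P[->|nm v0]; last exact: he.
by rewrite ltNge vm.
Qed.

(** Only finitely many blocks are involved: those with a positive energy have a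
    common positive lower bound, and a finer approximation keeps a quarter of the
    energy of each. *)
Lemma stoch_integral_all_small (m : nat) (js : nat -> 'I_d) (v : nat -> R) (x : R) : 0 < x ->
  (forall n, (n < m)%N ->
    ((v n)%:E <= \int[lambda]_(s in `]t n, t n.+1]) (\sum_l sigma s (js n) l ^+ 2)%:E)%E) ->
  (P [set w | forall n, (n < m)%N -> (`|Y n.+1 w (js n) 0 - Y n w (js n) 0| <= x)%R] <=
   (\prod_(n < m) (1 - tail_lower (2 * x) (v n / 4)))%:E)%E.
Proof.
move=> x0 hv; apply/lee_addgt0Pr => e e0.
have [e1 e10 he1] := exists_min_pos v m.
pose eta := Num.min e (e1 / 2).
have eta0 : 0 < eta by rewrite lt_min e0 divr_gt0.
have etae : eta <= e by rewrite ge_min lexx.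
have etae1 : eta <= e1 / 2 by rewrite ge_min lexx orbT.
have x20 : 0 < x / 2 by rewrite divr_gt0.
have [N [tau [kap [a [Bad [[tau0 tau_lt] [kapN kapS] hV [mBad PBad] hBad]]]]]] :=
  approx_grid_uniform m x20 eta0.
pose a' n := a (js n).
pose G := [set w | forall n, (n < m)%N ->
   (`|gridS B tau (kap n) (kap n.+1) (a' n) w| <= 2 * x)%R].
have mG : measurable G.
  rewrite (_ : G = \bigcap_(n in `I_m) ((fun w => `|gridS B tau (kap n) (kap n.+1) (a' n) w|) @^-1` `]-oo, 2 * x])).
    apply: fin_bigcap_measurable => [|n /= nm]; first exact: finite_II.
    rewrite -[X in measurable X]setTI; apply: measurableT_comp => //.
    by apply: (gridS_measurable hFi hB tau0 tau_lt); exact: kapN.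
  by apply/seteqP; split=> w h n nm; have := h n nm; rewrite /= in_itv.
have PG : (P G <= (\prod_(n < m) (1 - tail_lower (2 * x) (v n / 4)))%:E)%E.
  apply: (le_trans (grid_all_small hFi hB tau0 tau_lt a' (2 * x) kapN kapS)).
  rewrite lee_fin; apply: ler_prod => n _.
  have /andP[g0 g1] := tail_lower_itv (2 * x) (gridV tau (kap n) (kap n.+1) (a' n)).
  rewrite subr_ge0 g1/= lerB// le_tail_lower//.
  have [_ V2] := hV n n.+1 (js n) (leqnSn n) (ltn_ord n).
  have := le_trans (hv n (ltn_ord n)) V2; rewrite -EFinM -EFinD lee_fin -/(a' n).
  have [vn0|vn0] := ltP 0 (v n).
    by have := he1 n (ltn_ord n) vn0; move: (gridV _ _ _ _) => y; lra.
  move=> _; apply: (@le_trans _ _ 0); first by lra.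
  by apply: (gridV_ge0 tau_lt); exact: kapN.
apply: (@le_trans _ _ (P (G `|` Bad))); last first.
  by rewrite (le_trans (measureU2 _ _ _))// leeD// (le_trans PBad)// lee_fin.
apply: le_measure; rewrite ?inE; last 2 first.
- exact: measurableU.
- move=> w /= hw; have [Bw|nBw] := pselect (Bad w); [by right|left] => n nm.
  have b1 := hBad w n (js n) nBw (ltnW nm); have b2 := hBad w n.+1 (js n) nBw nm.
  rewrite (gridS_cat B tau _ w (leq0n (kap n)) (kapS _ nm)) -/(a' n) in b1 b2.
  have := hw n nm; move: b1 b2; rewrite -/(a' n).
  move: (Y n w _ 0) (Y n.+1 w _ 0) (gridS _ _ 0 _ _ w) (gridS B tau (kap n) _ _ w) => y1 y2 y3 y4.
  move=> b1 b2 b3; have := ler_normD (y2 - y1) ((y3 + y4) - y2 + (y1 - y3)).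
  have -> : y2 - y1 + (y3 + y4 - y2 + (y1 - y3)) = y4 by ring.
  have := ler_normD ((y3 + y4) - y2) (y1 - y3); rewrite (distrC (y3 + y4)).
  move: (`|y4|) (`|y2 - y1|) (`|y1 - y3|) (`|y2 - _|) (`|y3 + y4 - y2 + _|) b1 b2 b3 => z1 z2 z3 z4 z5 b1 b2 b3.
  lra.
rewrite (_ : mkset _ = \bigcap_(n in `I_m) ((fun w => `|Y n.+1 w (js n) 0 - Y n w (js n) 0|) @^-1` `]-oo, x])).
  apply: fin_bigcap_measurable => [|n /= nm]; first exact: finite_II.
  rewrite -[X in measurable X]setTI; apply: measurableT_comp => //.
  exact: measurable_funB.
by apply/seteqP; split=> w h n nm; have := h n nm; rewrite /= in_itv.
Qed.

End Times.
End Bounds.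

(** * Decay of a dissipative linear equation over a block of time *)

Section OneVariable.
Context (R : realType).

Lemma cvg_sumr (T : Type) (F : set_system T) (FF : Filter F) n
    (h : 'I_n -> T -> R) (l : 'I_n -> R) :
  (forall i, h i x @[x --> F] --> l i) ->
  \sum_(i < n) h i x @[x --> F] --> \sum_(i < n) l i.
Proof.
move=> H; apply: cvg_big => [|i _]; last exact: H.
exact: (@add_continuous R^o).
Qed.

Implicit Types (f g : R -> R) (t : R).
Local Notation lambda := (@lebesgue_measure R).

Lemma is_derive_mulf f g t (df dg : R) : is_derive t 1 f df -> is_derive t 1 g dg ->
  is_derive t 1 (fun s => f s * g s) (f t * dg + g t * df).
Proof. by move=> hf hg; exact: is_deriveM. Qed.

Lemma is_derive_addf f g t (df dg : R) : is_derive t 1 f df -> is_derive t 1 g dg ->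
  is_derive t 1 (fun s => f s + g s) (df + dg).
Proof. by move=> hf hg; exact: is_deriveD. Qed.

Lemma is_derive_sumf n (h : 'I_n -> R -> R) t (dh : 'I_n -> R) :
  (forall i, is_derive t 1 (h i) (dh i)) ->
  is_derive t 1 (fun s => \sum_(i < n) h i s) (\sum_(i < n) dh i).
Proof.
move=> H; have := is_derive_sum H.
by rewrite (_ : \sum_(i < n) h i = fun s => \sum_(i < n) h i s)//; apply/funext => s; rewrite fct_sumE.
Qed.

Lemma is_derive_expRM (a t : R) : is_derive t 1 (fun s => expR (a * s)) (a * expR (a * t)).
Proof.
have h : is_derive t (1 : R) (fun s => a * s) a.
  by have := is_derive_mulf (is_derive_cst a t 1) (is_derive_id t 1); rewrite mulr1 mulr0 addr0.
have := @is_derive1_comp R expR (fun s => a * s) t _ _ (is_derive_expR (a * t)) h.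
by rewrite mulrC.
Qed.

Lemma continuous_clamp (U : topologicalType) (f : R -> U) :
  {within `[0, +oo[, continuous f} -> continuous (fun t => f (Num.max t 0)).
Proof.
move=> cf t V /= fV.
have m0 : (`[0, +oo[%classic : set R) (Num.max t 0) by rewrite /= in_itv/= andbT le_max lexx orbT.
have h : within `[0, +oo[%classic (nbhs (Num.max t 0)) (f @^-1` V).
  by rewrite nbhs_subspace_in//; exact: cf.
have cm : (fun s : R => Num.max s 0) @ t --> Num.max t 0.
  by apply: (@continuous_max _ R^o id (cst 0) t); [move=> W|exact: (@cst_continuous R R^o)].
suff : \forall s \near t, V (f (Num.max s 0)) by [].
near=> s.
have hs : `[0, +oo[%classic (Num.max s 0) -> (f @^-1` V) (Num.max s 0).
  by near: s; exact: (cm _ h).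
by apply: hs; rewrite /= in_itv/= andbT le_max lexx orbT.
Unshelve. all: by end_near. Qed.

Lemma continuous_segment_integrable f (a b : R) : continuous f ->
  lambda.-integrable `[a, b] (EFin \o f).
Proof.
move=> cf; apply: continuous_compact_integrable; first exact: segment_compact.
exact: continuous_subspaceT.
Qed.

Lemma continuous_integrable_oc f (a b : R) : continuous f ->
  lambda.-integrable `]a, b] (EFin \o f).
Proof.
move=> cf; have iS := @continuous_segment_integrable f a b cf.
by apply: (integrableS _ _ _ iS) => //; apply: subset_itvr; rewrite bnd_simp.
Qed.

(** An integral from [0]; it is zero at negative times. *)
Definition primitive f t : R := \int[lambda]_(s in `[0, t]) f s.

Lemma is_derive_primitive f t : continuous f -> 0 < t -> is_derive t 1 (primitive f) (f t).
Proof.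
move=> cf t0.
have t1 : t < t + 1 by rewrite ltrDl.
have [h1 h2] := continuous_FTC1_closed t1 (continuous_segment_integrable 0 (t + 1) cf) t0 (cf t).
by apply: DeriveDef; [exact: h1|rewrite -derive1E].
Qed.

Lemma continuous_primitive f (T : R) : continuous f -> 0 <= T ->
  {within `[0, T], continuous (primitive f)}.
Proof.
by move=> cf T0; exact: parameterized_integral_continuous T0 (continuous_segment_integrable _ _ cf).
Qed.

Lemma primitiveB f (s t : R) : continuous f -> 0 <= s -> s <= t ->
  primitive f t - primitive f s = \int[lambda]_(u in `]s, t]) f u.
Proof.
move=> cf s0 st; rewrite /primitive Rintegral_itvB ?bnd_simp//.
exact: continuous_segment_integrable.
Qed.

End OneVariable.

Lemma continuous_mulmx_entry (R : realType) (d : nat) (A : 'M[R]_d)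
    (x : R -> 'cV[R]_d) : continuous x ->
  forall i, continuous (fun s => (A *m x s) i 0).
Proof.
move=> cx i s; rewrite /continuous_at mxE.
under eq_fun do rewrite mxE.
apply: cvg_sumr => j; apply: cvgM; first exact: cvg_cst.
apply: (@continuous_comp _ _ _ x (fun M : 'cV[R]_d => M j 0)); first exact: cx.
exact: coord_continuous.
Qed.

Section Block.
Context (R : realType) (n d : nat).
Variables (L : 'M[R]_(n, d)) (A : 'M[R]_d) (lam : R).
Hypothesis lam0 : 0 < lam.

Definition quad_form (z : 'cV[R]_d) : R := \sum_(k < n) (L *m z) k 0 ^+ 2.

Hypothesis dissip : forall z : 'cV[R]_d,
  \sum_(k < n) (L *m z) k 0 * (L *m (A *m z)) k 0 <= - lam * quad_form z.

Definition drift (x : R -> 'cV[R]_d) (t : R) : 'cV[R]_d :=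
  \col_i \int[lebesgue_measure]_(s in `[0, t]) (A *m x s) i 0.

Lemma quad_form_ge0 z : 0 <= quad_form z.
Proof. by apply: sumr_ge0 => k _; exact: sqr_ge0. Qed.

(** Crude bound for the image of the unit ball of the sup norm. *)
Definition row_sum_bound (M : 'M[R]_(n, d)) : R := \sum_(k < n) (\sum_(i < d) `|M k i|) ^+ 2.

Lemma row_sum_bound_ge0 M : 0 <= row_sum_bound M.
Proof. by apply: sumr_ge0 => k _; exact: sqr_ge0. Qed.

Lemma sq_mulmx_le (M : 'M[R]_(n, d)) (z : 'cV[R]_d) u : 0 <= u ->
  (forall i, `|z i 0| <= u) -> \sum_(k < n) (M *m z) k 0 ^+ 2 <= row_sum_bound M * u ^+ 2.
Proof.
move=> u0 zu; rewrite /row_sum_bound mulr_suml; apply: ler_sum => k _.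
rewrite -exprMn -real_normK ?num_real// ler_pXn2r ?nnegrE ?mulr_ge0 ?sumr_ge0//.
rewrite mxE (le_trans (ler_norm_sum _ _ _))// mulr_suml; apply: ler_sum => i _.
by rewrite normrM ler_wpM2l.
Qed.

Lemma quad_formD_le (z y : 'cV[R]_d) e : 0 < e ->
  quad_form (z + y) <= (1 + e) * quad_form z + (1 + e^-1) * quad_form y.
Proof.
move=> e0; rewrite /quad_form !mulr_sumr -big_split/=; apply: ler_sum => k _.
rewrite mulmxDr mxE; move: ((L *m z) k 0) ((L *m y) k 0) => a b.
rewrite -subr_ge0 (_ : _ - _ = (e * a - b) ^+ 2 / e); last by field; rewrite gt_eqF.
by rewrite divr_ge0 ?sqr_ge0// ltW.
Qed.

Variable x : R -> 'cV[R]_d.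
Hypothesis cx : continuous x.

Let Ax i s : R := (A *m x s) i 0.

Let cAx i : continuous (Ax i) := @continuous_mulmx_entry R d A x cx i.

(** Removing from [x] the forcing accumulated since [a] gives a differentiable
    path [z] with [z' = A (z + mart)], and then
    [(quad_form z)' <= - lam * quad_form z + row_sum_bound (L *m A) / lam * u ^+ 2]. *)
Lemma block_decay (a b u : R) (mart : R -> 'cV[R]_d) : 0 <= a -> 0 <= u ->
  (forall t, a <= t -> t <= b -> mart t = x t - drift x t - (x a - drift x a)) ->
  (forall t i, a <= t -> t <= b -> `|mart t i 0| <= u) ->
  forall t, a <= t -> t <= b ->
  quad_form (x t - mart t) <= expR (- (lam * (t - a))) * quad_form (x a) + row_sum_bound (L *m A) / lam ^+ 2 * u ^+ 2.
Proof.
move=> a0 u0 martE martu t at' tb.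
pose C := row_sum_bound (L *m A) / lam ^+ 2 * u ^+ 2.
pose z s : 'cV[R]_d := x a - drift x a + drift x s.
have zE s : a <= s -> s <= b -> x s - mart s = z s.
  by move=> as' sb; rewrite martE// /z; apply/matrixP => i j; rewrite !mxE; ring.
pose g k s := (L *m (x a - drift x a)) k 0 + \sum_(i < d) L k i * primitive (Ax i) s.
have gE k s : (L *m z s) k 0 = g k s.
  rewrite /z mulmxDr mxE; congr (_ + _); rewrite mxE; apply: eq_bigr => i _.
  by rewrite mxE.
have dg k (s : R) : 0 < s -> is_derive s 1 (g k) ((L *m (A *m x s)) k 0).
  move=> s0; have := is_derive_addf (is_derive_cst ((L *m (x a - drift x a)) k 0) s 1)
    (is_derive_sumf (fun i => is_derive_mulf (is_derive_cst (L k i) s 1) (is_derive_primitive (@cAx i) s0))).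
  rewrite add0r (_ : \sum_(i < d) _ = (L *m (A *m x s)) k 0)// mxE.
  by apply: eq_bigr => i _; rewrite mulr0 addr0.
pose V s := \sum_(k < n) g k s * g k s.
have VE s : V s = quad_form (z s) by apply: eq_bigr => k _; rewrite gE.
(* Gronwall: this function is nonincreasing on the block. *)
pose W s := expR (lam * s) * (V s + - C).
pose dV s := \sum_(k < n) (g k s * (L *m (A *m x s)) k 0 + g k s * (L *m (A *m x s)) k 0).
have dVe (s : R) : 0 < s -> is_derive s 1 V (dV s).
  by move=> s0; apply: is_derive_sumf => k; apply: is_derive_mulf; exact: dg.
have dW (s : R) : 0 < s -> is_derive s 1 W (expR (lam * s) * (dV s + 0) + (V s + - C) * (lam * expR (lam * s))).
  move=> s0; apply: is_derive_mulf; first exact: is_derive_expRM.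
  exact: (is_derive_addf (dVe s s0) (is_derive_cst _ _ _)).
have cW : {within `[0, b], continuous W}.
  have [b0|b0] := leP 0 b; last first.
    by rewrite set_itv_ge ?bnd_simp -?ltNge//; exact: continuous_subspace0.
  have cg k : {within `[0, b], continuous (g k)}.
    move=> s; apply: cvgD; first exact: cvg_cst.
    apply: cvg_sumr => i; apply: cvgM; first exact: cvg_cst.
    exact: (continuous_primitive (@cAx i) b0).
  have ce : {within `[0, b], continuous (fun s => expR (lam * s))}.
    apply: continuous_subspaceT => s.
    apply: (@continuous_comp _ _ _ (fun s => lam * s) expR); last exact: continuous_expR.
    by apply: cvgM; [exact: cvg_cst|exact: cvg_id].
  move=> s; apply: cvgM; first exact: ce.
  apply: cvgD; last exact: cvg_cst.
  by apply: cvg_sumr => k; apply: cvgM; exact: cg.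
have Wle : forall s, s \in `]a, b[ -> derive1 W s <= 0.
  move=> s; rewrite in_itv/= => /andP[as' sb].
  have s0 := le_lt_trans a0 as'.
  rewrite derive1E (@derive_val _ _ _ _ _ _ _ (dW s s0)) addr0.
  rewrite [X in _ + X](_ : _ = expR (lam * s) * (lam * (V s - C))); last by ring.
  rewrite -mulrDr pmulr_rle0 ?expR_gt0//.
  have -> : dV s = \sum_(k < n) 2 * (g k s * (L *m (A *m x s)) k 0).
    by apply: eq_bigr => k _; rewrite mulr_natl mulr2n.
  have xs : x s = z s + mart s by rewrite -(zE s (ltW as') (ltW sb)) subrK.
  have e1 : \sum_(k < n) 2 * (g k s * (L *m (A *m x s)) k 0) <=
     2 * (\sum_(k < n) (L *m z s) k 0 * (L *m (A *m z s)) k 0) +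
     (lam * V s + lam^-1 * \sum_(k < n) ((L *m A) *m mart s) k 0 ^+ 2).
    rewrite !mulr_sumr -!big_split/=; apply: ler_sum => k _.
    have -> : (L *m (A *m x s)) k 0 = (L *m (A *m z s)) k 0 + (L *m A *m mart s) k 0.
      by rewrite xs !mulmxDr mxE -(mulmxA L A (mart s)).
    rewrite gE.
    move: (g k s) ((L *m (A *m z s)) k 0) ((L *m A *m mart s) k 0) => p q w.
    rewrite -subr_ge0 (_ : _ - _ = (lam * p - w) ^+ 2 / lam); last by field; rewrite gt_eqF.
    by rewrite divr_ge0 ?sqr_ge0// ltW.
  have e2 := dissip (z s); rewrite -VE in e2.
  have e3 := @sq_mulmx_le (L *m A) (mart s) u u0 (fun i => martu s i (ltW as') (ltW sb)).
  have e4 : lam^-1 * \sum_(k < n) ((L *m A) *m mart s) k 0 ^+ 2 <= lam * C.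
    rewrite [lam * C](_ : _ = lam^-1 * (row_sum_bound (L *m A) * u ^+ 2)); last first.
      by rewrite /C; field; rewrite gt_eqF.
    by rewrite ler_pM2l ?invr_gt0.
  move: e1 e2 e4; move: (\sum_(k < n) 2 * _) (\sum_(k < n) (L *m z s) k 0 * _) (lam^-1 * _) => y1 y2 y3.
  rewrite mulrBr mulNr; move: (lam * V s) (lam * C) => y4 y5; lra.
have dWd : forall s, s \in `]a, b[ -> derivable W s 1.
  move=> s; rewrite in_itv/= => /andP[as' sb].
  by apply: ex_derive; exact: dW (le_lt_trans a0 as').
have cWab : {within `[a, b], continuous W}.
  by apply: continuous_subspaceW cW; apply: subset_itvr; rewrite bnd_simp.
have := @ler0_derive1_nincr R W a b dWd Wle cWab a t (lexx a) at' tb.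
rewrite /W !VE (_ : z a = x a); last by rewrite /z subrK.
rewrite zE// -/C -lerBlDr => h.
have -> : expR (- (lam * (t - a))) = expR (lam * a) / expR (lam * t).
  by rewrite -expRN -expRD; congr expR; ring.
rewrite mulrAC ler_pdivlMr ?expR_gt0// mulrC (le_trans h)// ler_pM2l ?expR_gt0//.
rewrite lerBlDr lerDl mulr_ge0 ?sqr_ge0// divr_ge0 ?sqr_ge0//; exact: row_sum_bound_ge0.
Qed.

End Block.

(** * Lyapunov forms of stable matrices *)

Section Schur.
Context (R : realType).
Local Notation C := (R[i]).

Lemma ReM (x y : C) : complex.Re (x * y) =
  complex.Re x * complex.Re y - complex.Im x * complex.Im y.
Proof. by case: x; case: y. Qed.

Lemma ImM (x y : C) : complex.Im (x * y) =
  complex.Re x * complex.Im y + complex.Im x * complex.Re y.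
Proof. by case: x; case: y. Qed.

Lemma Re_sum (I : Type) (s : seq I) (F : I -> C) :
  complex.Re (\sum_(i <- s) F i) = \sum_(i <- s) complex.Re (F i).
Proof. by apply: (big_morph (@complex.Re R)) => // -[? ?] [? ?]. Qed.

Lemma Im_sum (I : Type) (s : seq I) (F : I -> C) :
  complex.Im (\sum_(i <- s) F i) = \sum_(i <- s) complex.Im (F i).
Proof. by apply: (big_morph (@complex.Im R)) => // -[? ?] [? ?]. Qed.

Local Notation Rem := (map_mx (@complex.Re R)).
Local Notation Imm := (map_mx (@complex.Im R)).

Lemma Rem_mul m n p (X : 'M[C]_(m, n)) (Y : 'M[C]_(n, p)) :
  Rem (X *m Y) = Rem X *m Rem Y - Imm X *m Imm Y.
Proof.
apply/matrixP => i j; rewrite !mxE Re_sum -sumrB; apply: eq_bigr => k _.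
by rewrite ReM !mxE.
Qed.

Lemma Imm_mul m n p (X : 'M[C]_(m, n)) (Y : 'M[C]_(n, p)) :
  Imm (X *m Y) = Rem X *m Imm Y + Imm X *m Rem Y.
Proof.
apply/matrixP => i j; rewrite !mxE Im_sum -big_split/=; apply: eq_bigr => k _.
by rewrite ImM !mxE.
Qed.

(** Schur triangularization over the complex numbers, [P A = T P], read in real
    and imaginary parts; the diagonal of [T] consists of eigenvalues of [A]. *)
Lemma schur_real (d : nat) (A : 'M[R]_d) : (0 < d)%N -> stable_matrix A ->
  exists Pr Pi Tr Ti Nr Ni : 'M[R]_d,
  [/\ Pr *m A = Tr *m Pr - Ti *m Pi, Pi *m A = Tr *m Pi + Ti *m Pr,
      Nr *m Pr - Ni *m Pi = 1%:M, (forall i, Tr i i < 0) &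
      forall i j : 'I_d, (i < j)%N -> Tr i j = 0 /\ Ti i j = 0].
Proof.
move=> d0 sA; pose Ac := map_mx (real_complex R) A.
have [P /unitarymx_unit Pu Ptrig] := Schur Ac d0.
have {}Ptrig : is_trig_mx (P *m Ac *m invmx P).
  by move: Ptrig; rewrite /mxred.similar_to /= mxred.conjumx.
pose T := P *m Ac *m invmx P.
have PT : P *m Ac = T *m P by rewrite /T mulmxKV.
have ReA : Rem Ac = A by apply/matrixP => i j; rewrite !mxE.
have ImA : Imm Ac = 0 by apply/matrixP => i j; rewrite !mxE.
have eigT i : eigenvalue Ac (T i i).
  have : eigenvalue T (T i i).
    rewrite eigenvalue_root_char char_poly_trig// rootE horner_prod (bigD1 i)//=.
    by rewrite hornerXsubC subrr mul0r.
  move=> /eigenvalueP[v vT v0]; apply/eigenvalueP; exists (v *m P).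
    by rewrite -mulmxA PT mulmxA vT scalemxAl.
  by apply: contra v0 => /eqP vP; rewrite -(mulmxK Pu v) vP mul0mx.
exists (Rem P), (Imm P), (Rem T), (Imm T), (Rem (invmx P)), (Imm (invmx P)); split.
- by rewrite -Rem_mul -PT Rem_mul ReA ImA mulmx0 subr0.
- by rewrite addrC -[in RHS]addrC -Imm_mul -PT Imm_mul ReA ImA mulmx0 add0r.
- rewrite -Rem_mul mulVmx//; apply/matrixP => i j; rewrite !mxE.
  by case: (i == j).
- by move=> i; rewrite [Rem T i i]mxE; apply: sA; exact: eigT.
- move=> i j ij; have /is_trig_mxP/(_ i j ij) Tij := Ptrig.
  by rewrite [Rem T i j]mxE [Imm T i j]mxE Tij.
Qed.

Lemma norm_dot_le (a b p q : R) (t : R) :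
  t * (a * p + b * q) <= `|t| * ((a ^+ 2 + b ^+ 2) + (p ^+ 2 + q ^+ 2)).
Proof.
have h0 : 0 <= a ^+ 2 + b ^+ 2 + (p ^+ 2 + q ^+ 2) by rewrite !addr_ge0 ?sqr_ge0.
apply: (le_trans (ler_norm _)); rewrite normrM ler_wpM2l// ler_norml; apply/andP; split.
  rewrite -subr_ge0 (_ : _ - _ = ((a + p) ^+ 2 + (b + q) ^+ 2 + (a ^+ 2 + b ^+ 2 + (p ^+ 2 + q ^+ 2))) / 2); last by field.
  by rewrite divr_ge0// addr_ge0// addr_ge0 ?sqr_ge0.
rewrite -subr_ge0 (_ : _ - _ = ((a - p) ^+ 2 + (b - q) ^+ 2 + (a ^+ 2 + b ^+ 2 + (p ^+ 2 + q ^+ 2))) / 2); last by field.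
by rewrite divr_ge0// addr_ge0// addr_ge0 ?sqr_ge0.
Qed.

(** Lyapunov's theorem. The form is the squared modulus of rescaled Schur
    coordinates: conjugating the triangular form by [diag (1, dl, dl ^ 2, ...)]
    makes its off-diagonal part negligible against the diagonal, whose real part
    is negative. *)
Lemma lyapunov (d : nat) (A : 'M[R]_d) : (0 < d)%N -> stable_matrix A ->
  exists (n : nat) (L : 'M[R]_(n, d)) (al lam : R), [/\ 0 < al, 0 < lam,
   forall z : 'cV[R]_d, al * (\sum_i z i 0 ^+ 2) <= quad_form L z &
   forall z : 'cV[R]_d,
     \sum_(k < n) (L *m z) k 0 * (L *m (A *m z)) k 0 <= - lam * quad_form L z].
Proof.
move=> d0 sA; have [Pr [Pi [Tr [Ti [Nr [Ni [PA1 PA2 NP T0 Tz]]]]]]] := schur_real d0 sA.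
(* The factor 2 leaves room for the off-diagonal part. *)
have [mu mu0 hmu] : exists2 mu, 0 < mu & forall i, Tr i i <= - (2 * mu).
  pose g := \big[Num.min/1]_(i < d) (- Tr i i / 2).
  have g0 : 0 < g.
    by apply: lt_bigmin => // i _; rewrite divr_gt0// oppr_gt0.
  exists g => // i.
  have : g <= - Tr i i / 2 by exact: bigmin_le_cond.
  by lra.
pose K := \sum_i \sum_j (`|Tr i j| + `|Ti i j|).
have K0 : 0 <= K by apply: sumr_ge0 => i _; apply: sumr_ge0 => j _; rewrite addr_ge0.
have TK i j : `|Tr i j| + `|Ti i j| <= K.
  rewrite /K (bigD1 i)//= (bigD1 j)//= -addrA lerDl addr_ge0//.
    by apply: sumr_ge0 => k _; rewrite addr_ge0.
  by apply: sumr_ge0 => k _; apply: sumr_ge0 => l _; rewrite addr_ge0.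
pose dl := Num.min 1 (mu / (2 * d%:R * (K + 1))).
have dn0 : 0 < d%:R :> R by rewrite ltr0n.
have dl0 : 0 < dl.
  by rewrite lt_min ltr01/= divr_gt0// !mulr_gt0// ltr_wpDl.
have dl1 : dl <= 1 by rewrite ge_min lexx.
have dlK : dl * K * (2 * d%:R) <= mu.
  have : dl <= mu / (2 * d%:R * (K + 1)) by rewrite ge_min lexx orbT.
  rewrite ler_pdivlMr; last by rewrite !mulr_gt0// ltr_wpDl.
  apply: le_trans; rewrite -mulrA ler_pM2l// mulrC ler_pM2l ?mulr_gt0//.
  by rewrite lerDl.
(* The Schur coordinates are rescaled by the powers of [dl]: the triangular form
   keeps its diagonal, and the entries below it are multiplied by positive powers
   of [dl]. *)
pose s (i : nat) : R := dl ^+ i.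
have s0 i : 0 < s i by rewrite exprn_gt0.
pose Sr := \matrix_(i < d, j < d) (s i * Pr i j).
pose Si := \matrix_(i < d, j < d) (s i * Pi i j).
pose L := col_mx Sr Si.
pose Ur (i j : 'I_d) := s i / s j * Tr i j.
pose Ui (i j : 'I_d) := s i / s j * Ti i j.
(* Real and imaginary parts of the rescaled coordinates of [z]. *)
pose a (z : 'cV[R]_d) i := (Sr *m z) i 0.
pose b (z : 'cV[R]_d) i := (Si *m z) i 0.
have rE (M : 'M[R]_d) (z : 'cV[R]_d) (i : 'I_d) :
    ((\matrix_(i < d, j < d) (s i * M i j)) *m z) i 0 = s i * (M *m z) i 0.
  by rewrite !mxE mulr_sumr; apply: eq_bigr => j _; rewrite mxE mulrA.
have aE z i : (Pr *m z) i 0 = a z i / s i.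
  by rewrite /a rE mulrC mulKf// gt_eqF.
have bE z i : (Pi *m z) i 0 = b z i / s i.
  by rewrite /b rE mulrC mulKf// gt_eqF.
have mE (M : 'M[R]_d) (z : 'cV[R]_d) i : (M *m z) i 0 = \sum_j M i j * z j 0.
  by rewrite mxE.
have subE (x y : 'cV[R]_d) i : (x - y) i 0 = x i 0 - y i 0 by rewrite !mxE.
have addE (x y : 'cV[R]_d) i : (x + y) i 0 = x i 0 + y i 0 by rewrite mxE.
have aA z i : a (A *m z) i = \sum_j (Ur i j * a z j - Ui i j * b z j).
  rewrite [a (A *m z) i]/a rE mulmxA PA1 mulmxBl -!mulmxA subE !mE mulrDr mulrN !mulr_sumr -sumrB.
  by apply: eq_bigr => j _; rewrite aE bE /Ur /Ui; field; rewrite !gt_eqF.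
have bA z i : b (A *m z) i = \sum_j (Ur i j * b z j + Ui i j * a z j).
  rewrite [b (A *m z) i]/b rE mulmxA PA2 mulmxDl -!mulmxA addE !mE mulrDr !mulr_sumr -big_split.
  by apply: eq_bigr => j _; rewrite aE bE /Ur /Ui /=; field; rewrite !gt_eqF.
pose p z i := a z i ^+ 2 + b z i ^+ 2.
have p0 z i : 0 <= p z i by rewrite addr_ge0 ?sqr_ge0.
have qE z : quad_form L z = \sum_i p z i.
  rewrite /quad_form big_split_ord/= /L mul_col_mx -big_split/=; apply: eq_bigr => i _.
  by rewrite col_mxEu col_mxEd.
pose S z := \sum_i p z i.
have S0 z : 0 <= S z by apply: sumr_ge0.
have UK i j : i != j -> `|Ur i j| + `|Ui i j| <= dl * K.
  move=> ij; rewrite /Ur /Ui; case: (ltnP i j) => [ij'|ji].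
    by have [-> ->] := Tz _ _ ij'; rewrite !mulr0 normr0 addr0 mulr_ge0// ltW.
  have {}ji : (j < i)%N by rewrite ltn_neqAle ji andbT eq_sym.
  have sij : 0 <= s i / s j <= dl.
    rewrite divr_ge0 ?(ltW (s0 _))//= ler_pdivrMr// -exprS.
    by rewrite /s -(subnKC ji) exprD ler_piMr ?exprn_ge0 ?exprn_ile1// ltW.
  have /andP[sij0 sijd] := sij.
  rewrite (normrM _ (Tr i j)) (normrM _ (Ti i j)) (ger0_norm sij0) -mulrDr ler_pM// ?TK// addr_ge0//.
have dissip z : \sum_(k < d + d) (L *m z) k 0 * (L *m (A *m z)) k 0 <= - mu * S z.
  have -> : \sum_(k < d + d) (L *m z) k 0 * (L *m (A *m z)) k 0 =
      \sum_i \sum_j (Ur i j * (a z i * a z j + b z i * b z j) +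
                     Ui i j * (b z i * a z j + a z i * - b z j)).
    rewrite big_split_ord/= /L !mul_col_mx -big_split/=; apply: eq_bigr => i _.
    rewrite !col_mxEu !col_mxEd -/(a z i) -/(b z i) -/(a (A *m z) i) -/(b (A *m z) i).
    rewrite aA bA !mulr_sumr -big_split/=; apply: eq_bigr => j _; ring.
  apply: (@le_trans _ _ (\sum_i (- (2 * mu) * p z i + \sum_j dl * K * (p z i + p z j)))).
    apply: ler_sum => i _; rewrite (bigD1 i)//= [X in _ <= _ + X](bigD1 i)//=.
    rewrite addrA lerD//; last first.
      apply: ler_sum => j ji.
      apply: (@le_trans _ _ ((`|Ur i j| + `|Ui i j|) * (p z i + p z j))).
        rewrite mulrDl lerD// ?norm_dot_le//.
        apply: (le_trans (norm_dot_le _ _ _ _ _)).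
        by rewrite sqrrN /p [b z i ^+ 2 + _]addrC.
      apply: ler_wpM2r; first exact: addr_ge0.
      by apply: UK; rewrite eq_sym.
    rewrite /Ur divff ?gt_eqF// mul1r [X in _ + X]mulrC mulrN [a z i * b z i]mulrC subrr mul0r addr0.
    rewrite -!expr2 -/(p z i) -[leLHS]addr0 lerD//.
      by rewrite ler_wpM2r.
    by apply: mulr_ge0; [apply: mulr_ge0 => //; exact: ltW|exact: addr_ge0].
  rewrite big_split/= -mulr_sumr -/(S z).
  have -> : \sum_i \sum_j dl * K * (p z i + p z j) = dl * K * (2 * d%:R) * S z.
    transitivity (\sum_(i < d) (dl * K * d%:R * p z i + dl * K * S z)).
      apply: eq_bigr => i _; rewrite -mulr_sumr big_split/= sumr_const card_ord -/(S z).
      by rewrite -mulr_natr; ring.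
    rewrite big_split/= -mulr_sumr -/(S z) sumr_const card_ord -mulr_natr; ring.
  rewrite -mulrDl ler_wpM2r//; move: dlK; move: (dl * K * _) => y; lra.
pose c i := \sum_j (`|Nr i j| + `|Ni i j|) / s j.
have c0 i : 0 <= c i by apply: sumr_ge0 => j _; rewrite divr_ge0 ?addr_ge0// ltW.
pose cc := 1 + \sum_i c i ^+ 2.
have cc0 : 0 < cc by rewrite ltr_pwDl// sumr_ge0// => i _; exact: sqr_ge0.
exists (d + d)%N, L, cc^-1, mu; split=> //; first by rewrite invr_gt0.
  move=> z; rewrite qE -/(S z) mulrC ler_pdivrMr//.
  have zE i : z i 0 = \sum_j (Nr i j * (a z j / s j) - Ni i j * (b z j / s j)).
    rewrite -[in LHS](mul1mx z) -NP mulmxBl -!mulmxA subE !mE -sumrB.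
    by apply: eq_bigr => j _; rewrite aE bE.
  have rt : 0 <= Num.sqrt (S z) by exact: sqrtr_ge0.
  have pS j : p z j <= S z by rewrite /S (bigD1 j)//= lerDl sumr_ge0.
  have aS j : `|a z j| <= Num.sqrt (S z).
    by rewrite -sqrtr_sqr ler_sqrt// (le_trans _ (pS j))// /p lerDl sqr_ge0.
  have bS j : `|b z j| <= Num.sqrt (S z).
    by rewrite -sqrtr_sqr ler_sqrt// (le_trans _ (pS j))// /p lerDr sqr_ge0.
  have zc i : z i 0 ^+ 2 <= c i ^+ 2 * S z.
    rewrite -[X in _ <= _ * X](sqr_sqrtr (S0 z)) -exprMn -[leLHS]real_normK ?num_real//.
    rewrite ler_pXn2r ?nnegrE ?mulr_ge0// zE (le_trans (ler_norm_sum _ _ _))//.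
    rewrite /c mulr_suml; apply: ler_sum => j _; rewrite (le_trans (ler_normB _ _))//.
    rewrite !normrM normfV (gtr0_norm (s0 j)) mulrDl mulrDl lerD//.
      by rewrite -[leRHS]mulrA ler_wpM2l// mulrC ler_wpM2l// invr_ge0 ltW.
    by rewrite -[leRHS]mulrA ler_wpM2l// mulrC ler_wpM2l// invr_ge0 ltW.
  apply: (@le_trans _ _ (\sum_i c i ^+ 2 * S z)); first exact: ler_sum.
  by rewrite -mulr_suml mulrC ler_wpM2l// /cc lerDr.
by move=> z; rewrite qE; exact: dissip.
Qed.

End Schur.

(** * Pathwise control of the solution by the forcing over blocks *)

(** Increment over [a, t] of the forcing term of the equation. For a solution it is
    an increment of the stochastic integral, but it makes sense path by path. *)
Definition forcing_incr (R : realType) (d : nat) (A : 'M[R]_d) (x : R -> 'cV[R]_d) (a t : R) : 'cV[R]_d :=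
  x t - drift A x t - (x a - drift A x a).

Section Recursion.
Context (R : realType).
Implicit Types (W u : nat -> R) (rho C : R).

Lemma rec_limsup W u rho C y n0 e : 0 < rho -> rho < 1 -> 0 <= C ->
  (forall n, 0 <= W n) -> (forall n, W n.+1 <= rho * W n + C * u n ^+ 2) ->
  (forall n, 0 <= u n) -> (forall n, (n0 <= n)%N -> u n <= y) -> 0 < e ->
  exists n1, forall n, (n1 <= n)%N -> W n <= C * y ^+ 2 / (1 - rho) + e.
Proof.
move=> r0 r1 C0 W0 WS u0 uy e0; have r10 : 0 < 1 - rho by rewrite subr_gt0.
pose K := C * y ^+ 2 / (1 - rho).
have step k : W (n0 + k)%N <= rho ^+ k * W n0 + K.
  elim: k => [|k IH].
    rewrite addn0 expr0 mul1r lerDl; apply: divr_ge0; last exact: ltW.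
    by apply: mulr_ge0 => //; exact: sqr_ge0.
  rewrite addnS (le_trans (WS _))//.
  apply: (@le_trans _ _ (rho * (rho ^+ k * W n0 + K) + C * y ^+ 2)).
    rewrite lerD//; first by rewrite ler_pM2l.
    apply: ler_wpM2l => //; rewrite ler_pXn2r ?nnegrE ?uy ?leq_addr//.
    exact: (le_trans (u0 n0) (uy _ (leqnn _))).
  rewrite le_eqVlt; apply/orP; left; apply/eqP; rewrite (exprS rho) /K.
  by move: (rho ^+ k) (W n0) => z w; field; rewrite gt_eqF.
have c0 : rho ^+ k * W n0 @[k --> \oo] --> 0.
  rewrite -[X in _ --> X](mul0r (W n0)); apply: cvgM; last exact: cvg_cst.
  by apply: cvg_expr; rewrite ger0_norm// ltW.
have [N _ hN] : \forall k \near \oo, rho ^+ k * W n0 < e.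
  by apply: (cvgr_lt 0 c0).
exists (n0 + N)%N => n nN; rewrite -(subnKC (leq_trans (leq_addr N n0) nN)).
rewrite (le_trans (step _))// addrC lerD2l ltW//; apply: hN => /=.
by rewrite -(leq_add2l n0) subnKC// (leq_trans (leq_addr N n0)).
Qed.

Lemma rec_sum W u rho C N : 0 < rho -> rho < 1 ->
  (forall n, 0 <= W n) -> (forall n, W n.+1 <= rho * W n + C * u n ^+ 2) ->
  \sum_(n < N) W n <= (W 0%N + C * \sum_(n < N) u n ^+ 2) / (1 - rho).
Proof.
move=> r0 r1 W0 WS; rewrite ler_pdivlMr ?subr_gt0//.
suff : \sum_(n < N) W n + W N <= W 0%N + rho * (\sum_(n < N) W n) + C * \sum_(n < N) u n ^+ 2.
  have := W0 N; rewrite mulrBr mulr1 [_ * rho]mulrC.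
  move: (W N) (\sum_(n < N) W n) (rho * _) (C * _) (W 0%N) => a b c e f; lra.
elim: N => [|N IH]; first by rewrite !big_ord0 !mulr0 !addr0 add0r.
rewrite !big_ord_recr/= !mulrDr; have := WS N; move: IH.
move: (W N.+1) (W N) (\sum_(n < N) W n) (rho * _) (rho * _) (C * _) (C * _) (W 0%N).
by move=> a b c e f g k l; lra.
Qed.

End Recursion.

Section Path.
Context (R : realType) (d : nat) (A : 'M[R]_d).
Hypothesis d0 : (0 < d)%N.
Hypothesis sA : stable_matrix A.
Variable h : R.
Hypothesis h0 : 0 < h.
Local Notation lambda := (@lebesgue_measure R).
Implicit Types (x : R -> 'cV[R]_d) (u : nat -> R).

Definition block_bound x u := forall (n : nat) t i, n%:R * h <= t -> t <= n.+1%:R * h ->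
  `|forcing_incr A x (n%:R * h) t i 0| <= u n.

(** [W n] is the Lyapunov form at the beginning of block [n]. The cross terms
    between the decayed form and the forcing are absorbed by a contraction factor
    [rho] slightly larger than the one of [block_decay]. *)
Lemma path_bound : exists C rho, [/\ 0 < C, 0 < rho, rho < 1 &
  forall x u, continuous x -> (forall n, 0 <= u n) -> block_bound x u ->
  exists W : nat -> R, [/\ (forall n, 0 <= W n),
    (forall n, W n.+1 <= rho * W n + C * u n ^+ 2) &
    forall n t, n%:R * h <= t -> t <= n.+1%:R * h ->
      fnorm (x t) ^+ 2 <= C * (W n + u n ^+ 2)]].
Proof.
have [n [L [al [lam [al0 lam0 Lal Ldis]]]]] := lyapunov d0 sA.
pose q := expR (- (lam * h)).
have q0 : 0 < q by exact: expR_gt0.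
have q1 : q < 1 by rewrite -[ltRHS]expR0 ltr_expR oppr_lt0 mulr_gt0.
pose rho := (1 + q) / 2; pose e := (q^-1 - 1) / 2.
have e0 : 0 < e by rewrite divr_gt0// subr_gt0 invf_gt1.
have rhoE : (1 + e) * q = rho by rewrite /e /rho; field; rewrite gt_eqF.
pose c1 := row_sum_bound (L *m A) / lam ^+ 2; pose cL := row_sum_bound L.
have c10 : 0 <= c1 by rewrite divr_ge0 ?row_sum_bound_ge0// sqr_ge0.
have cL0 : 0 <= cL by exact: row_sum_bound_ge0.
pose C1 := (1 + e) * c1 + (1 + e^-1) * cL; pose C2 := 2 * c1 + 2 * cL + 2.
have C10 : 0 <= C1 by rewrite addr_ge0// mulr_ge0// addr_ge0// ?invr_ge0 ltW.
have C20 : 0 < C2 by rewrite ltr_wpDl// addr_ge0// mulr_ge0.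
pose C := C1 + C2 / al.
have C0 : 0 < C by rewrite ltr_wpDl// divr_gt0.
exists C, rho; split=> //.
- by rewrite divr_gt0// ltr_wpDl// ltW.
- by rewrite /rho; move: q1; lra.
move=> x u cx u0 bu; exists (fun m => quad_form L (x (m%:R * h))); split.
- by move=> m; exact: quad_form_ge0.
- move=> m; have mh0 : 0 <= m%:R * h by rewrite mulr_ge0// ltW.
  have mS : m%:R * h <= m.+1%:R * h by rewrite ler_pM2r// ler_nat.
  have := @block_decay R n d L A lam lam0 Ldis x cx (m%:R * h) (m.+1%:R * h) (u m)
    (forcing_incr A x (m%:R * h)) mh0 (u0 m) (fun t _ _ => erefl) (fun t i h1 h2 => bu m t i h1 h2)
    (m.+1%:R * h) mS (lexx _).
  rewrite -mulrBl -natrB// subSnn mul1r -/q -/c1.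
  have := @sq_mulmx_le R n d L (forcing_incr A x (m%:R * h) (m.+1%:R * h)) (u m) (u0 m)
     (fun i => bu m _ i mS (lexx _)).
  rewrite -/(quad_form L _) -/cL => b1 b2.
  have := quad_formD_le L (x (m.+1%:R * h) - forcing_incr A x (m%:R * h) (m.+1%:R * h))
    (forcing_incr A x (m%:R * h) (m.+1%:R * h)) e0.
  rewrite subrK => /le_trans; apply.
  apply: (@le_trans _ _ ((1 + e) * (q * quad_form L (x (m%:R * h)) + c1 * u m ^+ 2) + (1 + e^-1) * (cL * u m ^+ 2))).
    by rewrite lerD// ler_wpM2l// addr_ge0// ?invr_ge0 ltW.
  rewrite mulrDr [(1 + e) * (q * _)]mulrA rhoE -addrA lerD2l.
  rewrite [leLHS](_ : _ = C1 * u m ^+ 2); last by rewrite /C1; ring.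
  by rewrite ler_wpM2r ?sqr_ge0// /C lerDl divr_ge0// ltW.
- move=> m t mt tm; have mh0 : 0 <= m%:R * h by rewrite mulr_ge0// ltW.
  have := @block_decay R n d L A lam lam0 Ldis x cx (m%:R * h) (m.+1%:R * h) (u m)
    (forcing_incr A x (m%:R * h)) mh0 (u0 m) (fun t _ _ => erefl) (fun t i h1 h2 => bu m t i h1 h2)
    t mt tm.
  rewrite -/c1.
  have := @sq_mulmx_le R n d L (forcing_incr A x (m%:R * h) t) (u m) (u0 m)
     (fun i => bu m _ i mt tm).
  rewrite -/(quad_form L _) -/cL => b1 b2.
  have := quad_formD_le L (x t - forcing_incr A x (m%:R * h) t) (forcing_incr A x (m%:R * h) t) ltr01.
  rewrite subrK invr1 => b3.
  have b4 := Lal (x t).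
  have -> : fnorm (x t) ^+ 2 = \sum_i x t i 0 ^+ 2.
    by rewrite fnorm2; apply: eq_bigr => i _; rewrite big_ord1.
  have W0 := quad_form_ge0 L (x (m%:R * h)).
  have b5 : expR (- (lam * (t - m%:R * h))) * quad_form L (x (m%:R * h)) <= quad_form L (x (m%:R * h)).
    by rewrite ler_piMl// -[leRHS]expR0 ler_expR oppr_le0 mulr_ge0 ?subr_ge0// ltW.
  have u20 : 0 <= u m ^+ 2 by exact: sqr_ge0.
  have b6 : quad_form L (x t) <= C2 * (quad_form L (x (m%:R * h)) + u m ^+ 2).
    apply: (@le_trans _ _ (2 * (quad_form L (x (m%:R * h)) + c1 * u m ^+ 2) + 2 * (cL * u m ^+ 2))).
      move: b1 b2 b3 b5; move: (c1 * _) (cL * _) (expR _ * _) => y1 y2 y3.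
      rewrite (_ : 1 + 1 = 2 :> R)//; lra.
    rewrite -subr_ge0 (_ : _ - _ = (2 * c1 + 2 * cL) * quad_form L (x (m%:R * h)) + 2 * u m ^+ 2); last by rewrite /C2; ring.
    by apply: addr_ge0; apply: mulr_ge0 => //; apply: addr_ge0; apply: mulr_ge0.
  rewrite -(ler_pM2l al0) (le_trans b4)// (le_trans b6)// mulrA ler_wpM2r ?addr_ge0//.
  by rewrite /C mulrDr [al * (C2 / al)]mulrC divfK ?gt_eqF// lerDr mulr_ge0// ltW.
Qed.

Lemma exists_block t : 0 <= t -> exists n : nat, n%:R * h <= t /\ t < n.+1%:R * h.
Proof.
move=> t0; exists (Num.truncn (t / h)).
have := truncn_itv (divr_ge0 t0 (ltW h0)).
by rewrite ler_pdivlMr// ltr_pdivrMr// => /andP[].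
Qed.

End Path.

Section Limsup.
Context (R : realType).
Implicit Types (f : R -> R).

Lemma limf_esup_le f (K T : R) : (forall t, T <= t -> f t <= K) ->
  (limf_esup (fun t => (f t)%:E) (+oo%R : set_system R) <= K%:E)%E.
Proof.
move=> fK; rewrite limf_esupE; apply: (@le_trans _ _ (ereal_sup ((fun t => (f t)%:E) @` [set t | T <= t]))).
  apply: ereal_inf_lbound; exists [set t | T <= t] => //.
  exact: nbhs_pinfty_ge (num_real T).
by apply: ge_ereal_sup => _ [t /= Tt <-]; rewrite lee_fin fK.
Qed.

Lemma limf_esup_ge f (b : R) : (forall T, exists2 t, T <= t & b <= f t) ->
  (b%:E <= limf_esup (fun t => (f t)%:E) (+oo%R : set_system R))%E.
Proof.
move=> fb; rewrite limf_esupE; apply: le_ereal_inf_tmp => _ [V [M [_ MV]] <-].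
have [t Mt bt] := fb (M + 1).
apply: (@le_trans _ _ (f t)%:E); first by rewrite lee_fin.
apply: ereal_sup_ubound; exists t => //; apply: MV.
by rewrite (lt_le_trans _ Mt)// ltrDl.
Qed.

Lemma limf_einf0 f : (forall t, 0 <= f t) ->
  (forall e T, 0 < e -> exists2 t, T <= t & f t <= e) ->
  limf_einf (fun t => (f t)%:E) (+oo%R : set_system R) = 0%E.
Proof.
move=> f0 fe; rewrite limf_einfE; apply/eqP; rewrite eq_le; apply/andP; split.
  apply: ge_ereal_sup => _ [V [M [_ MV]] <-]; apply/lee_addgt0Pr => e e0; rewrite add0e.
  have [t Mt te] := fe e (M + 1) e0.
  apply: (@le_trans _ _ (f t)%:E); last by rewrite lee_fin.
  apply: ereal_inf_lbound; exists t => //; apply: MV.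
  by rewrite (lt_le_trans _ Mt)// ltrDl.
apply: (@le_trans _ _ (ereal_inf ((fun t => (f t)%:E) @` setT))).
  by apply: le_ereal_inf_tmp => _ [t _ <-]; rewrite lee_fin.
by apply: ereal_sup_ubound; exists setT => //; exact: filterT.
Qed.

End Limsup.

Lemma entry_le_fnorm (R : realType) (m n : nat) (M : 'M[R]_(m, n)) i j :
  `|M i j| <= fnorm M.
Proof.
have f0 : 0 <= fnorm M by exact: sqrtr_ge0.
by rewrite -(@ler_pXn2r _ 2) ?nnegrE// real_normK ?num_real// entry_le_fnorm2.
Qed.

Section PathConsequences.
Context (R : realType) (d : nat) (A : 'M[R]_d).
Hypothesis d0 : (0 < d)%N.
Hypothesis sA : stable_matrix A.
Variable h : R.
Hypothesis h0 : 0 < h.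
Local Notation lambda := (@lebesgue_measure R).
Implicit Types (x : R -> 'cV[R]_d) (u : nat -> R).

Let nh0 (n : nat) : 0 <= n%:R * h. Proof. by rewrite mulr_ge0// ltW. Qed.
Let nhS (n : nat) : n%:R * h <= n.+1%:R * h.
Proof. by rewrite ler_pM2r// ler_nat. Qed.

Lemma forcing_incrE x a t i : continuous x ->
  forcing_incr A x a t i 0 = x t i 0 - primitive (fun s => (A *m x s) i 0) t -
    (x a i 0 - primitive (fun s => (A *m x s) i 0) a).
Proof. by move=> cx; rewrite /forcing_incr !mxE. Qed.

(** Suprema over blocks: the least block bounds of a given path. *)
Lemma exists_block_sup x : continuous x -> exists u,
  [/\ (forall n, 0 <= u n), block_bound A h x u &
    forall n y, 0 <= y -> (forall t i, n%:R * h <= t -> t <= n.+1%:R * h ->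
      `|forcing_incr A x (n%:R * h) t i 0| <= y) -> u n <= y].
Proof.
move=> cx.
have /choice[c hc] (p : nat * 'I_d) : exists c, (p.1%:R * h <= c /\ c <= p.1.+1%:R * h) /\
    forall t, p.1%:R * h <= t -> t <= p.1.+1%:R * h ->
    `|forcing_incr A x (p.1%:R * h) t p.2 0| <= `|forcing_incr A x (p.1%:R * h) c p.2 0|.
  case: p => n i /=.
  have cf : {within `[n%:R * h, n.+1%:R * h], continuous (fun t => `|forcing_incr A x (n%:R * h) t i 0|)}.
    apply: (@continuous_subspaceW _ _ _ (`[0, n.+1%:R * h]%classic)).
      by apply: subset_itvr; rewrite bnd_simp.
    rewrite (_ : (fun t => _) = (fun t => `|x t i 0 - primitive (fun s => (A *m x s) i 0) t -
      (x (n%:R * h) i 0 - primitive (fun s => (A *m x s) i 0) (n%:R * h))|)); last first.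
      by apply/funext => t; rewrite forcing_incrE.
    move=> s; apply: cvg_norm; apply: cvgB; last exact: cvg_cst.
    apply: cvgB; last exact: (continuous_primitive (@continuous_mulmx_entry R d A x cx i) (nh0 n.+1)).
    apply: continuous_subspaceT => {}s.
    apply: (@continuous_comp _ _ _ x (fun M : 'cV[R]_d => M i 0)); first exact: cx.
    exact: coord_continuous.
  have [c cin hc] := EVT_max (nhS n) cf.
  move: cin; rewrite in_itv/= => /andP[c1 c2].
  exists c; split; first by split.
  by move=> t t1 t2; apply: hc; rewrite in_itv/= t1 t2.
exists (fun n => \big[Num.max/0]_(i < d) `|forcing_incr A x (n%:R * h) (c (n, i)) i 0|); split.
- by move=> n; exact: bigmax_ge_id.
- move=> n t i t1 t2; have [_ /(_ t t1 t2) /= hi] := hc (n, i).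
  by rewrite (le_trans hi)//; exact: le_bigmax_cond.
- move=> n y y0 H; apply: bigmax_le => // i _.
  by have [[c1 c2] _] := hc (n, i); exact: H.
Qed.

(** The contribution of the past decays geometrically, so that only the eventual
    size of the forcing over blocks matters. *)
Lemma path_eventually_le : exists2 C, 0 < C & forall x y, continuous x -> 0 < y ->
  (exists n0 : nat, forall n t i, (n0 <= n)%N -> n%:R * h <= t -> t <= n.+1%:R * h ->
     `|forcing_incr A x (n%:R * h) t i 0| <= y) ->
  exists T, forall t, T <= t -> fnorm (x t) <= C * y.
Proof.
have [C [rho [C0 r0 r1 H]]] := path_bound d0 sA h0.
have r10 : 0 < 1 - rho by rewrite subr_gt0.
pose D := C * (C / (1 - rho) + 2).
have D0 : 0 < D by rewrite mulr_gt0// ltr_wpDl// divr_ge0// ltW.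
exists (Num.sqrt D); first by rewrite sqrtr_gt0.
move=> x y cx y0 [n0 hn0].
have [u [u0 bu umin]] := exists_block_sup cx.
have [W [W0 WS Wx]] := H x u cx u0 bu.
have uy n : (n0 <= n)%N -> u n <= y.
  by move=> nn; apply: umin; [exact: ltW|move=> t i; exact: hn0].
have y20 : 0 < y ^+ 2 by rewrite exprn_gt0.
have [n1 hn1] := rec_limsup r0 r1 (ltW C0) W0 WS u0 uy y20.
exists ((maxn n0 n1)%:R * h) => t Tt.
have t0 : 0 <= t by rewrite (le_trans (nh0 _) Tt).
have [n [nt tn]] := exists_block h0 t0.
have nn : (maxn n0 n1 <= n)%N.
  by rewrite -ltnS -(ltr_nat R) -(ltr_pM2r h0) (le_lt_trans Tt).
rewrite geq_max in nn; have /andP[nn0 nn1] := nn.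
have f0 : 0 <= fnorm (x t) by exact: sqrtr_ge0.
rewrite -(@ler_pXn2r _ 2) ?nnegrE ?mulr_ge0 ?sqrtr_ge0 ?(ltW y0)//.
rewrite exprMn [Num.sqrt D ^+ 2]sqr_sqrtr ?(ltW D0)// (le_trans (Wx n t nt (ltW tn)))//.
rewrite /D -mulrA ler_pM2l//.
have h1 := hn1 n nn1.
have h2 : u n ^+ 2 <= y ^+ 2 by rewrite ler_pXn2r ?nnegrE ?uy// ltW.
apply: (le_trans (lerD h1 h2)).
by rewrite le_eqVlt; apply/orP; left; apply/eqP; field; rewrite gt_eqF.
Qed.

(** The forcing over a block is the increment of the path minus the integral of
    [A x]: its size is at most [2 + h * |A|] times a bound for the path there. *)
Lemma path_infinitely_often_ge : exists2 c, 0 < c & forall x y, continuous x -> 0 < y ->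
  (forall n0 : nat, exists n : nat, exists i, (n0 <= n)%N /\
     y < `|forcing_incr A x (n%:R * h) (n.+1%:R * h) i 0|) ->
  forall T, exists2 t, T <= t & c * y <= fnorm (x t).
Proof.
pose aS := \sum_i \sum_j `|A i j|.
have aS0 : 0 <= aS by apply: sumr_ge0 => i _; apply: sumr_ge0.
have D0 : 0 < 2 + h * aS by rewrite ltr_pwDl// mulr_ge0// ltW.
exists (2 + h * aS)^-1; first by rewrite invr_gt0.
move=> x y cx y0 H T; set b := _ * y.
apply: contrapT => /forall2NP nb.
have xb t : T <= t -> fnorm (x t) <= b.
  by move=> Tt; case: (nb t) => // /negP; rewrite -ltNge => /ltW.
have [n [i [nn]]] := H (Num.truncn (Num.max 0 T / h)).+1.
apply/negP; rewrite -leNgt.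
have Tn : T <= n%:R * h.
  have M0 : 0 <= Num.max 0 T by rewrite le_max lexx.
  have := truncn_itv (divr_ge0 M0 (ltW h0)).
  rewrite ltr_pdivrMr// => /andP[_ h1].
  apply: (@le_trans _ _ (Num.max 0 T)); first by rewrite le_max lexx orbT.
  by rewrite (le_trans (ltW h1))// ler_pM2r// ler_nat.
have Axb s : T <= s -> `|(A *m x s) i 0| <= aS * b.
  move=> Ts; rewrite mxE (le_trans (ler_norm_sum _ _ _))//.
  apply: (@le_trans _ _ (\sum_j `|A i j| * b)).
    apply: ler_sum => j _; rewrite normrM; apply: ler_wpM2l => //.
    by rewrite (le_trans (entry_le_fnorm _ j 0))// xb.
  rewrite -mulr_suml ler_wpM2r//; first by rewrite (le_trans _ (xb _ Ts))// sqrtr_ge0.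
  by rewrite /aS [leRHS](bigD1 i)//= lerDl sumr_ge0// => k _; rewrite sumr_ge0.
have cA := @continuous_mulmx_entry R d A x cx i.
have pB := primitiveB cA (nh0 n) (nhS n).
rewrite forcing_incrE// opprB.
set p1 := primitive _ _ in pB *; set p0 := primitive _ _ in pB *.
have IB : `|p1 - p0| <= h * (aS * b).
  rewrite pB; have iA := continuous_integrable_oc (n%:R * h) (n.+1%:R * h) cA.
  apply: (le_trans (le_normr_Rintegral _ iA)) => //.
  apply: (@le_trans _ _ (\int[lambda]_(s in `]n%:R * h, n.+1%:R * h]) (aS * b))).
    apply: le_Rintegral => //.
    - apply: continuous_integrable_oc => s; apply: cvg_norm; exact: cA.
    - apply: continuous_integrable_oc; exact: cst_continuous.
    - move=> s /=; rewrite in_itv/= => /andP[s1 _]; apply: Axb.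
      exact: le_trans Tn (ltW s1).
  rewrite Rintegral_cst// /= lebesgue_measure_itv/= lte_fin ltr_pM2r// ltr_nat ltnSn.
  by rewrite -EFinB/= -mulrBl -natrB// subSnn mul1r mulrC.
have b1 := le_trans (entry_le_fnorm (x (n.+1%:R * h)) i 0) (xb _ (le_trans Tn (nhS n))).
have b2 := le_trans (entry_le_fnorm (x (n%:R * h)) i 0) (xb _ Tn).
have yE : y = b + b + h * (aS * b) by rewrite /b; field; rewrite gt_eqF.
rewrite [leRHS]yE.
have -> : x (n.+1%:R * h) i 0 - p1 + (p0 - x (n%:R * h) i 0) =
   x (n.+1%:R * h) i 0 - x (n%:R * h) i 0 - (p1 - p0) by ring.
rewrite (le_trans (ler_normB _ _))// lerD// (le_trans (ler_normB _ _))// lerD//.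
Qed.

End PathConsequences.

Lemma continuous_entry (R : realType) (m n : nat) (x : R -> 'M[R]_(m, n)) :
  continuous x -> forall i j, continuous (fun s => x s i j).
Proof.
move=> cx i j s.
apply: (@continuous_comp _ _ _ x (fun M : 'M[R]_(m, n) => M i j)); first exact: cx.
exact: coord_continuous.
Qed.

Lemma continuous_fnorm2 (R : realType) (m n : nat) (x : R -> 'M[R]_(m, n)) :
  continuous x -> continuous (fun s => fnorm (x s) ^+ 2).
Proof.
move=> cx; rewrite (_ : (fun s => _) =
    (fun s => \sum_(i < m) \sum_(j < n) x s i j * x s i j)); last first.
  by apply/funext => t; rewrite fnorm2; apply: eq_bigr => i _; apply: eq_bigr => j _; rewrite expr2.
move=> s; have cxij i j := @continuous_entry R m n x cx i j s.
by apply: cvg_sumr => i; apply: cvg_sumr => j; apply: cvgM; exact: cxij.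
Qed.

Section PathAverage.
Context (R : realType) (d : nat) (A : 'M[R]_d).
Hypothesis d0 : (0 < d)%N.
Hypothesis sA : stable_matrix A.
Variable h : R.
Hypothesis h0 : 0 < h.
Local Notation lambda := (@lebesgue_measure R).
Implicit Types x : R -> 'cV[R]_d.

Lemma primitive_mono (f : R -> R) (s t : R) : continuous f -> (forall u, 0 <= f u) ->
  s <= t -> primitive f s <= primitive f t.
Proof.
move=> cf f0 st; have [s0|s0] := leP 0 s.
  by rewrite -subr_ge0 primitiveB//; apply: Rintegral_ge0.
rewrite [leLHS](_ : _ = 0); first exact: Rintegral_ge0.
by rewrite /primitive set_itv_ge ?bnd_simp -?ltNge// Rintegral_set0.
Qed.

(** Summed over the blocks, the recursion of [path_bound] controls the integral of
    the squared norm by the sum of the squared block bounds. *)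
Lemma path_average_le x (u : nat -> R) : continuous x -> (forall n, 0 <= u n) -> block_bound A h x u ->
  ((N%:R)^-1 * \sum_(n < N) u n ^+ 2 @[N --> \oo] --> (0 : R)) ->
  forall e, 0 < e -> exists2 T, 0 < T & forall t, T <= t ->
    t^-1 * primitive (fun s => fnorm (x s) ^+ 2) t <= e.
Proof.
move=> cx u0 bu uavg e e0.
have [C [rho [C0 r0 r1 H]]] := path_bound d0 sA h0.
have [W [W0 WS Wx]] := H x u cx u0 bu.
have r10 : 0 < 1 - rho by rewrite subr_gt0.
pose f (s : R) := fnorm (x s) ^+ 2.
have cf : continuous f by exact: continuous_fnorm2.
have f0 s : 0 <= f s by exact: sqr_ge0.
have nh0 (n : nat) : 0 <= n%:R * h by rewrite mulr_ge0// ltW.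
have nhS (n : nat) : n%:R * h <= n.+1%:R * h by rewrite ler_pM2r// ler_nat.
have Gblock n : primitive f (n.+1%:R * h) - primitive f (n%:R * h) <= h * (C * (W n + u n ^+ 2)).
  rewrite primitiveB//; apply: (@le_trans _ _ (\int[lambda]_(s in `]n%:R * h, n.+1%:R * h]) (C * (W n + u n ^+ 2)))).
    apply: le_Rintegral => //.
    - exact: continuous_integrable_oc.
    - apply: continuous_integrable_oc; exact: cst_continuous.
    - by move=> s /=; rewrite in_itv/= => /andP[s1 s2]; apply: Wx => //; exact: ltW.
  rewrite Rintegral_cst// /= lebesgue_measure_itv/= lte_fin ltr_pM2r// ltr_nat ltnSn.
  by rewrite -EFinB/= -mulrBl -natrB// subSnn mul1r mulrC.
have GN N : primitive f (N%:R * h) <= h * C * (\sum_(n < N) W n + \sum_(n < N) u n ^+ 2).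
  elim: N => [|N IH].
    by rewrite mul0r /primitive set_itv1 Rintegral_set1 !big_ord0 addr0 mulr0.
  rewrite !big_ord_recr/=; have := Gblock N; move: IH; rewrite mulrA.
  set a := primitive f _; set b := primitive f _; set g := h * C.
  move: (\sum_(n < N) W n) (\sum_(n < N) u n ^+ 2) (W N) (u N ^+ 2) => s1 s2 w1 u1.
  by rewrite !mulrDr; lra.
pose K := 2 * C * (C / (1 - rho) + 1).
pose K0 := 2 * C * (W 0%N / (1 - rho)).
have K0_ge : 0 <= K0 by rewrite mulr_ge0 ?divr_ge0 ?(ltW r10)// mulr_ge0// ltW.
have K_gt : 0 < K by rewrite mulr_gt0 ?mulr_gt0// ltr_wpDl// divr_ge0// ltW.
pose bnd N := K0 * (N%:R)^-1 + K * ((N%:R)^-1 * \sum_(n < N) u n ^+ 2).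
have cb : bnd N @[N --> \oo] --> (0 : R).
  have ci : (N%:R : R)^-1 @[N --> \oo] --> (0 : R) by rewrite -cvg_shiftS; exact: cvg_harmonic.
  rewrite (_ : 0 = K0 * 0 + K * 0); last by rewrite !mulr0 addr0.
  by apply: cvgD; apply: cvgM => //; exact: cvg_cst.
have [N0 _ hN0] : \forall N \near \oo, bnd N < e by apply: (cvgr_lt 0 cb).
exists (N0.+1%:R * h); first by rewrite mulr_gt0// ltr0n.
move=> t Tt; have t0 : 0 < t by rewrite (lt_le_trans _ Tt)// mulr_gt0// ltr0n.
have [n [nt tn]] := exists_block h0 (ltW t0).
have Nn : (N0.+1 <= n)%N.
  by rewrite -ltnS -(ltr_nat R) -(ltr_pM2r h0) (le_lt_trans Tt).
have n1 : (1 <= n)%N by exact: leq_trans Nn.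
apply: (@le_trans _ _ (bnd n.+1)); last first.
  by apply: ltW; apply: hN0 => /=; rewrite ltnW// ltnW.
rewrite mulrC ler_pdivrMr//.
apply: (@le_trans _ _ (primitive f (n.+1%:R * h))); first by apply: primitive_mono => //; exact: ltW.
apply: (le_trans (GN n.+1)).
have sW := rec_sum n.+1 r0 r1 W0 WS.
set S := \sum_(i < n.+1) u i ^+ 2 in sW *.
have S0 : 0 <= S by apply: sumr_ge0 => i _; exact: sqr_ge0.
apply: (@le_trans _ _ (bnd n.+1 * (n.+1%:R * h / 2))); last first.
  apply: ler_wpM2l.
    by rewrite /bnd -/S; apply: addr_ge0; apply: mulr_ge0; rewrite ?(ltW K_gt) ?invr_ge0// mulr_ge0 ?invr_ge0.
  apply: le_trans nt; rewrite mulrAC ler_pM2r// ler_pdivrMr//.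
  by rewrite -natrM ler_nat muln2 -addnn -[n.+1]addn1 leq_add2l.
apply: (@le_trans _ _ (h * C * ((W 0%N + C * S) / (1 - rho) + S))).
  by rewrite ler_pM2l ?mulr_gt0// lerD2r.
rewrite le_eqVlt; apply/orP; left; apply/eqP.
rewrite /bnd -/S /K0 /K; field.
apply/andP; split; last by rewrite gt_eqF.
by rewrite nat1r gt_eqF// ltr0n.
Qed.

End PathAverage.

(** * Summability of Gaussian weights *)

Section GaussWeight.
Context (R : realType).
Implicit Types (K v : R).

Lemma gauss_weight_ge0 K v : 0 <= gauss_weight K v.
Proof. by rewrite /gauss_weight; case: ifP => // _; exact: expR_ge0. Qed.

Lemma gauss_weight_le1 K v : 0 <= K -> gauss_weight K v <= 1.
Proof.
move=> K0; rewrite /gauss_weight; case: ifP => // v0.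
by rewrite -[leRHS]expR0 ler_expR oppr_le0 divr_ge0// ltW.
Qed.

Lemma gauss_weightX K v m : (0 < m)%N -> gauss_weight K v ^+ m = gauss_weight (m%:R * K) v.
Proof.
move=> m0; rewrite /gauss_weight; case: ifP => _; last by rewrite expr0n gtn_eqF.
by rewrite -expRM_natl mulrN mulrA.
Qed.

Lemma le_gauss_weight K K' v : K <= K' -> gauss_weight K' v <= gauss_weight K v.
Proof.
move=> KK; rewrite /gauss_weight; case: ifP => // v0.
by rewrite ler_expR lerN2 ler_pM2r ?invr_gt0.
Qed.

Lemma gauss_weight_mono K v v' : 0 <= K -> v <= v' -> gauss_weight K v <= gauss_weight K v'.
Proof.
move=> K0 vv; rewrite /gauss_weight; case: (ltP 0 v) => v0.
  rewrite (lt_le_trans v0 vv) ler_expR lerN2 ler_wpM2l//.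
  by rewrite lef_pV2 ?posrE// (lt_le_trans v0).
by case: ifP => // _; exact: expR_ge0.
Qed.

(** The power [n ^ (- 1 / m)] telescopes the convergent series of general term
    [(n + 1) ^ (- 1 - 1 / m)]. *)
Lemma root_step (m n : nat) : (0 < m)%N -> (0 < n)%N ->
  expR (- (ln n.+1%:R / m%:R)) / n.+1%:R <=
  m%:R * (expR (- (ln n%:R / m%:R)) - expR (- (ln n.+1%:R / m%:R))) :> R.
Proof.
move=> m0 n0; have m0' : 0 < m%:R :> R by rewrite ltr0n.
have n0' : 0 < n%:R :> R by rewrite ltr0n.
have n1' : 0 < n.+1%:R :> R by rewrite ltr0n.
pose dl : R := ln n.+1%:R - ln n%:R.
have dl1 : n.+1%:R^-1 <= dl.
  rewrite /dl -ln_div ?posrE// -[leLHS]opprK lerNl -lnV ?posrE ?divr_gt0// invf_div.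
  have -> : n%:R / n.+1%:R = 1 + - n.+1%:R^-1 :> R.
    by rewrite -[n.+1%:R]natr1; field; rewrite natr1 gt_eqF.
  by apply: le_ln1Dx; rewrite ltrN2 invf_lt1// ltr1n.
have -> : expR (- (ln n%:R / m%:R)) = expR (- (ln n.+1%:R / m%:R)) * expR (dl / m%:R) :> R.
  by rewrite -expRD; congr expR; rewrite /dl; field; rewrite gt_eqF.
rewrite -[X in _ - X]mulr1 -mulrBr mulrCA ler_pM2l ?expR_gt0//.
apply: (@le_trans _ _ (m%:R * (dl / m%:R))); first by rewrite mulrC divfK// gt_eqF.
rewrite ler_pM2l// lerBrDl; exact: expR_ge1Dx.
Qed.

(** Where [y n <= (n + 1) ^ (- 1 / m)] the terms are dominated by a convergent
    series; elsewhere [1 / (n + 1) < y n ^+ m <= q n]. *)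
Lemma weighted_sum (m : nat) (y q : nat -> R) (K : R) : (0 < m)%N ->
  (forall n, 0 <= y n) -> (forall n, y n <= 1) -> (forall n, y n ^+ m <= q n) ->
  (forall N, \sum_(n < N) q n <= K) ->
  forall N, \sum_(n < N) y n / n.+1%:R <= K + 1 + m%:R.
Proof.
move=> m0 y0 y1 yq qK N; have m0' : 0 < m%:R :> R by rewrite ltr0n.
pose tau n : R := expR (- (ln n.+1%:R / m%:R)).
have tauX n : tau n ^+ m = n.+1%:R^-1.
  rewrite /tau -expRM_natl mulrN mulrC divfK ?gt_eqF// expRN lnK// posrE ltr0n//.
have n0 n : 0 < n.+1%:R :> R by rewrite ltr0n.
have q0 n : 0 <= q n by rewrite (le_trans _ (yq n))// exprn_ge0.
have term n : y n / n.+1%:R <= q n + tau n / n.+1%:R.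
  have [yt|yt] := leP (y n) (tau n).
    by rewrite -[leLHS]add0r lerD// ler_pM2r// invr_gt0.
  rewrite -[leLHS]addr0 lerD//; last by rewrite divr_ge0 ?expR_ge0.
  apply: (@le_trans _ _ n.+1%:R^-1); first by rewrite ler_piMl// invr_ge0.
  by rewrite -tauX (le_trans _ (yq n))// ler_pXn2r ?nnegrE ?expR_ge0// ltW.
have tsum M : \sum_(n < M.+1) tau n / n.+1%:R <= 1 + m%:R * (1 - tau M).
  elim: M => [|M IH].
    by rewrite big_ord1 /tau ln1 mul0r oppr0 expR0 subrr mulr0 addr0 divr1.
  rewrite big_ord_recr/=; have := root_step m0 (ltn0Sn M); move: IH.
  rewrite -/(tau M) -/(tau M.+1) !mulrBr.
  move: (\sum_(n < _) _) (_ / _) (m%:R * tau M) (m%:R * tau M.+1) (m%:R * 1) => a b c e g; lra.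
have tsum' : \sum_(n < N) tau n / n.+1%:R <= 1 + m%:R.
  case: N => [|N]; first by rewrite big_ord0 addr_ge0// ltW.
  rewrite (le_trans (tsum N))// lerD2l ler_piMr ?(ltW m0')// lerBlDl lerDr.
  exact: expR_ge0.
rewrite -addrA; apply: (@le_trans _ _ (\sum_(n < N) (q n + tau n / n.+1%:R))).
  exact: ler_sum.
by rewrite big_split lerD.
Qed.

End GaussWeight.

(** * The criterion as a series over blocks *)

Section BlockIntegral.
Context (R : realType).
Local Notation lambda := (@lebesgue_measure R).
Variables (h : R) (g : R -> R).
Hypotheses (h0 : 0 < h) (g0 : forall t, 0 <= g t) (mg : measurable_fun [set: R] g).

Let nh0 (n : nat) : 0 <= n%:R * h. Proof. by rewrite mulr_ge0// ltW. Qed.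
Let nhS (n : nat) : n%:R * h < n.+1%:R * h. Proof. by rewrite ltr_pM2r// ltr_nat. Qed.
Let mgE (D : set R) : measurable_fun D (EFin \o g).
Proof. by apply: measurableT_comp => //; exact: measurable_funTS. Qed.

Lemma integral_blockS (N : nat) :
  (\int[lambda]_(t in `[0%R, (N.+1%:R * h)%R[) (g t)%:E =
   \int[lambda]_(t in `[0%R, (N%:R * h)%R[) (g t)%:E +
   \int[lambda]_(t in `[(N%:R * h)%R, (N.+1%:R * h)%R[) (g t)%:E)%E.
Proof.
rewrite -ge0_integral_setU//.
- congr (integral _ _ _); apply/seteqP; split=> t /=; rewrite !in_itv/=.
    by case/andP=> t1 t2; have [tn|tn] := ltP t (N%:R * h); [left; rewrite t1|right].
  case=> /andP[t1 t2]; first by rewrite t1 (lt_trans t2).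
  by rewrite t2 (le_trans _ t1).
- exact: mgE.
- by move=> t _; rewrite lee_fin.
- apply/disj_setPS => t /=; rewrite !in_itv/= => -[/andP[_ t1] /andP[t2 _]].
  by move: (lt_le_trans t1 t2); rewrite ltxx.
Qed.

Lemma integral_block_cst (N : nat) (a : R) :
  (\int[lambda]_(t in `[(N%:R * h)%R, (N.+1%:R * h)%R[) a%:E = (h * a)%:E)%E.
Proof.
rewrite integral_cst//= lebesgue_measure_itv/= lte_fin nhS -EFinB -EFinM; congr EFin.
by rewrite -mulrBl -natrB// subSnn mul1r mulrC.
Qed.

Lemma integral_blocks_ge (a : nat -> R) (N : nat) : (forall n, 0 <= a n) ->
  (forall n t, n%:R * h <= t -> t < n.+1%:R * h -> a n <= g t) ->
  ((\sum_(n < N) h * a n)%:E <= \int[lambda]_(t in `[0%R, (N%:R * h)%R[) (g t)%:E)%E.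
Proof.
move=> a0 ag; elim: N => [|N IH].
  by rewrite big_ord0; apply: integral_ge0 => t _; rewrite lee_fin.
rewrite big_ord_recr/= integral_blockS EFinD leeD// -(integral_block_cst N).
apply: ge0_le_integral => //; try exact: mgE; try by move=> t _; rewrite lee_fin.
by move=> t /=; rewrite in_itv/= lee_fin => /andP[t1 t2]; exact: ag.
Qed.

Lemma integral_blocks_le (a : nat -> R) (N : nat) :
  (forall n t, n%:R * h <= t -> t < n.+1%:R * h -> g t <= a n) ->
  (\int[lambda]_(t in `[0%R, (N%:R * h)%R[) (g t)%:E <= (\sum_(n < N) h * a n)%:E)%E.
Proof.
move=> ag; elim: N => [|N IH].
  by rewrite big_ord0 mul0r set_itvco0 integral_set0.
rewrite big_ord_recr/= integral_blockS EFinD leeD// -(integral_block_cst N).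
apply: ge0_le_integral => //; try exact: mgE; try by move=> t _; rewrite lee_fin.
by move=> t /=; rewrite in_itv/= lee_fin => /andP[t1 t2]; exact: ag.
Qed.

Lemma integral_blocks_bounded (a : nat -> R) (K : R) :
  (forall n t, n%:R * h <= t -> t < n.+1%:R * h -> g t <= a n) ->
  (forall N, \sum_(n < N) h * a n <= K) ->
  (\int[lambda]_(t in `[0%R, +oo[) (g t)%:E <= K%:E)%E.
Proof.
move=> ag aK; rewrite (ge0_integral_ereal_sup lambda g0 mg).
apply: ge_ereal_sup => _ [i _ <-].
have [N _ iN] : exists2 N : nat, True & i.+1%:R < N%:R * h.
  by have [n [_ hn]] := exists_block h0 (ler0n R i.+1); exists n.+1.
apply: (@le_trans _ _ (\int[lambda]_(t in `[0%R, (N%:R * h)%R[) (g t)%:E)%E); last first.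
  by rewrite (le_trans (integral_blocks_le _ ag))// lee_fin.
apply: ge0_subset_integral => //; try exact: mgE; try by move=> t _; rewrite lee_fin.
by move=> t /=; rewrite !in_itv/= => /andP[-> ti]; rewrite (le_lt_trans ti).
Qed.

End BlockIntegral.

Section Volume.
Context (R : realType) (d r : nat) (sigma : R -> 'M[R]_(d, r)).
Hypothesis hsigma : {within `[0, +oo[, continuous sigma}.
Local Notation lambda := (@lebesgue_measure R).

Definition energy (t : R) : R := primitive (fun s => fnorm (sigma (Num.max s 0)) ^+ 2) t.

Let f s := fnorm (sigma (Num.max s 0)) ^+ 2.
Let cf : continuous f.
Proof. by apply: continuous_fnorm2; exact: continuous_clamp. Qed.
Let f0 s : 0 <= f s. Proof. exact: sqr_ge0. Qed.

Lemma energy_mono (s t : R) : s <= t -> energy s <= energy t.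
Proof. exact: primitive_mono. Qed.

Lemma energyE (s t : R) : 0 <= s -> s <= t ->
  \int[lambda]_(u in `[s, t]) (fnorm (sigma u) ^+ 2) = energy t - energy s.
Proof.
move=> s0 st; rewrite primitiveB// Rintegral_itv_obnd_cbnd; last exact: continuous_integrable_oc.
apply: eq_Rintegral => u; rewrite inE/= in_itv/= => /andP[su _].
by rewrite max_l// (le_trans s0).
Qed.

Let row j u := \sum_l sigma (Num.max u 0) j l ^+ 2.

Let crow j : continuous (row j).
Proof.
rewrite /row (_ : (fun u => _) = (fun u => \sum_l sigma (Num.max u 0) j l * sigma (Num.max u 0) j l)).
  move=> s; apply: cvg_sumr => l.
  have h := @continuous_entry R d r _ (continuous_clamp hsigma) j l s.
  by apply: cvgM; exact: h.
by apply/funext => s; apply: eq_bigr => l _; rewrite expr2.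
Qed.

Lemma row_integralE j (s t : R) : 0 <= s ->
  (\int[lambda]_(u in `]s, t]) (\sum_l sigma u j l ^+ 2)%:E =
   (\int[lambda]_(u in `]s, t]) row j u)%R%:E)%E.
Proof.
move=> s0; rewrite fineK; last first.
  by apply: integrable_fin_num => //; exact: continuous_integrable_oc.
apply: eq_integral => u; rewrite inE/= in_itv/= => /andP[su _].
by rewrite /row max_l// (le_trans s0)// ltW.
Qed.

Lemma energy_rows (s t : R) : 0 <= s -> s <= t ->
  energy t - energy s = \sum_j \int[lambda]_(u in `]s, t]) row j u.
Proof.
move=> s0 st; rewrite primitiveB//; apply: EFin_inj.
rewrite -sumEFin fineK; last first.
  by apply: integrable_fin_num => //; exact: continuous_integrable_oc.
transitivity (\int[lambda]_(u in `]s, t]) \sum_j (row j u)%:E)%E.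
  by apply: eq_integral => u _; rewrite sumEFin /row fnorm2.
rewrite ge0_integral_sum//.
- apply: eq_bigr => j _; rewrite fineK//.
  by apply: integrable_fin_num => //; exact: continuous_integrable_oc.
- move=> j; apply: measurableT_comp => //; apply: measurable_funTS.
  exact: continuous_measurable_fun.
- by move=> j u _; rewrite lee_fin; apply: sumr_ge0 => l _; exact: sqr_ge0.
Qed.

Lemma row_integral_le j (s t : R) : 0 <= s -> s <= t ->
  (\int[lambda]_(u in `]s, t]) (\sum_l sigma u j l ^+ 2)%:E <= (energy t - energy s)%:E)%E.
Proof.
move=> s0 st; rewrite row_integralE// lee_fin energy_rows// (bigD1 j)//= lerDl.
apply: sumr_ge0 => i _; apply: Rintegral_ge0 => // u _.
by apply: sumr_ge0 => l _; exact: sqr_ge0.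
Qed.

Lemma row_integral_ge (s t : R) : (0 < d)%N -> 0 <= s -> s <= t ->
  exists j, (((energy t - energy s) / d%:R)%:E <=
    \int[lambda]_(u in `]s, t]) (\sum_l sigma u j l ^+ 2)%:E)%E.
Proof.
move=> d0 s0 st; apply: contrapT => /forallNP H.
have H' j : \int[lambda]_(u in `]s, t]) row j u < (energy t - energy s) / d%:R.
  by have /negP := H j; rewrite -ltNge row_integralE// lte_fin.
suff : energy t - energy s < energy t - energy s by rewrite ltxx.
rewrite {1}energy_rows//.
apply: (@lt_le_trans _ _ (\sum_(j < d) (energy t - energy s) / d%:R)).
  by apply: ltr_sum => [|j _]; [apply/hasP; exists (Ordinal d0) => //; exact: mem_index_enum|exact: H'].
by rewrite sumr_const card_ord -[leLHS]mulr_natr divfK// pnatr_eq0 -lt0n.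
Qed.

Lemma measurable_entry j l : measurable_fun (`[0, +oo[ : set R) (fun u : R => sigma u j l).
Proof.
have cs : measurable_fun [set: R] (fun u => sigma (Num.max u 0) j l).
  apply: continuous_measurable_fun.
  exact: continuous_entry (continuous_clamp hsigma) j l.
have cs' : measurable_fun (`[0, +oo[ : set R) (fun u => sigma (Num.max u 0) j l).
  exact: measurable_funTS.
apply: eq_measurable_fun cs' => u; rewrite inE/= in_itv/= andbT => u0.
by rewrite max_l.
Qed.

Variable c : R.
Hypothesis c0 : 0 < c.

(** The factor [gauss_weight] absorbs the indicator function of the integrand. *)
Lemma IcE eps : Ic sigma c eps =
  (\int[lambda]_(t in `[0%R, +oo[)
     (Num.sqrt (energy (t + c) - energy t) * gauss_weight (eps ^+ 2 / 2) (energy (t + c) - energy t))%:E)%E.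
Proof.
apply: eq_integral => t; rewrite inE/= in_itv/= andbT => t0; congr EFin.
have tc : t <= t + c by rewrite lerDl ltW.
rewrite /varsigma energyE//; set q := energy _ - _.
have q0 : 0 <= q by rewrite subr_ge0 energy_mono.
rewrite [Num.sqrt q ^+ 2]sqr_sqrtr// indicE mem_setE /gauss_weight -mulrA; congr (_ * _).

case: ltP => qp; last first.
  by rewrite (le_anti (introT andP (conj qp q0))) sqrtr0 in_itv/= ltxx mulr0.
by rewrite in_itv/= andbT sqrtr_gt0 qp mulr1.
Qed.

End Volume.

Section IcSums.
Context (R : realType) (d r : nat) (sigma : R -> 'M[R]_(d, r)).
Hypothesis hsigma : {within `[0, +oo[, continuous sigma}.
Local Notation lambda := (@lebesgue_measure R).
Local Notation F := (energy sigma).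

Definition block_energy (h : R) (n : nat) : R := F (n.+1%:R * h) - F (n%:R * h).

Lemma block_energy_ge0 (h : R) n : 0 < h -> 0 <= block_energy h n.
Proof. by move=> h0; rewrite subr_ge0 energy_mono// ler_pM2r// ler_nat. Qed.

Let integrand (a q : R) : R := Num.sqrt q * gauss_weight a q.

Let integrand_mono (a : R) : 0 <= a -> {homo integrand a : p q / p <= q}.
Proof.
move=> a0 p q pq; apply: ler_pM; rewrite ?sqrtr_ge0 ?gauss_weight_ge0//.
- exact: ler_wsqrtr.
- exact: gauss_weight_mono.
Qed.

Let integrand_ge0 (a q : R) : 0 <= integrand a q.
Proof. by rewrite mulr_ge0 ?sqrtr_ge0 ?gauss_weight_ge0. Qed.

Let measurable_integrand (a c : R) : 0 <= a ->
  measurable_fun [set: R] (fun t => integrand a (F (t + c) - F t)).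
Proof.
move=> a0.
have mF : measurable_fun [set: R] F.
  by apply: nondecreasing_measurable => // s t; exact: energy_mono.
have mFc : measurable_fun [set: R] (fun t => F (t + c)).
  by apply: nondecreasing_measurable => // s t st; apply: energy_mono => //; rewrite lerD2r.
have mi : measurable_fun [set: R] (integrand a).
  by apply: nondecreasing_measurable => //; exact: integrand_mono.
by apply: (measurableT_comp mi); exact: measurable_funB.
Qed.

(** One half of the exponent is spent on the square root: with [y = a / v],
    [2 * sqrt y <= 1 + y <= expR y]. *)
Lemma gauss_weight_le_integrand (a v : R) : 0 < a ->
  gauss_weight (2 * a) v <= integrand a v / (2 * Num.sqrt a).
Proof.
move=> a0; rewrite /integrand /gauss_weight; case: ifP => [v0|]; last by rewrite mulr0 mul0r.
have sa : 0 < Num.sqrt a by rewrite sqrtr_gt0.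
have sv : 0 < Num.sqrt v by rewrite sqrtr_gt0.
rewrite (_ : - (2 * a / v) = - (a / v) + - (a / v)); last by ring.
rewrite expRD mulrAC ler_pM2r ?expR_gt0// expRN ler_pdivlMr ?mulr_gt0// mulrC.
rewrite ler_pdivrMr ?expR_gt0//.
apply: (@le_trans _ _ (Num.sqrt v * (1 + a / v))); last by rewrite ler_pM2l// expR_ge1Dx.
rewrite -[in a / v](sqr_sqrtr (ltW a0)) -[in X in _ / X](sqr_sqrtr (ltW v0)).
move: (Num.sqrt a) (Num.sqrt v) sa sv => p q p0 q0.
rewrite -subr_ge0 (_ : _ - _ = (p - q) ^+ 2 / q); last by field; rewrite gt_eqF.
by rewrite divr_ge0 ?sqr_ge0// ltW.
Qed.

(** Every window [t, t + c] that starts in a block of length [c / 2] contains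
    the next block. *)
Lemma Ic_finite_sum (c eps : R) : 0 < c -> 0 < eps -> (Ic sigma c eps < +oo)%E ->
  exists K, forall N, \sum_(n < N) gauss_weight (eps ^+ 2) (block_energy (c / 2) n) <= K.
Proof.
move=> c0 eps0; rewrite (IcE hsigma c0); set I := integral _ _ _ => Ifin.
have h0 : 0 < c / 2 by rewrite divr_gt0.
set h := c / 2 in h0 *.
have ch : c = 2 * h by rewrite /h; field.
pose a := eps ^+ 2 / 2; have a0 : 0 < a by rewrite divr_gt0// exprn_gt0.
have ea : eps ^+ 2 = 2 * a by rewrite /a; field.
pose g t := integrand a (F (t + c) - F t).
have g0 t : 0 <= g t by exact: integrand_ge0.
have mg : measurable_fun [set: R] g by exact: measurable_integrand (ltW a0).
have I0 : (0 <= I)%E by apply: integral_ge0 => t _; rewrite lee_fin g0.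
have If : I \is a fin_num by rewrite ge0_fin_numE.
have sumI N : \sum_(n < N) h * integrand a (block_energy h n.+1) <= fine I.
  rewrite -lee_fin fineK//.
  apply: (@le_trans _ _ (\int[lambda]_(t in `[0%R, (N%:R * h)%R[) (g t)%:E)%E).
    have ge n t : n%:R * h <= t -> t < n.+1%:R * h -> integrand a (block_energy h n.+1) <= g t.
      move=> nt tn; apply: integrand_mono; first exact: ltW.
      apply: lerB; apply: energy_mono => //; last exact: ltW.
      by rewrite ch -[n.+2]addn2 natrD mulrDl lerD2r.
    exact: (integral_blocks_ge h0 g0 mg N (fun n => integrand_ge0 a _) ge).
  apply: ge0_subset_integral => //.
  - by apply: measurableT_comp => //; exact: measurable_funTS.
  - by move=> t _; rewrite lee_fin; exact: g0.
  - by move=> t /=; rewrite !in_itv/= andbT => /andP[].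
pose D := h * (2 * Num.sqrt a).
have D0 : 0 < D by rewrite !mulr_gt0// sqrtr_gt0.
exists (1 + fine I / D) => -[|N]; first by rewrite big_ord0 addr_ge0// divr_ge0 ?fine_ge0// ltW.
rewrite big_ord_recl/= lerD ?gauss_weight_le1 ?sqr_ge0//.
rewrite ler_pdivlMr// (le_trans _ (sumI N))// mulr_suml; apply: ler_sum => n _.
rewrite ea (le_trans (ler_wpM2r (ltW D0) (gauss_weight_le_integrand _ a0)))//.
rewrite le_eqVlt; apply/orP; left; apply/eqP.
by rewrite /D; field; rewrite gt_eqF// sqrtr_gt0.
Qed.

(** Every window of length [c] that starts in a block of length [c] is covered by
    this block and the next one; doubling the larger of the two variances costs
    the factor 2 in the exponent. *)
Lemma sum_Ic_finite (c eps : R) : 0 < c -> 0 < eps ->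
  (exists K, forall N, \sum_(n < N) gauss_weight (eps ^+ 2 / 4) (block_energy c n) <= K) ->
  (Ic sigma c eps < +oo)%E.
Proof.
move=> c0 eps0 [K HK]; rewrite (IcE hsigma c0).
pose a := eps ^+ 2 / 2; have a0 : 0 < a by rewrite divr_gt0// exprn_gt0.
have ea : eps ^+ 2 / 4 = a / 2 by rewrite /a; field.
pose p n := gauss_weight (eps ^+ 2 / 4) (block_energy c n).
have p0 n : 0 <= p n by exact: gauss_weight_ge0.
have b0 : 0 < a / 2 by rewrite divr_gt0.
have v0 n : 0 <= block_energy c n by exact: block_energy_ge0.
(* The energies of the blocks are bounded, since their weights are summable and
   hence tend to zero. *)
have [V V0 HV] : exists2 V, 0 <= V & forall n, block_energy c n <= V.
  have pcvg : p n @[n --> \oo] --> (0 : R).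
    apply: cvg_series_cvg_0; apply: nondecreasing_is_cvgn.
      by apply/nondecreasing_seqP => n; rewrite /series/= big_nat_recr//= lerDl.
    by exists K => _ [N _ <-]; rewrite /series/= big_mkord; exact: HK.
  have [N _ HN] : \forall n \near \oo, p n < expR (-1).
    by apply: (cvgr_lt 0 pcvg); exact: expR_gt0.
  exists (a / 2 + \sum_(n < N) block_energy c n) => [|n].
    by rewrite addr_ge0 ?(ltW b0)// sumr_ge0.
  have [Nn|nN] := leqP N n; last first.
    rewrite (bigD1 (Ordinal nN))//= addrCA lerDl addr_ge0 ?(ltW b0)// sumr_ge0//.
  rewrite ler_wpDr ?sumr_ge0// leNgt; apply/negP => bv.
  have := HN n Nn; rewrite /p /gauss_weight (lt_trans b0 bv) ea ltr_expR ltrN2 ltNge.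
  by rewrite ler_pdivrMr ?(lt_trans b0)// mul1r ltW.
pose g t := integrand a (F (t + c) - F t).
have g0 t : 0 <= g t by exact: integrand_ge0.
have mg : measurable_fun [set: R] g by exact: measurable_integrand (ltW a0).
pose D := Num.sqrt (2 * V).
have D0 : 0 <= D by exact: sqrtr_ge0.
have K0 : 0 <= K by have := HK 0%N; rewrite big_ord0.
apply: (@le_lt_trans _ _ (c * (D * (2 * K)))%:E); last exact: ltry.
apply: (integral_blocks_bounded (a := fun n => D * (p n + p n.+1)) c0 g0 mg).
  move=> n t nt tn.
  pose m := Num.max (block_energy c n) (block_energy c n.+1).
  have t0 : 0 <= t by rewrite (le_trans _ nt)// mulr_ge0// ltW.
  have qm : F (t + c) - F t <= 2 * m.
    apply: (@le_trans _ _ (block_energy c n + block_energy c n.+1)).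
      rewrite /block_energy [leRHS]addrC addrA subrK; apply: lerB; apply: energy_mono => //.
      by rewrite -[n.+2%:R]natr1 mulrDl mul1r lerD2r ltW.
    by rewrite mulr_natl mulr2n lerD// /m le_max lexx ?orbT.
  apply: (le_trans (integrand_mono (ltW a0) qm)).
  apply: ler_pM; rewrite ?sqrtr_ge0 ?gauss_weight_ge0//.
    by apply: ler_wsqrtr; rewrite ler_pM2l// /m ge_max !HV.
  rewrite (_ : gauss_weight a (2 * m) = gauss_weight (eps ^+ 2 / 4) m); last first.
    rewrite /gauss_weight pmulr_rgt0// ea; case: ifP => // m0; congr (expR (- _)); field.
    by rewrite gt_eqF.
  have [pn pn1] := (p0 n, p0 n.+1).
  rewrite /m; case: (leP (block_energy c n)) => _.
  - exact: (ler_wpDl pn (lexx (p n.+1))).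
  - exact: (ler_wpDr pn1 (lexx (p n))).
move=> N; rewrite -mulr_sumr ler_pM2l// -mulr_sumr ler_wpM2l//.
rewrite big_split/= mulr_natl mulr2n lerD//; first exact: HK.
have := HK N.+1; rewrite big_ord_recl/=; apply: le_trans.
by rewrite lerDr gauss_weight_ge0.
Qed.

End IcSums.

(** * From dyadic times to continuous time *)

Definition dyadic (R : realType) (s D : R) (K i : nat) : R := s + i%:R * (D / 2 ^+ K).

Section Dyadic.
Context (R : realType) (s D : R).
Hypotheses (s0 : 0 <= s) (D0 : 0 < D).

Let st0 K : 0 < D / 2 ^+ K. Proof. by rewrite divr_gt0// exprn_gt0. Qed.

Lemma dyadic0 K : dyadic s D K 0 = s.
Proof. by rewrite /dyadic mul0r addr0. Qed.

Lemma dyadic_last K : dyadic s D K (2 ^ K) = s + D.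
Proof. by rewrite /dyadic natrX; congr (_ + _); field; rewrite expf_neq0. Qed.

Lemma dyadicS K i : dyadic s D K.+1 (2 * i) = dyadic s D K i.
Proof. by rewrite /dyadic natrM exprS; congr (_ + _); field; rewrite expf_neq0. Qed.

Lemma dyadic_ge0 K i : 0 <= dyadic s D K i.
Proof. by rewrite addr_ge0// mulr_ge0// ltW. Qed.

Lemma dyadic_le K i : dyadic s D K i <= dyadic s D K i.+1.
Proof. by rewrite lerD2l ler_pM2r// ler_nat. Qed.

Lemma dyadic_near t e : s <= t -> t <= s + D -> 0 < e ->
  exists K i, (i <= 2 ^ K)%N /\ `|t - dyadic s D K i| < e.
Proof.
move=> st tD e0.
have [k [_ hk]] := exists_block e0 (ltW D0).
have ts : 0 <= t - s by rewrite subr_ge0.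
exists k; have [i [it ti]] := exists_block (st0 k) ts.
have De : D / 2 ^+ k < e.
  rewrite ltr_pdivrMr ?exprn_gt0// (lt_le_trans hk)// mulrC ler_pM2l//.
  by rewrite -natrX ler_nat; exact: ltn_expl.
exists i; split.
  rewrite -(ler_nat R) -(ler_pM2r (st0 k)) (le_trans it)//.
  by rewrite natrX mulrC divfK ?expf_neq0// lerBlDl.
rewrite ger0_norm; last by rewrite subr_ge0 -lerBrDl.
rewrite /dyadic opprD addrA ltrBlDl (lt_trans ti)// -[i.+1%:R]natr1 mulrDl mul1r.
by rewrite ltrD2l.
Qed.

(** The forcing is continuous in [t] and the dyadic points of the block are dense. *)
Lemma forcing_incr_dyadic (d : nat) (A : 'M[R]_d) (x : R -> 'cV[R]_d) (y : R) (i : 'I_d) :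
  continuous x ->
  (forall K k, (k <= 2 ^ K)%N -> `|forcing_incr A x s (dyadic s D K k) i 0| <= y) ->
  forall t, s <= t -> t <= s + D -> `|forcing_incr A x s t i 0| <= y.
Proof.
move=> cx H t st tD; have := H 0%N 0%N (leq0n _); rewrite dyadic0.
have [<-//|nst _] := eqVneq s t.
have {nst}st' : s < t by rewrite lt_neqAle nst.
have t0 : 0 < t by exact: le_lt_trans st'.
pose f u := `|forcing_incr A x s u i 0|.
have cf : {for t, continuous f}.
  rewrite /f (_ : (fun u => _) = (fun u => `|x u i 0 - primitive (fun s => (A *m x s) i 0) u -
      (x s i 0 - primitive (fun s => (A *m x s) i 0) s)|)); last first.
    by apply/funext => u; rewrite forcing_incrE.
  apply: cvg_norm; apply: cvgB; last exact: cvg_cst.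
  apply: cvgB; first exact: (@continuous_entry R d 1 x cx i 0 t).
  apply: differentiable_continuous; apply/derivable1_diffP.
  by apply: ex_derive; exact: (is_derive_primitive (@continuous_mulmx_entry R d A x cx i) t0).
rewrite leNgt; apply/negP => yf.
have : \forall u \near t, y < f u by exact: (cvgr_gt _ cf).
move=> /nbhs_ballP[e /= e0 he].
have [K [k [kK tk]]] := dyadic_near st tD e0.
have := he _ tk; rewrite ltNge /f; apply/negP; rewrite negbK; exact: H.
Qed.

End Dyadic.

Section BlockEvent.
Context (R : realType) (disp : measure_display) (T : measurableType disp)
  (P : probability T R) (d r : nat) (Fi : R -> set (set T))
  (B : R -> T -> 'cV[R]_r).
Hypothesis hFi : filtration Fi.
Hypothesis hB : brownian_motion P Fi B.
Variable sigma : R -> 'M[R]_(d, r).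
Hypothesis hsigma : {within `[0, +oo[, continuous sigma}.
Variable Y : R -> T -> 'cV[R]_d.
Hypothesis hY : forall t, 0 <= t -> is_stoch_integral P B sigma t (Y t).
Local Notation lambda := (@lebesgue_measure R).

(** Dyadic levels make this a countable union of finite unions, which increases
    with the level. *)
Definition large_incr (s D x : R) (j : 'I_d) : set T :=
  \bigcup_K [set w | exists2 k, (k <= 2 ^ K)%N &
     (x < `|Y (dyadic s D K k) w j 0 - Y s w j 0|)%R].

Variables (s D : R).
Hypotheses (s0 : 0 <= s) (D0 : 0 < D).

Let mY t j : 0 <= t -> measurable_fun [set: T] (fun w => Y t w j 0).
Proof. by move=> /hY [+ _]; exact. Qed.

Let mlevel x j K : measurable [set w | exists2 k, (k <= 2 ^ K)%N &
     (x < `|Y (dyadic s D K k) w j 0 - Y s w j 0|)%R].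
Proof.
rewrite (_ : mkset _ = \bigcup_(k in [set k | (k <= 2 ^ K)%N])
    [set w | (x < `|Y (dyadic s D K k) w j 0 - Y s w j 0|)%R]); last first.
  by apply/seteqP; split=> w /= [k kK hk]; exists k.
apply: bigcup_measurable => k _; apply: measurable_gt.
apply: measurableT_comp => //; apply: measurable_funB; apply: mY => //.
exact: dyadic_ge0.
Qed.

Lemma measurable_large_incr x j : measurable (large_incr s D x j).
Proof. by apply: bigcup_measurable => K _; exact: mlevel. Qed.

(** The maximal inequality holds at every dyadic level with the same bound; the
    exponent [th = x / (4 * v)] optimizes it, and [th] tends to infinity if [v = 0]. *)
Lemma large_incr_prob (x v : R) j : 0 < x -> 0 <= v -> 
  (\int[lambda]_(u in `]s, (s + D)%R]) (\sum_l sigma u j l ^+ 2)%:E <= v%:E)%E ->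
  (P (large_incr s D x j) <= (2 * gauss_weight (x ^+ 2 / 16) v)%:E)%E.
Proof.
move=> x0 v0 hv.
have bnd th : 0 < th ->
    (P (large_incr s D x j) <= (2 * expR (- (th * x / 2) + th ^+ 2 * v))%:E)%E.
  move=> th0; set b := (2 * _)%:E.
  have mono : {homo (fun K => [set w | exists2 k, (k <= 2 ^ K)%N &
     (x < `|Y (dyadic s D K k) w j 0 - Y s w j 0|)%R]) : n m / (n <= m)%N >-> (n <= m)%O}.
    apply/nondecreasing_seqP => K; apply/subsetPset => w [k kK hk].
    by exists (2 * k)%N; [rewrite expnS leq_pmul2l|rewrite dyadicS].
  have cv := nondecreasing_cvg_mu (mlevel x j) (measurable_large_incr x j) mono (mu := P).
  apply: (cvge_le _ cv); apply: nearW => K /=.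
  have := @stoch_integral_max R disp T P d r Fi B hFi hB sigma (measurable_entry hsigma)
    (dyadic s D K) (fun n => Y (dyadic s D K n)) (dyadic_ge0 s0 D0 K) (dyadic_le s D0 K)
    (fun n => hY (dyadic_ge0 s0 D0 K n)) (2 ^ K)%N j th x v th0 x0.
  by rewrite dyadic_last dyadic0; apply.
rewrite /gauss_weight; case: ltP => [vp|vn].
  have th0 : 0 < x / (4 * v) by rewrite divr_gt0// mulr_gt0.
  apply: le_trans (bnd _ th0) _; rewrite lee_fin ler_pM2l// ler_expR.
  by rewrite le_eqVlt; apply/orP; left; apply/eqP; field; rewrite gt_eqF.
have v00 : v = 0 by apply/eqP; rewrite eq_le vn.
rewrite mulr0; apply/lee_addgt0Pr => e e0; rewrite add0e.
(* This exponent makes the bound at most [e]. *)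
have th0 : 0 < 4 / (e * x) by rewrite divr_gt0// mulr_gt0.
apply: le_trans (bnd _ th0) _; rewrite v00 mulr0 addr0 lee_fin.
rewrite (_ : 4 / (e * x) * x / 2 = 2 / e); last by field; rewrite !gt_eqF.
rewrite expRN ler_pdivrMr ?expR_gt0// (@le_trans _ _ (e * (1 + 2 / e)))//.
  by rewrite mulrDr mulr1 mulrCA divff ?gt_eqF// mulr1 lerDr ltW.
by rewrite ler_pM2l// expR_ge1Dx.
Qed.

End BlockEvent.

(** * Almost sure behaviour of the forcing over blocks *)

Lemma nneseries_le_bound (R : realType) (u : nat -> \bar R) (a : nat -> R) (K : R) :
  (forall n, (0 <= u n)%E) -> (forall n, (u n <= (a n)%:E)%E) ->
  (forall N, \sum_(n < N) a n <= K) -> (\sum_(0 <= n <oo) u n <= K%:E)%E.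
Proof.
move=> u0 ua aK; apply: lime_le; first by apply: is_cvg_nneseries => n _ _; exact: u0.
apply: nearW => N; apply: (@le_trans _ _ (\sum_(0 <= n < N) (a n)%:E)%E).
  by apply: lee_sum => n _; exact: ua.
by rewrite sumEFin lee_fin big_mkord; exact: aK.
Qed.

(** Kronecker's lemma. The terms before the index where the tail of the series
    becomes small are bounded in number; after it, [1 / N <= 1 / (n + 1)]. *)
Lemma kronecker_bounded (R : realType) (a : nat -> R) (C : R) :
  (forall n, 0 <= a n) -> (forall n, a n <= 1) ->
  (forall N, \sum_(n < N) a n / n.+1%:R <= C) ->
  forall e, 0 < e -> exists N0, forall N, (N0 <= N)%N -> \sum_(n < N) a n <= e * N%:R.
Proof.
move=> a0 a1 aC e e0.
pose S N := \sum_(n < N) a n / n.+1%:R.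
have t0 n : 0 <= a n / n.+1%:R by rewrite divr_ge0.
have Shs : has_sup (range S).
  by split; [exists (S 0%N), 0%N|exists C => _ [N _ <-]; exact: aC].
have e2 : 0 < e / 2 by rewrite divr_gt0.
have [_ [M _ <-] hM] := sup_adherent e2 Shs.
have [N1 [_ hN1]] := exists_block e2 (ler0n R M).
exists (maxn M N1.+1) => N; rewrite geq_max => /andP[MN N1N].
have N0 : (0 < N)%N by exact: leq_ltn_trans N1N.
have NR : 0 < N%:R :> R by rewrite ltr0n.
have tail : \sum_(M <= n < N) a n / n.+1%:R <= e / 2.
  have : S N <= sup (range S) by apply: ub_le_sup; [case: Shs|exists N].
  have -> : S N = S M + \sum_(M <= n < N) a n / n.+1%:R.
    by rewrite /S -!(big_mkord xpredT (fun n => a n / n.+1%:R)) -big_cat_nat.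
  by move: hM; move: (sup _) (S M) (\sum_(M <= _ < N) _) => x y z; lra.
rewrite -(big_mkord xpredT a) (big_cat_nat (leq0n M) MN)/=.
apply: (@le_trans _ _ (e / 2 * N%:R + e / 2 * N%:R)); last by rewrite -mulrDl -splitr.
apply: lerD.
  apply: (@le_trans _ _ M%:R).
    apply: (@le_trans _ _ (\sum_(0 <= n < M) 1)); first by apply: ler_sum => n _.
    by rewrite sumr_const_nat subn0.
  by rewrite (le_trans (ltW hN1))// mulrC ler_pM2l// ler_nat.
apply: (@le_trans _ _ ((\sum_(M <= n < N) a n / n.+1%:R) * N%:R)); last by rewrite ler_pM2r.
rewrite mulr_suml; apply: ler_sum_nat => n /andP[_ nN].
by rewrite -mulrA ler_peMr// mulrC ler_pdivlMr// mul1r ler_nat.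
Qed.

Lemma tail_lowerE (R : realType) (x V : R) : tail_lower x V = expR (- 16) / 4 * gauss_weight (16 * x ^+ 2) V.
Proof.
rewrite /tail_lower /gauss_weight; case: ifP => [V0|]; last by rewrite mulr0.
by rewrite [RHS]mulrAC -expRD; congr (expR _ / _); field; rewrite gt_eqF.
Qed.

Lemma gauss_weight_scale (R : realType) (K v k : R) : 0 < k -> gauss_weight K (v / k) = gauss_weight (K * k) v.
Proof.
move=> k0; rewrite /gauss_weight pmulr_lgt0 ?invr_gt0//; case: ifP => // v0.
by congr (expR (- _)); field; rewrite !gt_eqF.
Qed.

Lemma prod_le_expR (R : realType) (g : nat -> R) N : (forall n, 0 <= g n <= 1) ->
  \prod_(n < N) (1 - g n) <= expR (- \sum_(n < N) g n).
Proof.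
move=> g01; rewrite -sumrN expR_sum; apply: ler_prod => n _.
have /andP[g0 g1] := g01 n.
by rewrite subr_ge0 g1/=; exact: expR_ge1Dx.
Qed.

Section Solution.
Context (R : realType) (disp : measure_display) (T : measurableType disp)
  (P : probability T R) (d r : nat) (Fi : R -> set (set T))
  (B : R -> T -> 'cV[R]_r).
Hypothesis hFi : filtration Fi.
Hypothesis hB : brownian_motion P Fi B.
Variable sigma : R -> 'M[R]_(d, r).
Hypothesis hsigma : {within `[0, +oo[, continuous sigma}.
Hypothesis d0 : (0 < d)%N.
Variables (A : 'M[R]_d) (xi : 'cV[R]_d) (X : R -> T -> 'cV[R]_d).
Hypothesis hX : affine_sde_solution P Fi B A sigma xi X.
Variable h : R.
Hypothesis h0 : 0 < h.
Local Notation lambda := (@lebesgue_measure R).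
Local Notation v := (block_energy sigma h).

Let nh0 (n : nat) : 0 <= n%:R * h. Proof. by rewrite mulr_ge0// ltW. Qed.
Let nhS (n : nat) : n.+1%:R * h = n%:R * h + h.
Proof. by rewrite -natr1 mulrDl mul1r. Qed.

(** Paths are only constrained at nonnegative times; extending them by their initial
    value makes continuity a property on the whole line. *)
Definition forward_path w t := X (Num.max t 0) w.

Lemma exists_version : exists Y : R -> T -> 'cV[R]_d,
  (forall t, 0 <= t -> is_stoch_integral P B sigma t (Y t)) /\
  (forall t, 0 <= t -> {ae P, forall w, X t w = xi + drift A (fun s => X s w) t + Y t w}).
Proof.
have [_ _ H] := hX.
have /choice[Y hY] t : exists Y : T -> 'cV[R]_d, 0 <= t ->
    is_stoch_integral P B sigma t Y /\
    {ae P, forall w, X t w = xi + drift A (fun s => X s w) t + Y w}.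
  have [t0|t0] := leP 0 t; last by exists (fun=> 0).
  by have [Y Y1 Y2] := H t t0; exists Y.
by exists Y; split=> t t0; have [] := hY t t0.
Qed.

Lemma drift_path w t : drift A (forward_path w) t = drift A (fun s => X s w) t.
Proof.
apply/matrixP => i j; rewrite !mxE; apply: eq_Rintegral => s.
by rewrite inE/= in_itv/= => /andP[s0 _]; rewrite /forward_path max_l.
Qed.

Section Version.
Variable Y : R -> T -> 'cV[R]_d.
Hypothesis hY : forall t, 0 <= t -> is_stoch_integral P B sigma t (Y t).
Hypothesis hXY : forall t, 0 <= t ->
  {ae P, forall w, X t w = xi + drift A (fun s => X s w) t + Y t w}.

Let good w := continuous (forward_path w) /\
  forall n K k, forcing_incr A (forward_path w) (n%:R * h) (dyadic (n%:R * h) h K k) =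
    Y (dyadic (n%:R * h) h K k) w - Y (n%:R * h) w.

(** Only the countably many dyadic times are needed to control the forcing, so that
    the exceptional sets of the versions can be gathered. *)
Lemma ae_good : {ae P, forall w, good w}.
Proof.
have [_ hc _] := hX.
have e1 : {ae P, forall w, forall n K k, X (dyadic (n%:R * h) h K k) w =
    xi + drift A (fun s => X s w) (dyadic (n%:R * h) h K k) + Y (dyadic (n%:R * h) h K k) w}.
  apply: ae_foralln => n; apply: ae_foralln => K; apply: ae_foralln => k.
  by apply: hXY; exact: dyadic_ge0.
apply: filterS2 hc e1 => w cw ew; split; first exact: (continuous_clamp cw).
move=> n K k; have e2 := ew n K k; have e3 := ew n 0%N 0%N.
rewrite dyadic0 in e3.
rewrite /forcing_incr !drift_path /forward_path !max_l//; last exact: dyadic_ge0.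
by rewrite e2 e3; apply/matrixP => i j; rewrite !mxE; ring.
Qed.

Let dev (y : R) n : set T := \big[setU/set0]_(j < d) large_incr Y (n%:R * h) h y j.

Lemma measurable_dev y n : measurable (dev y n).
Proof.
by apply: bigsetU_measurable => j _; exact: (measurable_large_incr hY (nh0 n) h0).
Qed.

Lemma dev_prob y n : 0 < y -> (P (dev y n) <= (d%:R * 2 * gauss_weight (y ^+ 2 / 16) (v n))%:E)%E.
Proof.
move=> y0; apply: le_trans (measure_bigsetU_le _ _ _) _.
  by move=> j; exact: (measurable_large_incr hY (nh0 n) h0).
apply: (@le_trans _ _ (\sum_(j < d) (2 * gauss_weight (y ^+ 2 / 16) (v n))%:E)%E).
  apply: lee_sum => j _.
  apply: (large_incr_prob hFi hB hsigma hY (nh0 n) h0 y0 (block_energy_ge0 hsigma n h0)).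
  rewrite /block_energy nhS; apply: (row_integral_le hsigma) => //.
  by rewrite lerDl ltW.
by rewrite sumEFin lee_fin sumr_const card_ord -[leLHS]mulr_natl mulrA.
Qed.

Lemma dev_path w y n : good w -> 0 < y -> ~ dev y n w ->
  forall t i, n%:R * h <= t -> t <= n.+1%:R * h -> `|forcing_incr A (forward_path w) (n%:R * h) t i 0| <= y.
Proof.
move=> [cw gw] y0 nd t i t1 t2.
apply: (@forcing_incr_dyadic R (n%:R * h) h (nh0 n) h0) => //; last by rewrite -nhS.
move=> K k kK; rewrite gw leNgt; apply/negP => yk; apply: nd.
rewrite /dev (bigD1 i)//=; left; exists K => //=; exists k => //.
by move: yk; rewrite !mxE.
Qed.

(** First Borel-Cantelli lemma. *)
Lemma ae_blocks_eventually_le y : 0 < y ->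
  (exists K, forall N, \sum_(n < N) gauss_weight (y ^+ 2 / 16) (v n) <= K) ->
  {ae P, forall w, continuous (forward_path w) /\ exists n0 : nat, forall n t i, (n0 <= n)%N ->
    n%:R * h <= t -> t <= n.+1%:R * h -> `|forcing_incr A (forward_path w) (n%:R * h) t i 0| <= y}.
Proof.
move=> y0 [K HK].
have ls : P (lim_sup_set (dev y)) = 0.
  apply: lim_sup_set_cvg0; first exact: measurable_dev.
  apply: (@le_lt_trans _ _ (d%:R * 2 * K)%:E); last exact: ltry.
  apply: (nneseries_le_bound _ (fun n => dev_prob n y0)) => // N.
  by rewrite -mulr_sumr ler_wpM2l.
have e1 : {ae P, forall w, ~ lim_sup_set (dev y) w}.
  exists (lim_sup_set (dev y)); split => //.
    apply: bigcap_measurable => // k _; apply: bigcup_measurable => n _.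
    exact: measurable_dev.
  by move=> w /= /contrapT.
apply: filterS2 ae_good e1 => w gw nl; split; first by case: gw.
have [n0 hn0] : exists n0, forall n, (n0 <= n)%N -> ~ dev y n w.
  apply: contrapT => /forallNP H; apply: nl => m _.
  apply: contrapT => H2; apply: (H m) => n mn nd; apply: H2.
  by exists n.
by exists n0 => n t i nn; apply: dev_path => //; exact: hn0.
Qed.

(** Second Borel-Cantelli lemma, with the product bound [stoch_integral_all_small] in
    place of independence: in each block some row of [sigma] carries at least
    a fraction [1 / d] of the energy, and the product is at most the
    exponential of minus a divergent sum. *)
Lemma ae_blocks_infinitely_often_gt y : 0 < y ->
  (forall M, exists N, M < \sum_(n < N) gauss_weight (256 * d%:R * y ^+ 2) (v n)) ->
  {ae P, forall w, continuous (forward_path w) /\ forall n0 : nat, exists n : nat, exists i,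
    (n0 <= n)%N /\ y < `|forcing_incr A (forward_path w) (n%:R * h) (n.+1%:R * h) i 0|}.
Proof.
move=> y0 hdiv; have dR : 0 < d%:R :> R by rewrite ltr0n.
have /choice[js hjs] n : exists j, ((v n / d%:R)%:E <=
    \int[lambda]_(u in `](n%:R * h)%R, (n.+1%:R * h)%R]) (\sum_l sigma u j l ^+ 2)%:E)%E.
  by apply: (row_integral_ge hsigma) => //; rewrite nhS lerDl ltW.
(* No large increment in the blocks [m, ..., m + N - 1]. *)
pose E m N := [set w | forall n, (n < N)%N ->
  `|Y ((m + n.+1)%:R * h) w (js (m + n)%N) 0 - Y ((m + n)%:R * h) w (js (m + n)%N) 0| <= y].
have mE m N : measurable (E m N).
  rewrite (_ : E m N = \bigcap_(n in [set n | (n < N)%N])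
      ~` [set w | y < `|Y ((m + n.+1)%:R * h) w (js (m + n)%N) 0 - Y ((m + n)%:R * h) w (js (m + n)%N) 0|]).
    apply: bigcap_measurableType => n _; apply: measurableC; apply: measurable_gt.
    apply: measurableT_comp => //.
    by apply: measurable_funB; [have [+ _] := hY (nh0 (m + n.+1))|have [+ _] := hY (nh0 (m + n))]; exact.
  apply/seteqP; split=> w /= Ew n nN; first by apply/negP; rewrite -leNgt; exact: Ew.
  by rewrite leNgt; apply/negP; exact: Ew.
pose kap : R := expR (- 16) / 4.
have kap0 : 0 < kap by rewrite divr_gt0// expR_gt0.
pose S m N := \sum_(n < N) gauss_weight (256 * d%:R * y ^+ 2) (v (m + n)%N).
have PE m N : (P (E m N) <= (expR (- (kap * S m N)))%:E)%E.
  have hv n : (n < N)%N -> ((v (m + n)%N / d%:R)%:E <=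
      \int[lambda]_(u in `]((m + n)%:R * h)%R, ((m + n.+1)%:R * h)%R])
        (\sum_l sigma u (js (m + n)%N) l ^+ 2)%:E)%E.
    by rewrite addnS => _; exact: hjs.
  have tS n : (m + n)%:R * h <= (m + n.+1)%:R * h by rewrite addnS nhS lerDl ltW.
  have := @stoch_integral_all_small R disp T P d r Fi B hFi hB sigma (measurable_entry hsigma)
    (fun n => (m + n)%:R * h) (fun n => Y ((m + n)%:R * h)) (fun n => nh0 (m + n)) tS
    (fun n => hY (nh0 (m + n))) N (fun n => js (m + n)%N) (fun n => v (m + n)%N / d%:R) y y0 hv.
  move=> /le_trans; apply; rewrite lee_fin.
  have g01 n := tail_lower_itv (2 * y) (v (m + n)%N / d%:R / 4).
  apply: le_trans (prod_le_expR N g01) _.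
  rewrite ler_expR lerN2 /S mulr_sumr; apply: ler_sum => n _.
  rewrite tail_lowerE -/kap !gauss_weight_scale// le_eqVlt; apply/orP; left; apply/eqP.
  by congr (kap * gauss_weight _ _); ring.
have Kd0 : 0 <= 256 * d%:R * y ^+ 2.
  exact: (mulr_ge0 (mulr_ge0 (ler0n R 256) (ler0n R d)) (sqr_ge0 y)).
have Sdiv m M : exists N, M < S m N.
  have [N hN] := hdiv (M + m%:R); exists (N - m)%N.
  have [mN|Nm] := leqP m N; last first.
    have : \sum_(n < N) gauss_weight (256 * d%:R * y ^+ 2) (v n) <= m%:R.
      apply: (@le_trans _ _ (\sum_(n < N) 1)).
        by apply: ler_sum => n _; exact: gauss_weight_le1.
      by rewrite sumr_const card_ord ler_nat ltnW.
    move: (\sum_(n < N) _) hN => s1 hN s1m.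
    by rewrite (lt_le_trans _ (sumr_ge0 _ (fun n _ => gauss_weight_ge0 _ _)))//; lra.
  move: hN; rewrite -(big_mkord xpredT (fun n => gauss_weight _ (v n))) (big_cat_nat (leq0n m) mN)/=.
  have h1 : \sum_(0 <= n < m) gauss_weight (256 * d%:R * y ^+ 2) (v n) <= m%:R.
    apply: (@le_trans _ _ (\sum_(0 <= n < m) 1)).
      by apply: ler_sum => n _; exact: gauss_weight_le1.
    by rewrite sumr_const_nat subn0.
  have -> : \sum_(m <= n < N) gauss_weight (256 * d%:R * y ^+ 2) (v n) = S m (N - m)%N.
    rewrite -{1}[m]add0n big_addn big_mkord; apply: eq_bigr => n _.
    by rewrite addnC.
  move: h1; move: (\sum_(0 <= _ < m) _) (S _ _) => s1 s2; lra.
have e1 : {ae P, forall w, forall m, ~ forall N, E m N w}.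
  apply: ae_foralln => m; exists (\bigcap_N E m N); split.
  - exact: bigcap_measurableType.
  - apply/eqP; rewrite eq_le measure_ge0 andbT; apply/lee_addgt0Pr => e e0; rewrite add0e.
    have [N hN] := Sdiv m ((e * kap)^-1).
    apply: (@le_trans _ _ (P (E m N))).
      by apply: le_measure; rewrite ?inE//; [exact: bigcap_measurableType|move=> w /(_ N I)].
    apply: le_trans (PE m N) _; rewrite lee_fin expRN invf_ple ?posrE ?expR_gt0//.
    apply: (@le_trans _ _ (1 + kap * S m N)); last exact: expR_ge1Dx.
    rewrite -lerBlDl (@le_trans _ _ e^-1) ?lerBlDl ?lerDr//.
    by move/ltW: hN; rewrite invfM -ler_pdivlMr ?invr_gt0// invrK mulrC.
  - by move=> w /= /contrapT H N _; exact: H.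
apply: filterS2 ae_good e1 => w [cw gw] nE; split=> // m.
have [N /existsNP[n]] := (@existsNP nat (fun N => E m N w)).2 (nE m).
move=> /not_implyP[nN /negP]; rewrite -ltNge => yl.
exists (m + n)%N, (js (m + n)%N); split; first exact: leq_addr.
have := gw (m + n)%N 0%N (2 ^ 0)%N.
by rewrite dyadic_last -nhS => ->; move: yl; rewrite addnS !mxE.
Qed.

(** The weights are summable at the scale [K0], whereas [y] may be much smaller.
    But some power of the weight at scale [y] is smaller than the weight at scale
    [K0], and the factors [1 / (n + 1)] supply the rest of the summability. *)
Lemma ae_dev_sum y K0 : 0 < y -> 0 < K0 ->
  (exists K, forall N, \sum_(n < N) gauss_weight K0 (v n) <= K) ->
  {ae P, forall w, exists C, forall N, \sum_(n < N) (\1_(dev y n) w : R) / n.+1%:R <= C}.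
Proof.
move=> y0 K00 [K HK].
have y16 : 0 < y ^+ 2 / 16 by rewrite divr_gt0// exprn_gt0.
have [m [_ hm]] := exists_block y16 (ltW K00).
pose q n := gauss_weight (y ^+ 2 / 16) (v n).
have hq : forall N, \sum_(n < N) q n / n.+1%:R <= K + 1 + m.+1%:R.
  apply: (weighted_sum (q := fun n => gauss_weight K0 (v n))) => // n.
  - exact: gauss_weight_ge0.
  - by apply: gauss_weight_le1; exact: ltW.
  - by rewrite gauss_weightX// le_gauss_weight// ltW.
pose f n w : \bar R := ((\1_(dev y n) w : R) / n.+1%:R)%:E.
have f0 n w : (0 <= f n w)%E by rewrite lee_fin divr_ge0.
have mf n : measurable_fun [set: T] (f n).
  apply: measurableT_comp => //; apply: measurable_funM => //.
  exact/measurable_indicP/measurable_dev.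
pose D : R := d%:R * 2 * (K + 1 + m.+1%:R).
have If : (\int[P]_w (\sum_(0 <= n <oo) f n w) <= D%:E)%E.
  rewrite integral_nneseries//.
  apply: (@nneseries_le_bound _ _ (fun n => d%:R * 2 * (q n / n.+1%:R))).
  - by move=> n; apply: integral_ge0.
  - move=> n; have -> : (\int[P]_w f n w = (n.+1%:R^-1)%:E * P (dev y n))%E.
      rewrite -[dev y n]setIT -integral_indic//; last exact: measurable_dev.
      rewrite -ge0_integralZl_EFin//.
      + by apply: eq_integral => w _; rewrite /f mulrC EFinM.
      + by apply: measurableT_comp => //; exact/measurable_indicP/measurable_dev.
    apply: (@le_trans _ _ ((n.+1%:R^-1)%:E * (d%:R * 2 * q n)%:E)%E).
      by rewrite lee_pmul2l// ?lte_fin ?invr_gt0//; exact: dev_prob.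
    by rewrite -EFinM lee_fin mulrC mulrA.
  - by move=> N; rewrite -mulr_sumr ler_wpM2l.
have iS : P.-integrable [set: T] (fun w => \sum_(0 <= n <oo) f n w)%E.
  apply/integrableP; split; first exact: ge0_emeasurable_sum.
  apply: (@le_lt_trans _ _ D%:E); last exact: ltry.
  apply: le_trans If; rewrite le_eqVlt; apply/orP; left; apply/eqP.
  by apply: eq_integral => w _; rewrite gee0_abs//; exact: nneseries_ge0.
have := integrable_ae measurableT iS; apply: filterS => w /(_ I) fin.
exists (fine (\sum_(0 <= n <oo) f n w)%E) => N.
rewrite -lee_fin fineK// -sumEFin -(big_mkord xpredT (fun n => f n w)).
exact: nneseries_lim_ge.
Qed.

(** The block suprema are eventually below [4 * Num.sqrt K0], and for each [y] they
    exceed [y] only on a random set of blocks of density zero. *)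
Lemma ae_blocks_average K0 : 0 < K0 ->
  (exists K, forall N, \sum_(n < N) gauss_weight K0 (v n) <= K) ->
  {ae P, forall w, continuous (forward_path w) /\ exists u : nat -> R,
    [/\ (forall n, 0 <= u n), block_bound A h (forward_path w) u &
      (N%:R)^-1 * \sum_(n < N) u n ^+ 2 @[N --> \oo] --> (0 : R)]}.
Proof.
move=> K00 HK; pose Y0 := 4 * Num.sqrt K0.
have Y00 : 0 < Y0 by rewrite mulr_gt0// sqrtr_gt0.
have Y0E : Y0 ^+ 2 / 16 = K0 by rewrite /Y0 exprMn [Num.sqrt K0 ^+ 2]sqr_sqrtr ?(ltW K00)//; field.
have eup : {ae P, forall w, continuous (forward_path w) /\ exists n0 : nat, forall n t i, (n0 <= n)%N ->
    n%:R * h <= t -> t <= n.+1%:R * h -> `|forcing_incr A (forward_path w) (n%:R * h) t i 0| <= Y0}.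
  by apply: ae_blocks_eventually_le => //; rewrite Y0E.
have edev : {ae P, forall w, forall k : nat, exists C, forall N,
    \sum_(n < N) (\1_(dev (k.+1%:R^-1) n) w : R) / n.+1%:R <= C}.
  by apply: ae_foralln => k; apply: ae_dev_sum HK; rewrite ?invr_gt0.
apply: filterS3 ae_good eup edev => w gw [cw [n0 hn0]] hdev; split=> //.
have [u [u0 bu umin]] := exists_block_sup A h0 cw.
exists u; split=> //.
(* A bound for all the blocks, including the finitely many exceptional ones. *)
pose Z := Y0 ^+ 2 + \sum_(n < n0) u n ^+ 2.
have Z0 : 0 <= Z by rewrite addr_ge0 ?sqr_ge0// sumr_ge0// => n _; exact: sqr_ge0.
have uZ n : u n ^+ 2 <= Z.
  have [nn|nn] := leqP n0 n.
    rewrite ler_wpDr ?sumr_ge0//; first by move=> i _; exact: sqr_ge0.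
    rewrite ler_pXn2r ?nnegrE ?(ltW Y00)//; apply: umin; first exact: ltW.
    by move=> t i; exact: hn0.
  rewrite /Z (bigD1 (Ordinal nn))//= addrCA lerDl addr_ge0 ?sqr_ge0// sumr_ge0//.
  by move=> i _; exact: sqr_ge0.
apply/cvgrPdist_le => e e0.
have e2 : 0 < e / 2 by rewrite divr_gt0.
have [k [_ hk]] := exists_block e2 (@ler01 R).
pose y : R := k.+1%:R^-1.
have y0 : 0 < y by rewrite invr_gt0.
have y2 : y ^+ 2 <= e / 2.
  apply: (@le_trans _ _ y).
    by rewrite expr2 ler_piMl ?(ltW y0)// invf_le1// ler1n.
  by rewrite -[leRHS]mul1r -[y]mul1r ler_pdivrMr// mul1r mulrC ltW.
have [C hC] := hdev k.
have eZ : 0 < e / 2 / (Z + 1) by rewrite divr_gt0// ltr_wpDl.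
have a0 n : 0 <= \1_(dev y n) w :> R by [].
have a1 n : \1_(dev y n) w <= 1 :> R by rewrite indicE; case: (_ \in _).
have [N0 hN0] := kronecker_bounded a0 a1 hC eZ.
exists N0.+1 => // N /= N0N.
have NR : 0 < N%:R :> R by rewrite ltr0n (leq_ltn_trans _ N0N).
have S0 : 0 <= \sum_(n < N) u n ^+ 2 by apply: sumr_ge0 => n _; exact: sqr_ge0.
rewrite sub0r normrN ger0_norm; last by rewrite mulr_ge0 ?invr_ge0// ltW.
rewrite mulrC ler_pdivrMr//.
apply: (@le_trans _ _ (\sum_(n < N) (e / 2 + Z * \1_(dev y n) w))).
  apply: ler_sum => n _; rewrite indicE; case: (boolP (w \in dev y n)) => [_|nd].
    by rewrite mulr1 ler_wpDl ?(ltW e2).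
  rewrite mulr0 addr0 (le_trans _ y2)// ler_pXn2r ?nnegrE ?(ltW y0)//.
  apply: umin; first exact: ltW.
  by move=> t i; apply: dev_path => // /mem_set; exact/negP.
rewrite big_split/= sumr_const card_ord -[X in X + _]mulr_natr -mulr_sumr.
apply: (@le_trans _ _ (e / 2 * N%:R + Z * (e / 2 / (Z + 1) * N%:R))).
  by rewrite lerD2l ler_wpM2l// hN0// ltnW.
rewrite [leRHS](_ : _ = e / 2 * N%:R + e / 2 * N%:R); last by field.
rewrite lerD2l mulrA ler_pM2r// mulrCA ler_piMr ?(ltW e2)//.
by rewrite ler_pdivrMr ?ltr_wpDl// mul1r lerDl.
Qed.

End Version.

End Solution.

(** * Almost sure behaviour of the solution *)

(** If the norm exceeded [e] from time [T] on, the average of its square would be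
    at least [e ^+ 2 / 2] from time [2 * T] on. *)
Lemma average_liminf (R : realType) (d : nat) (x : R -> 'cV[R]_d) : continuous x ->
  (forall e, 0 < e -> exists2 T, 0 < T & forall t, T <= t ->
    t^-1 * primitive (fun s => fnorm (x s) ^+ 2) t <= e) ->
  forall e T, 0 < e -> exists2 t, T <= t & fnorm (x t) <= e.
Proof.
move=> cx avg e T0 e0; apply: contrapT => /forall2NP H.
pose T := Num.max 0 T0; have T_ge0 : 0 <= T by rewrite le_max lexx.
have big t : T <= t -> e ^+ 2 <= fnorm (x t) ^+ 2.
  rewrite ge_max => /andP[_ Tt]; have [//|/negP] := H t.
  by rewrite -ltNge => /ltW et; rewrite ler_pXn2r ?nnegrE ?sqrtr_ge0// ltW.
have e20 : 0 < e ^+ 2 by rewrite exprn_gt0.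
have e40 : 0 < e ^+ 2 / 4 by rewrite divr_gt0.
have [S S0 hS] := avg _ e40.
pose t := Num.max S (2 * T).
have St : S <= t by rewrite le_max lexx.
have Tt2 : 2 * T <= t by rewrite le_max lexx orbT.
have t0 : 0 < t by exact: lt_le_trans St.
have Tt : T <= t by rewrite (le_trans _ Tt2)// ler_peMl// ler1n.
pose f (s : R) := fnorm (x s) ^+ 2.
have cf : continuous f by exact: continuous_fnorm2.
have f0 s : 0 <= f s by exact: sqr_ge0.
have low : e ^+ 2 * (t - T) <= primitive f t.
  apply: (@le_trans _ _ (primitive f t - primitive f T)); last first.
    by rewrite gerBl; apply: Rintegral_ge0.
  rewrite primitiveB//.
  apply: (@le_trans _ _ (\int[lebesgue_measure]_(s in `]T, t]) (e ^+ 2))).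
    rewrite Rintegral_cst// /= lebesgue_measure_itv/= lte_fin.
    by case: ltP => [_|tT]; rewrite ?EFinB//= mulr0 mulr_ge0_le0 ?subr_le0// ltW.
  apply: le_Rintegral => //.
  - apply: continuous_integrable_oc; exact: cst_continuous.
  - exact: continuous_integrable_oc.
  - by move=> s /=; rewrite in_itv/= => /andP[Ts _]; apply: big; exact: ltW.
have := hS t St; rewrite -/f mulrC ler_pdivrMr// => up.
have := le_trans low up; apply/negP; rewrite -ltNge.
rewrite -mulrA ltr_pM2l// mulrC; lra.
Qed.

Section AlmostSure.
Context (R : realType) (disp : measure_display)
    (T : measurableType disp) (P : probability T R) (d r : nat)
    (Fi : R -> set (set T)) (B : R -> T -> 'cV[R]_r)
    (sigma : R -> 'M[R]_(d, r)) (A : 'M[R]_d) (X : 'cV[R]_d -> R -> T -> 'cV[R]_d).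
Hypotheses (d_gt0 : (0 < d)%N) (hFi : filtration Fi) (hB : brownian_motion P Fi B)
  (hsigma : {within `[0, +oo[, continuous sigma}) (hA : stable_matrix A)
  (hX : forall xi, affine_sde_solution P Fi B A sigma xi (X xi)).
Variable c : R.
Hypothesis c0 : 0 < c.

Let h0 : 0 < c / 2. Proof. by rewrite divr_gt0. Qed.

Lemma forward_pathE xi w t : 0 <= t -> forward_path (X xi) w t = X xi t w.
Proof. by move=> t0; rewrite /forward_path max_l. Qed.

Lemma ae_eventually_le : exists2 C, 0 < C & forall eps, 0 < eps ->
  (Ic sigma c eps < +oo)%E -> forall xi,
  {ae P, forall w, exists T0, forall t, T0 <= t -> fnorm (X xi t w) <= C * eps}.
Proof.
have [C C0 HC] := path_eventually_le d_gt0 hA h0.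
exists (4 * C) => [|eps eps0 Ifin xi]; first by rewrite mulr_gt0.
have [Y [hY hXY]] := exists_version (hX xi).
have y0 : 0 < 4 * eps by rewrite mulr_gt0.
(* The weight of the deviation [4 * eps] is the one that [Ic_finite_sum] sums. *)
have yE : (4 * eps) ^+ 2 / 16 = eps ^+ 2 by field.
have := @ae_blocks_eventually_le R disp T P d r Fi B hFi hB sigma hsigma A xi (X xi) (hX xi)
  (c / 2) h0 Y hY hXY (4 * eps) y0.
rewrite yE => /(_ (Ic_finite_sum hsigma c0 eps0 Ifin)); apply: filterS => w [cw hw].
have [T0 hT0] := HC _ _ cw y0 hw.
exists (Num.max 0 T0) => t; rewrite ge_max => /andP[t0 Tt].
by rewrite -forward_pathE// (le_trans (hT0 t Tt))// mulrCA mulrA.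
Qed.

Lemma ae_infinitely_often_ge : exists2 k, 0 < k & forall eps, 0 < eps ->
  Ic sigma c eps = +oo%E -> forall xi,
  {ae P, forall w, forall T0, exists2 t, T0 <= t & k * eps <= fnorm (X xi t w)}.
Proof.
have [k k0 Hk] := path_infinitely_often_ge A c0.
have dR : 0 < d%:R :> R by rewrite ltr0n.
have sd : 0 < Num.sqrt d%:R :> R by rewrite sqrtr_gt0.
(* The deviation [eps / D] has the weight of [sum_Ic_finite]. *)
pose D : R := 32 * Num.sqrt d%:R.
have D0 : 0 < D by rewrite mulr_gt0.
exists (k / D) => [|eps eps0 Iinf xi]; first by rewrite divr_gt0.
have [Y [hY hXY]] := exists_version (hX xi).
have y0 : 0 < eps / D by rewrite divr_gt0.
have yE : 256 * d%:R * (eps / D) ^+ 2 = eps ^+ 2 / 4.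
  rewrite -[in LHS](sqr_sqrtr (ltW dR)) /D; field; rewrite gt_eqF//.
have hdiv M : exists N, M < \sum_(n < N) gauss_weight (256 * d%:R * (eps / D) ^+ 2) (block_energy sigma c n).
  apply: contrapT => /forallNP nM; have : (Ic sigma c eps < +oo)%E; last by rewrite Iinf.
  apply: (sum_Ic_finite hsigma c0 eps0); exists M => N.
  by rewrite -yE leNgt; apply/negP; exact: nM.
have := @ae_blocks_infinitely_often_gt R disp T P d r Fi B hFi hB sigma hsigma d_gt0 A xi (X xi) (hX xi)
  c c0 Y hY hXY (eps / D) y0 hdiv.
apply: filterS => w [cw hw] T0.
have [t Tt kt] := Hk _ _ cw y0 hw (Num.max 0 T0).
move: Tt; rewrite ge_max => /andP[t0 Tt]; exists t => //.
by rewrite -forward_pathE// (le_trans _ kt)// -mulrA [_^-1 * _]mulrC.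
Qed.

Lemma ae_average eps : 0 < eps -> (Ic sigma c eps < +oo)%E -> forall xi,
  {ae P, forall w, (forall e, 0 < e -> exists2 T0, 0 < T0 & forall t, T0 <= t ->
      t^-1 * \int[lebesgue_measure]_(s in `[0, t]) (fnorm (X xi s w) ^+ 2) <= e) /\
    (forall e T0, 0 < e -> exists2 t, T0 <= t & fnorm (X xi t w) <= e)}.
Proof.
move=> eps0 Ifin xi; have [Y [hY hXY]] := exists_version (hX xi).
have eps20 : 0 < eps ^+ 2 by rewrite exprn_gt0.
have := @ae_blocks_average R disp T P d r Fi B hFi hB sigma hsigma A xi (X xi) (hX xi)
  (c / 2) h0 Y hY hXY (eps ^+ 2) eps20 (Ic_finite_sum hsigma c0 eps0 Ifin).
apply: filterS => w [cw [u [u0 bu avg]]].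
have pavg := path_average_le d_gt0 hA h0 cw u0 bu avg.
split=> [e e0|e T0 e0].
  have [T0 T00 hT0] := pavg e e0; exists T0 => // t Tt.
  rewrite (le_trans _ (hT0 t Tt))// le_eqVlt; apply/orP; left; apply/eqP.
  congr (_ * _); apply: eq_Rintegral => s; rewrite inE/= in_itv/= => /andP[s0 _].
  by rewrite forward_pathE.
have [t] := average_liminf cw pavg (Num.max 0 T0) e0.
by rewrite ge_max => /andP[t0 Tt]; rewrite forward_pathE// => te; exists t.
Qed.

End AlmostSure.

Theorem theorem6 (R : realType) (disp : measure_display)
    (T : measurableType disp) (P : probability T R) (d r : nat)
    (d_gt0 : (0 < d)%N) (r_gt0 : (0 < r)%N)
    (Fi : R -> set (set T)) (hFi : filtration Fi)
    (B : R -> T -> 'cV[R]_r) (hB : brownian_motion P Fi B)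
    (sigma : R -> 'M[R]_(d, r))
    (hsigma : {within `[0, +oo[, continuous sigma})
    (A : 'M[R]_d) (hA : stable_matrix A)
    (X : 'cV[R]_d -> R -> T -> 'cV[R]_d)
    (hX : forall xi, affine_sde_solution P Fi B A sigma xi (X xi))
    (c : R) (c_gt0 : 0 < c) :
  [/\ (* (A) *)
      (forall eps, 0 < eps -> (Ic sigma c eps < +oo)%E) ->
      forall xi, {ae P, forall w, X xi t w @[t --> +oo] --> (0 : 'cV[R]_d)},
      (* (B) *)
      (exists2 eps' : R, 0 < eps' &
        (forall eps, eps' < eps -> (Ic sigma c eps < +oo)%E) /\
        (forall eps, 0 < eps -> eps < eps' -> Ic sigma c eps = +oo%E)) ->
      (exists c1 c2 : R, [/\ 0 < c1, c1 <= c2 &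
        forall xi, {ae P, forall w,
          (c1%:E <= limf_esup (fun t => (fnorm (X xi t w))%:E) (+oo%R : set_system R)
             <= c2%:E)%E}]) /\
      (forall xi, {ae P, forall w,
         limf_einf (fun t => (fnorm (X xi t w))%:E) (+oo%R : set_system R) = 0%E /\
         t^-1 * \int[lebesgue_measure]_(s in `[0, t]) (fnorm (X xi s w) ^+ 2)
           @[t --> +oo] --> (0 : R)})
    & (* (C) *)
      (forall eps, 0 < eps -> Ic sigma c eps = +oo%E) ->
      forall xi, {ae P, forall w,
        limf_esup (fun t => (fnorm (X xi t w))%:E) (+oo%R : set_system R) = +oo%E}].
Proof.
have [C C0 up] := ae_eventually_le d_gt0 hFi hB hsigma hA hX c_gt0.
have [k k0 low] := ae_infinitely_often_ge d_gt0 hFi hB hsigma hX c_gt0.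
have fn0 xi t w : 0 <= fnorm (X xi t w) by exact: sqrtr_ge0.
split.
- move=> Ifin xi.
  have : {ae P, forall w, forall n : nat, exists T0, forall t, T0 <= t ->
      fnorm (X xi t w) <= C * n.+1%:R^-1}.
    by apply: ae_foralln => n; apply: up; [rewrite invr_gt0|apply: Ifin; rewrite invr_gt0].
  apply: filterS => w hw; apply/cvgrPdist_le => e e0.
  have [n [_ hn]] := exists_block e0 (ltW C0).
  have [T0 hT0] := hw n.
  have near_T0 : \forall t \near +oo, T0 <= t by exact: nbhs_pinfty_ge (num_real T0).
  apply: filterS near_T0 => t Tt; rewrite sub0r normrN.
  have ft : fnorm (X xi t w) <= e.
    rewrite (le_trans (hT0 t Tt))//.
    by rewrite ler_pdivrMr// mulrC ltW.
  rewrite /Num.norm/= mx_normrE; apply: bigmax_le => [|[i j] _]; first exact: ltW.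
  by rewrite (le_trans (entry_le_fnorm _ i j)).
- move=> [eps' eps'0 [Ifin Iinf]].
  have e10 : eps' < eps' + 1 by rewrite ltrDl.
  have e1 : 0 < eps' + 1 by exact: lt_trans e10.
  have e20 : 0 < eps' / 2 by rewrite divr_gt0.
  have e2 : eps' / 2 < eps' by rewrite ltr_pdivrMr// ltr_pMr// ltr1n.
  split.
    have c20 : 0 < C * (eps' + 1) by rewrite mulr_gt0.
    have c10 : 0 < k * (eps' / 2) by rewrite mulr_gt0.
    exists (Num.min (k * (eps' / 2)) (C * (eps' + 1))), (C * (eps' + 1)).
    split; [by rewrite lt_min c10|by rewrite ge_min lexx orbT|move=> xi].
    apply: filterS2 (up _ e1 (Ifin _ e10) xi) (low _ e20 (Iinf _ e20 e2) xi) => w [T0 hT0] hlow.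
    apply/andP; split; last exact: (limf_esup_le hT0).
    apply: limf_esup_ge => T1; have [t Tt ht] := hlow T1; exists t => //.
    by rewrite (le_trans _ ht)// ge_min lexx.
  move=> xi; have := ae_average d_gt0 hFi hB hsigma hA hX c_gt0 e1 (Ifin _ e10) xi.
  apply: filterS => w [avg linf]; split; first exact: limf_einf0.
  apply/cvgrPdist_le => e e0; have [T0 T00 hT0] := avg e e0.
  have near_T0 : \forall t \near +oo, T0 <= t by exact: nbhs_pinfty_ge (num_real T0).
  apply: filterS near_T0 => t Tt; rewrite sub0r normrN ger0_norm; first exact: hT0.
  apply: mulr_ge0; first by rewrite invr_ge0 (le_trans (ltW T00)).
  by apply: Rintegral_ge0 => s _; exact: sqr_ge0.
- move=> Iinf xi.
  have : {ae P, forall w, forall n : nat, forall T0, exists2 t, T0 <= t &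
      k * n.+1%:R <= fnorm (X xi t w)}.
    by apply: ae_foralln => n; apply: low => //; exact: Iinf.
  apply: filterS => w hw; apply: eq_infty => a.
  have [n [_ hn]] := exists_block k0 (normr_ge0 a).
  apply: (@le_trans _ _ (k * n.+1%:R)%:E); last exact: limf_esup_ge.
  by rewrite lee_fin (le_trans (ler_norm a))// mulrC ltW.
Qed.
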